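(* Let $n\ge3$, let $p$ be a positive real number, let $U\subset\mathbb{R}^n$ be a domain and suppose $g:U\to Cl_n$ is a weak solution of the $p$-Dirac equation $D\|g\|^{p-2}g=0$ on $U$. Let $y=M(x)=(ax+b)(cx+d)^{-1}$ be a Möbius transformation (with $a,b,c,d\in Cl_n$ satisfying conditions (i)-(iii) of the context) with $cx+d$ non-zero on the closure of $M^{-1}(U)$. Then $(cx+d)^{-1}g(M(x))$ is a weak solution to the $A,p$-Dirac equation on $M^{-1}(U)$, with $A(x)=\|cx+d\|^{p-n}$.
   Context: $Cl_n$ is the real associative Clifford algebra of dimension $2^n$ generated by an orthonormal basis $e_1,\dots,e_n$ of $\mathbb{R}^n\subset Cl_n$ with $e_ie_j+e_je_i=-2\delta_{ij}$ (so $x^2=-\|x\|^2$ for $x\in\mathbb{R}^n$). A basis of $Cl_n$ is given by $1$ and the products $e_{j_1}\cdots e_{j_r}$, $j_1<\dots<j_r$, $1\le r\le n$; $\|A\|$ is the Euclidean norm of the coefficients of $A\in Cl_n$ in this basis. Reversion $A\mapsto\tilde A$ is the linear anti-automorphism with $e_{j_1}\cdots e_{j_r}\mapsto e_{j_r}\cdots e_{j_1}$; conjugation $A\mapsto\overline{A}$ is the linear anti-automorphism with $e_{j_1}\cdots e_{j_r}\mapsto(-1)^re_{j_r}\cdots e_{j_1}$. The Dirac operator is $D=\sum_{j=1}^n e_j\frac{\partial}{\partial x_j}$, acting from the left on $Cl_n$-valued functions. A $Cl_n$-valued test function on an open set has components in $C_0^\infty$ of that set. A function $g:U\to Cl_n$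 is a weak solution to the $p$-Dirac equation on $U$ if $g\in L^p_{loc}(U)$ (componentwise) and $\int_U\overline{\|g\|^{p-2}g}\,D\eta\,dx^n=0$ for every $Cl_n$-valued test function $\eta$ on $U$. For an open set $V\subset\mathbb{R}^n$ and a smooth bounded function $A:V\to\mathbb{R}^+$, a function $g:V\to Cl_n$ is a weak solution to the $A,p$-Dirac equation $D\,\|g\|^{p-2}A(x)g(x)=0$ on $V$ if $g\in L^p_{loc}(V)$ and $\int_V\overline{A(x)\|g(x)\|^{p-2}g(x)}\,D\eta(x)\,dx^n=0$ for every $Cl_n$-valued test function $\eta$ on $V$. Möbius transformations of $\mathbb{R}^n\cup\{\infty\}$ are written as $M(x)=(ax+b)(cx+d)^{-1}$ with $a,b,c,d\in Cl_n$ such that (i) $a,b,c,d$ are all products of vectors of $\mathbb{R}^n$; (ii) $\tilde a c,\ \tilde c d,\ \tilde d b,\ \tilde b a\in\mathbb{R}^n$; (iii) $\tilde a d-\tilde c b=1$. For $x\in\mathbb{R}^n$ with $cx+d\neq0$, $cx+d$ is a product of non-zero vectors, hence invertible in $Cl_n$. $M^{-1}(U)$ denotes $\{x\in\mathbb{R}^n: cx+d\ne 0,\ M(x)\in U\}$.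
   Formalization: The context requires A to be bounded, but A(x)=‖cx+d‖^{p-n} is unbounded when p>n, c≠0 and M^{-1}(U) is unbounded; boundedness of A is claimed only if p≤n, M^{-1}(U) is bounded or c=0, while the weak equation is claimed always. *)

(* Defs.v *)
From HB Require Import structures.
From mathcomp Require Import all_boot all_order all_algebra.
From mathcomp Require Import ring.
From mathcomp Require Import all_classical all_reals all_analysis.

Set Implicit Arguments.
Unset Strict Implicit.
Unset Printing Implicit Defensive.
Import Order.TTheory GRing.Theory Num.Theory.
Import numFieldNormedType.Exports.

Local Open Scope classical_set_scope.
Local Open Scope ring_scope.

Definition row_display : measure_display -> measure_display.
Proof. exact. Qed.

Section RowVectorMeasurable.
Context {R : realType} (n : nat).

Definition row_coord (i : 'I_n) (v : 'rV[R]_n) : measurableTypeR R := v ord0 i.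

Let row_set0 : g_sigma_preimage row_coord set0.
Proof. exact: sigma_algebra0. Qed.

Let row_setC A : g_sigma_preimage row_coord A -> g_sigma_preimage row_coord (~` A).
Proof. exact: sigma_algebraC. Qed.

Let row_bigcup (F : (set 'rV[R]_n)^nat) :
  (forall i, g_sigma_preimage row_coord (F i)) ->
  g_sigma_preimage row_coord (\bigcup_i (F i)).
Proof. exact: sigma_algebra_bigcup. Qed.

HB.instance Definition _ :=
  @isMeasurable.Build (row_display default_measure_display)
    'rV[R]_n (g_sigma_preimage row_coord) row_set0 row_setC row_bigcup.

End RowVectorMeasurable.

Section RowVectorMeasurableFun.
Context {R : realType}.

Lemma measurable_row_coord n (i : 'I_n) :
  measurable_fun [set: 'rV[R]_n] (row_coord i).
Proof.
move=> _ Y mY; rewrite setTI; apply: sub_sigma_algebra => /=.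
rewrite -bigcup_seq/=; exists i => /=; first by rewrite mem_index_enum.
by exists Y => //; rewrite setTI.
Qed.

Lemma measurable_rowP d (T : measurableType d) n (f : T -> 'rV[R]_n) :
  (forall i, measurable_fun [set: T] (row_coord i \o f)) ->
  measurable_fun [set: T] f.
Proof.
move=> mf; have : g_sigma_preimage (fun i => row_coord i \o f) `<=` measurable.
  apply: smallest_sub; first exact: sigma_algebra_measurable.
  case: n => [|n] in f mf *; first by rewrite big_ord0.
  rewrite -bigcup_mkord_ord; apply: bigcup_sub => i Ii.
  by move=> A [B mB <-]; exact: mf.
by rewrite g_sigma_preimage_comp => prefS _ A mA; apply: prefS; exists A.
Qed.

Definition row_cons n (xv : measurableTypeR R * 'rV[R]_n) : 'rV[R]_n.+1 :=
  \row_i oapp (xv.2 ord0) xv.1 (unlift ord0 i).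

Definition row_uncons n (w : 'rV[R]_n.+1) : measurableTypeR R * 'rV[R]_n :=
  (w ord0 ord0, \row_i w ord0 (lift ord0 i)).

Lemma row_cons0 n (xv : measurableTypeR R * 'rV[R]_n) :
  row_cons xv ord0 ord0 = xv.1.
Proof. by rewrite mxE unlift_none. Qed.

Lemma row_consS n (xv : measurableTypeR R * 'rV[R]_n) i :
  row_cons xv ord0 (lift ord0 i) = xv.2 ord0 i.
Proof. by rewrite mxE liftK. Qed.

Lemma row_consK n : cancel (@row_cons n) (@row_uncons n).
Proof.
move=> [x v]; rewrite /row_uncons row_cons0/=; congr (_, _).
by apply/rowP => i; rewrite mxE row_consS.
Qed.

Lemma measurable_row_cons n : measurable_fun setT (@row_cons n).
Proof.
apply: measurable_rowP => i; case: (unliftP ord0 i) => [j|] ->.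
  rewrite (_ : _ \o _ = row_coord j \o snd); last first.
    by apply/funext => xv /=; rewrite /row_coord row_consS.
  by apply: measurableT_comp => //; exact: measurable_row_coord.
by rewrite (_ : _ \o _ = fst)//; apply/funext => xv; exact: row_cons0.
Qed.

Lemma measurable_row_uncons n : measurable_fun setT (@row_uncons n).
Proof.
apply/measurable_fun_pairP; split; first exact: (measurable_row_coord ord0).
apply: measurable_rowP => i.
rewrite (_ : _ \o _ = row_coord (lift ord0 i)); first exact: measurable_row_coord.
by apply/funext => w; rewrite /= /row_coord mxE.
Qed.

Section Step.
Context n (mu : {sigma_finite_measure set 'rV[R]_n -> \bar R}).

Definition row_cons_measure : set 'rV[R]_n.+1 -> \bar R :=
  pushforward (@lebesgue_measure R \x mu)%E (@row_cons n).

Let measurable_preimage A : measurable A -> measurable (@row_cons n @^-1` A).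
Proof.
by move=> mA; rewrite -[X in measurable X]setTI; exact: measurable_row_cons.
Qed.

Let row_cons_measure0 : row_cons_measure set0 = 0%E.
Proof. by rewrite /row_cons_measure /pushforward preimage_set0 measure0. Qed.

Let row_cons_measure_ge0 A : (0 <= row_cons_measure A)%E.
Proof. by rewrite /row_cons_measure /pushforward; exact: measure_ge0. Qed.

Let row_cons_measure_sigma_additive : semi_sigma_additive row_cons_measure.
Proof.
move=> F mF tF mUF; rewrite /row_cons_measure /pushforward preimage_bigcup.
apply: measure_semi_sigma_additive.
- by move=> i; exact: measurable_preimage.
- apply/trivIsetP => /= i j _ _ ij; rewrite -preimage_setI.
  by move/trivIsetP : tF => /(_ _ _ _ _ ij) ->//; rewrite preimage_set0.
- by rewrite -preimage_bigcup; exact: measurable_preimage.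
Qed.

HB.instance Definition _ := isMeasure.Build _ _ _ row_cons_measure
  row_cons_measure0 row_cons_measure_ge0 row_cons_measure_sigma_additive.

Let row_cons_measure_sigma_finite : sigma_finite setT row_cons_measure.
Proof.
have /sigma_finiteP[F [TF ndF Foo]] := sigma_finiteT (@lebesgue_measure R).
have /sigma_finiteP[G [TG ndG Goo]] := sigma_finiteT mu.
exists (fun k => @row_uncons n @^-1` (F k `*` G k)).
  apply/seteqP; split => // w _.
  have [i _ Fi] : (\bigcup_i F i) (row_uncons w).1 by rewrite -TF.
  have [j _ Gj] : (\bigcup_i G i) (row_uncons w).2 by rewrite -TG.
  exists (maxn i j) => //; split.
    by move: Fi; exact/subsetPset/ndF/leq_maxl.
  by move: Gj; exact/subsetPset/ndG/leq_maxr.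
move=> k; have [[mF Fk] [mG Gk]] := (Foo k, Goo k); split.
  rewrite -[X in measurable X]setTI.
  by apply: measurable_row_uncons => //; exact: measurableX.
rewrite /row_cons_measure /pushforward -comp_preimage.
rewrite (_ : _ \o _ = id); last by apply/funext; exact: row_consK.
by rewrite preimage_id product_measure1E// lte_mul_pinfty// ge0_fin_numE.
Qed.

HB.instance Definition _ := Measure_isSigmaFinite.Build _ _ _ row_cons_measure
  row_cons_measure_sigma_finite.

End Step.

Fixpoint borel_lebesgue n : {sigma_finite_measure set 'rV[R]_n -> \bar R} :=
  if n is m.+1 then row_cons_measure (borel_lebesgue m)
  else \d_ (0 : 'rV[R]_0).

Lemma measurable_row_box n (B : 'I_n -> set (measurableTypeR R)) :
  (forall i, measurable (B i)) ->
  measurable [set v : 'rV[R]_n | forall i, B i (v ord0 i)].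
Proof.
move=> mB; have -> : [set v : 'rV[R]_n | forall i, B i (v ord0 i)] =
    \bigcap_(i in setT) (row_coord i @^-1` B i).
  by apply/seteqP; split => [v vB i _|v vB i]; [exact: vB|exact: (vB i I)].
apply: fin_bigcap_measurable => // i _.
by rewrite -[X in measurable X]setTI; exact: measurable_row_coord.
Qed.

Lemma borel_lebesgue_box n (B : 'I_n -> set (measurableTypeR R)) :
  (forall i, measurable (B i)) ->
  borel_lebesgue n [set v | forall i, B i (v ord0 i)] =
  (\prod_(i < n) lebesgue_measure (B i))%E.
Proof.
elim: n B => [|n IHn] B mB.
  by rewrite big_ord0 /= diracE mem_set// => -[].
rewrite big_ord_recl -(IHn (fun i => B (lift ord0 i)))//.
rewrite -product_measure1E//; last first.
  exact: (@measurable_row_box _ (fun i => B (lift ord0 i))).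
rewrite /= /row_cons_measure /pushforward; apply: congr1.
apply/seteqP; split => [xv xvB|xv [xB vB] i] /=.
  split => [|i]; first by rewrite -(row_cons0 xv); exact: xvB.
  by rewrite -row_consS; exact: xvB.
by case: (unliftP ord0 i) => [j|] ->; rewrite ?row_consS ?row_cons0.
Qed.

End RowVectorMeasurableFun.

(* R^n with the Lebesgue (Caratheodory) sigma-algebra; convertible to 'rV[R]_n. *)
Definition lebesgueT (R : realType) (n : nat) :=
  caratheodory_type (borel_lebesgue (R := R) n)^*%mu.

Definition lebesgue (R : realType) (n : nat) :
    {measure set (lebesgueT R n) -> \bar R} :=
  @completed_measure_extension _ _ _ (borel_lebesgue n).

Lemma lebesgue_box (R : realType) n (B : 'I_n -> set (measurableTypeR R)) :
  (forall i, measurable (B i)) ->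
  lebesgue R n [set v : 'rV[R]_n | forall i, B i (v ord0 i)] =
  (\prod_(i < n) lebesgue_measure (B i))%E.
Proof.
move=> mB; rewrite -borel_lebesgue_box//.
by apply: measurable_mu_extE; exact: measurable_row_box.
Qed.

(* The coefficient [x A] is the one of e_{j_1} ... e_{j_r}, where
   A = {j_1 < ... < j_r}; see [cl_basisE] and [cl_basis_sum]. *)
Definition clifford (R : realType) (n : nat) := {ffun {set 'I_n} -> R}.

Section CliffordRing.
Context {R : realType} {n : nat}.
Local Notation Cl := (clifford R n).
Implicit Types (A B C : {set 'I_n}) (x y z : Cl).

HB.instance Definition _ :=
  GRing.Lmodule.copy Cl {ffun {set 'I_n} -> R^o}.

Definition cl_symdiff A B : {set 'I_n} := [set i | (i \in A) (+) (i \in B)].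

(* e_A e_B = cl_sign A B e_{A symdiff B}: each pair (a, b) with b < a contributes
   a transposition, each common index a factor e_a^2 = -1. *)
Definition cl_sign A B : R :=
  \prod_(a in A) \prod_(b in B | (b <= a)%N) (-1).

Definition cl_basis A : Cl := [ffun B => (B == A)%:R].

Definition cl_mul x y : Cl :=
  [ffun C => \sum_A \sum_(B | cl_symdiff A B == C) cl_sign A B * x A * y B].

Lemma cl_symdiffC A B : cl_symdiff A B = cl_symdiff B A.
Proof. by apply/setP => i; rewrite !inE addbC. Qed.

Lemma cl_symdiffA A B C :
  cl_symdiff A (cl_symdiff B C) = cl_symdiff (cl_symdiff A B) C.
Proof. by apply/setP => i; rewrite !inE addbA. Qed.

Lemma cl_symdiff0 A : cl_symdiff A finset.set0 = A.
Proof. by apply/setP => i; rewrite !inE addbF. Qed.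

Lemma cl_symdiffK A : involutive (cl_symdiff A).
Proof. by move=> B; apply/setP => i; rewrite !inE addbA addbb. Qed.

Let prod_symdiff (f : 'I_n -> R) A B : (forall i, f i * f i = 1) ->
  \prod_(i in cl_symdiff A B) f i = \prod_(i in A) f i * \prod_(i in B) f i.
Proof.
move=> ff; rewrite big_mkcond [X in _ = X * _]big_mkcond.
rewrite [X in _ = _ * X]big_mkcond -big_split/=.
by apply: eq_bigr => i _; rewrite inE; do 2![case: (i \in _)];
  rewrite ?mulr1 ?mul1r.
Qed.

Let sqr1_prod (I : finType) (P : pred I) (f : I -> R) :
  (forall i, f i * f i = 1) -> (\prod_(i | P i) f i) * (\prod_(i | P i) f i) = 1.
Proof. by move=> ff; rewrite -big_split/= big1. Qed.

Lemma cl_sign_symdiffl A B C :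
  cl_sign (cl_symdiff A B) C = cl_sign A C * cl_sign B C.
Proof. by apply: prod_symdiff => i; apply: sqr1_prod => _; rewrite mulrNN mulr1. Qed.

Lemma cl_sign_symdiffr A B C :
  cl_sign A (cl_symdiff B C) = cl_sign A B * cl_sign A C.
Proof.
rewrite /cl_sign -big_split/=; apply: eq_bigr => a _.
rewrite !big_mkcondr; apply: prod_symdiff => i.
by case: ifP; rewrite ?mulrNN mulr1.
Qed.

Lemma cl_sign_sqr A B : cl_sign A B * cl_sign A B = 1.
Proof. by do 2!apply: sqr1_prod => ?; rewrite mulrNN mulr1. Qed.

Lemma cl_sign0l A : cl_sign finset.set0 A = 1.
Proof. by rewrite /cl_sign big_set0. Qed.

Lemma cl_sign0r A : cl_sign A finset.set0 = 1.
Proof. by rewrite /cl_sign big1// => a _; rewrite big1// => b; rewrite inE. Qed.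

Let cl_mulE x y C :
  cl_mul x y C = \sum_A cl_sign A (cl_symdiff A C) * x A * y (cl_symdiff A C).
Proof.
rewrite ffunE; apply: eq_bigr => A _; apply: (big_pred1 (cl_symdiff A C)) => B.
by rewrite -(inj_eq (can_inj (cl_symdiffK A))) cl_symdiffK.
Qed.

Let cl_mulA : associative cl_mul.
Proof.
move=> x y z; apply/ffunP => E; rewrite !cl_mulE.
under [RHS]eq_bigr do rewrite cl_mulE mulr_sumr mulr_suml.
rewrite [RHS]exchange_big/=; apply: eq_bigr => A _.
rewrite cl_mulE mulr_sumr (reindex_inj (can_inj (cl_symdiffK A)))/=.
apply: eq_bigr => D _; set F := cl_symdiff (_ A D) (_ A E).
have -> : F = cl_symdiff D E.
  by rewrite /F cl_symdiffA -(cl_symdiffA A D A) (cl_symdiffC D A) cl_symdiffK.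
have -> : cl_symdiff A E = cl_symdiff (cl_symdiff A D) (cl_symdiff D E).
  by rewrite -cl_symdiffA cl_symdiffK.
rewrite cl_sign_symdiffr [cl_sign (_ A D) (_ D E)]cl_sign_symdiffl.
set s := cl_sign A (cl_symdiff D E).
set t := cl_sign _ _; set u := cl_sign _ _.
have ss : s * s = 1 by exact: cl_sign_sqr.
rewrite !mulrA -[RHS]mul1r -[X in _ = X * _]ss; ring.
Qed.

Let cl_one : Cl := cl_basis finset.set0.

Let cl_mul1 : left_id cl_one cl_mul.
Proof.
move=> x; apply/ffunP => C; rewrite cl_mulE (bigD1 finset.set0)//= big1 => [|A A0].
  by rewrite cl_sign0l ffunE eqxx addr0 !mul1r cl_symdiffC cl_symdiff0.
by rewrite ffunE (negbTE A0) mulr0 mul0r.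
Qed.

Let cl_mulr1 : right_id cl_one cl_mul.
Proof.
move=> x; apply/ffunP => C; rewrite cl_mulE (bigD1 C)//= big1 => [|A AC].
  rewrite ffunE (_ : cl_symdiff C C = finset.set0) ?eqxx ?cl_sign0r ?mul1r ?mulr1 ?addr0//.
  by apply/setP => i; rewrite !inE addbb.
rewrite ffunE (_ : (_ == _) = false) ?mulr0//; apply: contraNF AC => /eqP AC0.
by rewrite -(cl_symdiff0 A) -AC0 cl_symdiffK.
Qed.

Lemma cl_addE x y A : (x + y) A = x A + y A.
Proof. by rewrite ffunE. Qed.

Lemma cl_scaleE (k : R) x A : (k *: x) A = k * x A.
Proof. by rewrite ffunE. Qed.

Lemma cl_sumE (I : Type) (r : seq I) (P : pred I) (F : I -> Cl) A :
  (\sum_(i <- r | P i) F i) A = \sum_(i <- r | P i) F i A.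
Proof.
by apply: (big_morph (fun x : Cl => x A)) => [x y|]; [exact: cl_addE|rewrite ffunE].
Qed.

Let cl_mulDl : left_distributive cl_mul +%R.
Proof.
move=> x y z; apply/ffunP => C; rewrite cl_mulE cl_addE !cl_mulE -big_split/=.
by apply: eq_bigr => A _; rewrite cl_addE mulrDr mulrDl.
Qed.

Let cl_mulDr : right_distributive cl_mul +%R.
Proof.
move=> x y z; apply/ffunP => C; rewrite cl_mulE cl_addE !cl_mulE -big_split/=.
by apply: eq_bigr => A _; rewrite cl_addE mulrDr.
Qed.

Let cl_one_neq0 : cl_one != 0.
Proof.
apply/eqP => /ffunP/(_ finset.set0); rewrite !ffunE eqxx; apply/eqP.
exact: oner_neq0.
Qed.

HB.instance Definition _ := GRing.Zmodule_isNzRing.Build Cl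
  cl_mulA cl_mul1 cl_mulr1 cl_mulDl cl_mulDr cl_one_neq0.

Lemma cl_mulrE x y C :
  (x * y) C = \sum_A cl_sign A (cl_symdiff A C) * x A * y (cl_symdiff A C).
Proof. exact: cl_mulE. Qed.

Let cl_scalerAl (k : R) x y : k *: (x * y) = k *: x * y.
Proof.
apply/ffunP => C; rewrite cl_scaleE !cl_mulrE mulr_sumr; apply: eq_bigr => A _.
by rewrite cl_scaleE; ring.
Qed.

HB.instance Definition _ := GRing.Lmodule_isLalgebra.Build R Cl cl_scalerAl.

Let cl_scalerAr (k : R) x y : k *: (x * y) = x * (k *: y).
Proof.
apply/ffunP => C; rewrite cl_scaleE !cl_mulrE mulr_sumr; apply: eq_bigr => A _.
by rewrite cl_scaleE; ring.
Qed.

HB.instance Definition _ := GRing.Lalgebra_isAlgebra.Build R Cl cl_scalerAr.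

(* The inverse is the genuine two-sided one; by convention it is the identity
   on non-invertible elements. *)
Let cl_unit : pred Cl := fun x => `[< exists y, y * x = 1 /\ x * y = 1 >].

Let cl_inv x : Cl := xget x [set y | y * x = 1 /\ x * y = 1].

Let cl_invP x : cl_unit x -> cl_inv x * x = 1 /\ x * cl_inv x = 1.
Proof. by move=> /asboolP[y yx]; rewrite /cl_inv; case: xgetP => // /(_ y). Qed.

Let cl_mulVr : {in cl_unit, left_inverse 1 cl_inv *%R}.
Proof. by move=> x /cl_invP[]. Qed.

Let cl_mulrV : {in cl_unit, right_inverse 1 cl_inv *%R}.
Proof. by move=> x /cl_invP[]. Qed.

Let cl_unitP x y : y * x = 1 /\ x * y = 1 -> cl_unit x.
Proof. by move=> xy; apply/asboolP; exists y. Qed.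

Let cl_inv_out : {in [predC cl_unit], cl_inv =1 id}.
Proof.
move=> x /asboolPn xN; rewrite /cl_inv; case: xgetP => // y _ yx.
by case: xN; exists y.
Qed.

HB.instance Definition _ := GRing.NzRing_hasMulInverse.Build Cl
  cl_mulVr cl_mulrV cl_unitP cl_inv_out.

Lemma cl_basisM A B :
  cl_basis A * cl_basis B = cl_sign A B *: cl_basis (cl_symdiff A B).
Proof.
apply/ffunP => C; rewrite cl_mulrE cl_scaleE (bigD1 A)//= big1 => [|D DA]; last first.
  by rewrite !ffunE (negbTE DA) mulr0 mul0r.
rewrite !ffunE eqxx mulr1 addr0.
have [->|CAB] := eqVneq C (cl_symdiff A B); first by rewrite cl_symdiffK eqxx.
rewrite (_ : (_ == _) = false) ?mulr0//; apply: contraNF CAB => /eqP <-.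
by rewrite cl_symdiffK.
Qed.

Definition cl_e (i : 'I_n) : Cl := cl_basis [set i]%SET.

Lemma cl_e_anticomm i j :
  cl_e i * cl_e j + cl_e j * cl_e i = (- 2 * (i == j)%:R)%:A.
Proof.
have s_e a b : cl_sign [set a]%SET [set b]%SET = (-1) ^+ (b <= a)%N.
  by rewrite /cl_sign big_set1 big_mkcondr big_set1; case: ifP.
rewrite !cl_basisM !s_e (cl_symdiffC [set j]%SET) -scalerDl.
have [->|ij] := eqVneq i j.
  rewrite leqnn !expr1 mulr1; congr (_ *: _); first by rewrite -opprD.
  by congr cl_basis; apply/setP => a; rewrite !inE addbb.
rewrite mulr0 scale0r; have [_|_|/val_inj/eqP] := ltngtP i j.
- by rewrite expr0 expr1 subrr scale0r.
- by rewrite expr0 expr1 addNr scale0r.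
- by rewrite (negbTE ij).
Qed.

Lemma cl_basisE A : cl_basis A = \prod_(i <- enum A) cl_e i.
Proof.
have : sorted (fun i j : 'I_n => (i < j)%N) (enum A).
  rewrite {1}/enum_mem -enumT; apply: sorted_filter.
    by move=> ? ? ?; exact: ltn_trans.
  by have := iota_ltn_sorted 0 n; rewrite -val_enum_ord sorted_map.
rewrite -[A in LHS]set_enum; elim: (enum A) => [|i s IHs] is_.
  by rewrite big_nil; congr cl_basis; apply/setP => a; rewrite !inE.
rewrite big_cons -IHs ?(path_sorted is_)// cl_basisM.
have ltis j : j \in s -> (i < j)%N.
  by move: j; apply/allP; apply: order_path_min is_ => ? ? ?; exact: ltn_trans.
have -> : cl_sign [set i]%SET [set j in s]%SET = 1.
  rewrite /cl_sign big_set1 big_pred0// => j; rewrite inE.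
  by apply/negbTE/negP => /andP[/ltis]; rewrite ltnNge => /negbTE ->.
rewrite scale1r; congr cl_basis; apply/setP => j; rewrite !inE.
by case: (eqVneq j i) => // ->; case: (boolP (i \in s)) => // /ltis; rewrite ltnn.
Qed.

Lemma cl_basis_sum x : x = \sum_A x A *: cl_basis A.
Proof.
apply/ffunP => B; rewrite cl_sumE (bigD1 B)//= big1 => [|A AB].
  by rewrite cl_scaleE ffunE eqxx addr0 mulr1.
by rewrite cl_scaleE ffunE eq_sym (negbTE AB) mulr0.
Qed.

End CliffordRing.

Section CliffordOperations.
Context {R : realType} {n : nat}.
Local Notation Cl := (clifford R n).
Implicit Types (x : Cl) (v : 'rV[R]_n).

Definition cl_rev x : Cl :=
  \sum_A x A *: \prod_(i <- rev (enum A)) cl_e i.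

Definition cl_conj x : Cl :=
  \sum_A x A *: ((-1) ^+ #|A| *: \prod_(i <- rev (enum A)) cl_e i).

Definition cl_norm x : R := Num.sqrt (\sum_A x A ^+ 2).

Definition cl_vec v : Cl := \sum_i v ord0 i *: cl_e i.

Definition cl_unvec x : 'rV[R]_n := \row_i x [set i]%SET.

Definition is_vector x : Prop := exists v, x = cl_vec v.

Definition is_vector_product x : Prop :=
  exists s : seq 'rV[R]_n, x = \prod_(v <- s) cl_vec v.

Lemma cl_vecK : cancel cl_vec cl_unvec.
Proof.
move=> v; apply/rowP => i; rewrite mxE cl_sumE (bigD1 i)//= big1 => [|j ji].
  by rewrite cl_scaleE ffunE eqxx addr0 mulr1.
by rewrite cl_scaleE ffunE (inj_eq set1_inj) eq_sym (negbTE ji) mulr0.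
Qed.

End CliffordOperations.

Section Moebius.
Context {R : realType} {n : nat}.
Local Notation Cl := (clifford R n).
Implicit Types (a b c d : Cl).

Definition moebius_coeffs a b c d : Prop :=
  [/\ [/\ is_vector_product a, is_vector_product b,
          is_vector_product c & is_vector_product d],
      [/\ is_vector (cl_rev a * c), is_vector (cl_rev c * d),
          is_vector (cl_rev d * b) & is_vector (cl_rev b * a)] &
      cl_rev a * d - cl_rev c * b = 1].

(* Under [moebius_coeffs] the Clifford number projected by [cl_unvec] is
   itself a vector whenever [c * cl_vec x + d != 0]. *)
Definition moebius a b c d (x : 'rV[R]_n) : 'rV[R]_n :=
  cl_unvec ((a * cl_vec x + b) * (c * cl_vec x + d)^-1).

Definition moebius_preimage a b c d (U : set 'rV[R]_n) : set 'rV[R]_n :=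
  [set x | c * cl_vec x + d != 0 /\ U (moebius a b c d x)].

End Moebius.

Section WeakSolutions.
Context {R : realType} {n : nat}.
Local Notation Cl := (clifford R n).
Implicit Types (U : set 'rV[R]_n) (f : 'rV[R]_n -> R) (g : 'rV[R]_n -> Cl).

Definition partial (i : 'I_n) f : 'rV[R]_n -> R := 'D_(delta_mx ord0 i) f.

(* [f] and all its iterated partial derivatives are (Frechet) differentiable on
   [U]; for open [U] only the values of [f] on [U] matter. *)
Definition smooth_on U f : Prop :=
  forall (s : seq 'I_n) x, U x -> differentiable (foldr partial f s) x.

(* Test functions on [U] are extended by 0 to the whole space. *)
Definition test_function U f : Prop :=
  let supp := closure [set x | f x != 0] in
  [/\ smooth_on setT f, compact supp & supp `<=` U].

Definition cl_test_function U g : Prop :=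
  forall A, test_function U (fun x => g x A).

Definition dirac_op g (x : 'rV[R]_n) : Cl :=
  \sum_i cl_e i * [ffun A => partial i (fun y => g y A) x].

Definition Lp_loc (p : R) U f : Prop :=
  measurable_fun (U : set (lebesgueT R n)) (f : _ -> measurableTypeR R) /\
  forall K, K `<=` U -> compact K ->
    (\int[lebesgue R n]_(x in K) (`|f x| `^ p)%:E < +oo)%E.

Definition cl_Lp_loc (p : R) U g : Prop :=
  forall A, Lp_loc p U (fun x => g x A).

(* [cl_integral] is the componentwise integral; it is meaningful only under
   [cl_integrable], which is automatic in the weak equations when 1 <= p. *)
Definition cl_integrable U g : Prop :=
  forall A, (lebesgue R n).-integrable U (fun x => (g x A)%:E).

Definition cl_integral U g : Cl :=
  [ffun A => \int[lebesgue R n]_(x in U) g x A].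

(* Where [g] vanishes, ||g||^(p-2) g is 0 whatever the sign of p - 2. *)
Definition p_dirac_weak_solution (p : R) U g : Prop :=
  cl_Lp_loc p U g /\
  forall eta, cl_test_function U eta ->
    let F x := cl_conj (cl_norm (g x) `^ (p - 2) *: g x) * dirac_op eta x in
    cl_integrable U F /\ cl_integral U F = 0.

Definition Ap_dirac_weak_solution (A : 'rV[R]_n -> R) (p : R) U g : Prop :=
  cl_Lp_loc p U g /\
  forall eta, cl_test_function U eta ->
    let F x :=
      cl_conj ((A x * cl_norm (g x) `^ (p - 2)) *: g x) * dirac_op eta x in
    cl_integrable U F /\ cl_integral U F = 0.

End WeakSolutions.

(* Main.v *)
(* The operator T xi (x) = |cx + d|^(-n) (cx + d)~ xi(M x) satisfies
     (cx + d) D(T xi)(x) = |cx + d|^(-n) (D xi)(M x),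
   because |cx + d|^(-n) (cx + d)~ is annihilated by D and the differential of M at x is the
   similarity h |-> (cx + d)^-1~ h (cx + d)^-1. Given a test function eta on M^-1(U), let xi be
   its image under the operator T of M^-1, so that eta = T xi. Then the weak integrand of
   (cx + d)^-1 g(M x) and eta at x is |cx + d|^(-2n), the Jacobian of M, times that of g and xi
   at M x, and the weak equation on U transfers by a change of variables. For the latter,
   M is near each point the composite of a similarity with a map of Lipschitz constant close
   to 1, hence it expands Lebesgue measure by at most about its Jacobian; the same bound for
   M^-1, whose Jacobian is the reciprocal, turns the inequality into an equality. *)

Require Import Defs.
From HB Require Import structures.
From mathcomp Require Import all_boot all_order all_algebra.
From mathcomp Require Import ring lra.
From mathcomp Require Import all_classical all_reals all_analysis measurable_realfun.

Set Implicit Arguments.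
Unset Strict Implicit.
Unset Printing Implicit Defensive.
Import Order.TTheory GRing.Theory Num.Theory.
Import numFieldNormedType.Exports.
Local Open Scope classical_set_scope.
Local Open Scope ring_scope.

(** * Involutions and norm of the Clifford algebra *)

(** Two obstacles shape the measure part. Measure is computed on dyadic cubes and the norm of row
    vectors is the sup norm, for which a Euclidean similarity has no sharp Lipschitz constant;
    estimating [M] by a single Lipschitz constant would lose a dimensional factor. So the similarity
    is treated apart, by comparing its effect on a cube and on the Euclidean ball, and only a map
    close to the identity, for which both norms give a constant close to 1, is estimated on cubes.
    Moreover continuity of [M] controls preimages of Borel sets only; for Lebesgue measurable sets,
    null sets must pull back to null sets, and this too comes from the bound on the inverse. On the
    algebraic side [M] maps the set cx + d != 0 bijectively onto the set where the denominator of
    the inverse is non-zero. [U] may meet the complement of that image, but the transformed test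
    function is supported in the compact set M(K), K being the support of the given one, hence
    vanishes near the excluded points. The exponent -n of T is forced: the gradient of |cx + d|^(-n)
    has to cancel the sum of the e_i e_i, which is -n. *)

Section CliffordInvolutions.
Context {R : realType} {n : nat}.
Local Notation Cl := (clifford R n).
Local Notation symdiff := (@cl_symdiff n).
Local Notation sign := (@cl_sign R n).
Implicit Types (A B C : {set 'I_n}) (x y z w : Cl) (u v : 'rV[R]_n) (k : R).

Lemma cl_symdiffxx A : symdiff A A = finset.set0.
Proof. by apply/setP => i; rewrite !inE addbb. Qed.

Lemma cl_e_sqr i : cl_e i * cl_e i = -1 :> Cl.
Proof.
have e2 : 2 *: (cl_e i * cl_e i) = 2 *: (-1) :> Cl.
  by rewrite scaler_nat mulr2n cl_e_anticomm eqxx mulr1 scalerN scaleNr.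
have := congr1 ( *:%R 2^-1) e2.
by rewrite !scalerA mulVf ?pnatr_eq0// !scale1r.
Qed.

Let prod_e_inv (s : seq 'I_n) : (\prod_(i <- s) cl_e i) *
  ((-1) ^+ size s *: \prod_(i <- rev s) cl_e i) = 1 :> Cl.
Proof.
elim: s => [|i s IH]; first by rewrite !big_nil mul1r expr0 scale1r.
rewrite rev_cons big_cons -cats1 big_cat big_seq1/= exprS -scalerA scalerAl.
by rewrite scaleN1r mulrN mulrA -(mulrA (cl_e i)) IH mulr1 cl_e_sqr opprK.
Qed.

(** Up to sign the reversed product is the inverse of e_B, and so is e_B itself. Reversion and
    conjugation therefore act diagonally on the basis, by signs. *)
Let prod_rev_e B :
  \prod_(i <- rev (enum B)) cl_e i = (-1) ^+ #|B| *: (sign B B *: cl_basis B) :> Cl.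
Proof.
have := prod_e_inv (enum B); rewrite -cl_basisE -cardE.
move/(congr1 ( *%R (sign B B *: cl_basis B))).
rewrite mulrA mulr1 -scalerAl cl_basisM scalerA cl_sign_sqr scale1r.
rewrite cl_symdiffxx mul1r => <-.
by rewrite scalerA -exprD addnn -muln2 exprM sqrr_sign scale1r.
Qed.

Let sum_basisE (f : {set 'I_n} -> R) A :
  (\sum_B f B *: cl_basis B : Cl) A = f A.
Proof.
rewrite cl_sumE (bigD1 A)//= big1 => [|B BA].
  by rewrite !cl_scaleE ffunE eqxx mulr1 addr0.
by rewrite !cl_scaleE ffunE eq_sym (negbTE BA) !mulr0.
Qed.

Lemma cl_revE x A : cl_rev x A = (-1) ^+ #|A| * (sign A A * x A).
Proof.
rewrite -[RHS](sum_basisE (fun A => (-1) ^+ #|A| * (sign A A * x A))).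
congr ((_ : Cl) _); apply: eq_bigr => B _; rewrite prod_rev_e !scalerA.
by congr (_ *: _); ring.
Qed.

Lemma cl_conjE x A : cl_conj x A = sign A A * x A.
Proof.
rewrite -[RHS](sum_basisE (fun A => sign A A * x A)).
congr ((_ : Cl) _); apply: eq_bigr => B _; rewrite prod_rev_e !scalerA.
congr (_ *: _); have /(congr1 ( *%R (sign B B * x B))) := sqrr_sign R #|B|.
by rewrite mulr1 => <-; ring.
Qed.

(** [sign] is multiplicative in each argument for the symmetric difference; after expansion the
    factor [sign A B] occurs twice and cancels. *)
Let signC A B : sign A B * sign (symdiff A B) (symdiff A B) =
  sign B A * sign B B * sign A A.
Proof.
rewrite !cl_sign_symdiffl !cl_sign_symdiffr.
set s := sign A B; have ss : s * s = 1 by exact: cl_sign_sqr.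
by rewrite -[RHS]mul1r -ss; ring.
Qed.

Let sign_grade A B : (-1) ^+ #|symdiff A B| = (-1) ^+ #|A| * (-1) ^+ #|B| :> R.
Proof.
have prodN (C : {set 'I_n}) : (-1) ^+ #|C| = \prod_i (if i \in C then -1 else 1) :> R.
  by rewrite -big_mkcond/= prodr_const.
rewrite !prodN -big_split/=; apply: eq_bigr => i _; rewrite inE.
by do 2!case: (i \in _); rewrite ?mulrNN ?mulr1 ?mul1r.
Qed.

(** A diagonal map e_A |-> t(A) e_A reverses all products once it reverses those of basis elements,
    which is a condition on signs only. *)
Let antimorph (t : {set 'I_n} -> R) x y :
  (forall A B, sign A B * t (symdiff A B) = sign B A * t B * t A) ->
  ([ffun C => t C * (x * y) C] : Cl) =
  ([ffun B => t B * y B] : Cl) * ([ffun A => t A * x A] : Cl).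
Proof.
move=> tM; apply/ffunP => C; rewrite ffunE !cl_mulrE mulr_sumr.
rewrite [RHS](reindex_inj (can_inj (cl_symdiffK C)))/=.
apply: eq_bigr => A _; rewrite !ffunE.
rewrite (cl_symdiffC (symdiff C A)) cl_symdiffK (cl_symdiffC C).
have := tM A (symdiff A C); rewrite cl_symdiffK => tMA.
have -> : t C * (sign A (symdiff A C) * x A * y (symdiff A C)) =
  sign A (symdiff A C) * t C * x A * y (symdiff A C) by ring.
by rewrite tMA; ring.
Qed.

Lemma cl_conjM x y : cl_conj (x * y) = cl_conj y * cl_conj x.
Proof.
have E z : cl_conj z = [ffun A => sign A A * z A].
  by apply/ffunP => A; rewrite cl_conjE ffunE.
by rewrite !E; apply: (@antimorph (fun A => sign A A)) => A B; exact: signC.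
Qed.

Lemma cl_revM x y : cl_rev (x * y) = cl_rev y * cl_rev x.
Proof.
have E z : cl_rev z = ([ffun A : {set 'I_n} => (-1) ^+ #|A| * sign A A * z A] : Cl).
  by apply/ffunP => A; rewrite cl_revE ffunE mulrA.
rewrite !E; apply: (@antimorph (fun A => (-1) ^+ #|A| * sign A A)) => A B.
rewrite sign_grade mulrCA signC; ring.
Qed.

Lemma cl_conj_is_linear : linear (@cl_conj R n).
Proof.
move=> k x y; apply/ffunP => A.
by rewrite !(cl_conjE, cl_addE, cl_scaleE); ring.
Qed.
HB.instance Definition _ := GRing.isLinear.Build R Cl Cl _ _ cl_conj_is_linear.

Lemma cl_rev_is_linear : linear (@cl_rev R n).
Proof.
move=> k x y; apply/ffunP => A.
by rewrite !(cl_revE, cl_addE, cl_scaleE); ring.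
Qed.
HB.instance Definition _ := GRing.isLinear.Build R Cl Cl _ _ cl_rev_is_linear.

Lemma cl_conjK : involutive (@cl_conj R n).
Proof. by move=> x; apply/ffunP => A; rewrite !cl_conjE mulrA cl_sign_sqr mul1r. Qed.

Lemma cl_revK : involutive (@cl_rev R n).
Proof.
move=> x; apply/ffunP => A; rewrite !cl_revE.
rewrite (_ : _ * _ = ((-1) ^+ #|A| * (-1) ^+ #|A|) * (sign A A * sign A A) * x A).
  by rewrite cl_sign_sqr -expr2 sqrr_sign !mul1r.
by ring.
Qed.

Lemma cl_oneE A : (1 : Cl) A = (A == finset.set0)%:R.
Proof. by rewrite ffunE. Qed.

Lemma cl_conj1 : cl_conj (1 : Cl) = 1.
Proof.
apply/ffunP => A; rewrite cl_conjE cl_oneE.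
by case: eqVneq => [->|_]; rewrite ?cl_sign0l ?mulr1 ?mulr0.
Qed.

Lemma cl_rev1 : cl_rev (1 : Cl) = 1.
Proof.
apply/ffunP => A; rewrite cl_revE cl_oneE.
by case: eqVneq => [->|_]; rewrite ?cl_sign0l ?cards0 ?mulr1 ?mulr0.
Qed.

Lemma cl_vecE v A : cl_vec v A = \sum_i v ord0 i * (A == [set i]%SET)%:R.
Proof. by rewrite cl_sumE; apply: eq_bigr => i _; rewrite cl_scaleE ffunE. Qed.

Let sign1 i : sign [set i]%SET [set i]%SET = -1.
Proof. by rewrite /cl_sign big_set1 big_mkcondr big_set1 leqnn. Qed.

Lemma cl_conj_vec v : cl_conj (cl_vec v) = - cl_vec v.
Proof.
rewrite linear_sum/= /cl_vec -sumrN; apply: eq_bigr => i _; rewrite linearZ/= -scalerN.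
congr (_ *: _); apply/ffunP => A; rewrite cl_conjE !ffunE.
by case: eqVneq => [->|_]; rewrite ?sign1 ?mulr1 ?mulr0 ?oppr0.
Qed.

Lemma cl_rev_vec v : cl_rev (cl_vec v) = cl_vec v.
Proof.
rewrite linear_sum/=; apply: eq_bigr => i _; rewrite linearZ/=.
congr (_ *: _); apply/ffunP => A; rewrite cl_revE !ffunE.
case: eqVneq => [->|_]; last by rewrite !mulr0.
by rewrite sign1 cards1 expr1 mulr1 mulrNN mulr1.
Qed.

Definition dot u v : R := \sum_i u ord0 i * v ord0 i.

Lemma cl_vec_is_linear : linear (@cl_vec R n).
Proof.
move=> k u v; rewrite /cl_vec scaler_sumr -big_split/=; apply: eq_bigr => i _.
by rewrite !mxE scalerDl scalerA.
Qed.
HB.instance Definition _ := GRing.isLinear.Build R 'rV[R]_n Cl _ _ cl_vec_is_linear.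

Let scaleM k k' x y : (k *: x) * (k' *: y) = (k * k') *: (x * y).
Proof. by rewrite -scalerAl -scalerAr scalerA. Qed.

Lemma cl_vec_anticomm u v :
  cl_vec u * cl_vec v + cl_vec v * cl_vec u = (- 2 * dot u v)%:A.
Proof.
rewrite /cl_vec !mulr_suml.
under eq_bigr do rewrite mulr_sumr.
under [X in _ + X]eq_bigr do rewrite mulr_sumr.
rewrite [X in _ + X]exchange_big -big_split/= /dot mulr_sumr scaler_suml.
apply: eq_bigr => i _; rewrite -big_split/= (bigD1 i)//= big1 => [|j ji].
  rewrite !scaleM (mulrC (v _ _)) -scalerDr cl_e_anticomm eqxx mulr1 addr0.
  by rewrite scalerA mulrC.
rewrite !scaleM (mulrC (v _ _)) -scalerDr.
by rewrite cl_e_anticomm eq_sym (negbTE ji) mulr0 scale0r scaler0.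
Qed.

Lemma cl_vec_sqr v : cl_vec v * cl_vec v = (- dot v v)%:A.
Proof.
have e2 : 2 *: (cl_vec v * cl_vec v) = 2 *: (- dot v v)%:A.
  by rewrite scaler_nat mulr2n cl_vec_anticomm scalerA mulrN mulNr.
have := congr1 ( *:%R 2^-1) e2.
by rewrite !scalerA mulrA mulVf ?pnatr_eq0// mul1r scale1r.
Qed.

Lemma cl_norm_ge0 x : 0 <= cl_norm x. Proof. exact: sqrtr_ge0. Qed.

Lemma cl_norm_sqr x : cl_norm x ^+ 2 = \sum_A x A ^+ 2.
Proof. by rewrite sqr_sqrtr// sumr_ge0// => A _; exact: sqr_ge0. Qed.

Lemma cl_norm_eq0 x : (cl_norm x == 0) = (x == 0).
Proof.
rewrite -sqrf_eq0 cl_norm_sqr psumr_eq0 => [|A _]; last exact: sqr_ge0.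
apply/allP/eqP => [x0|-> A _]; last by rewrite ffunE expr0n eqxx.
apply/ffunP => A; rewrite ffunE; apply/eqP; rewrite -sqrf_eq0.
by have := x0 A; rewrite mem_index_enum => /(_ isT).
Qed.

Lemma cl_norm_gt0 x : (0 < cl_norm x) = (x != 0).
Proof. by rewrite lt_def cl_norm_ge0 cl_norm_eq0 andbT. Qed.

Lemma cl_conj_mulE0 x : (cl_conj x * x) finset.set0 = cl_norm x ^+ 2.
Proof.
rewrite cl_mulrE cl_norm_sqr; apply: eq_bigr => A _.
by rewrite cl_symdiff0 cl_conjE mulrA cl_sign_sqr mul1r.
Qed.

Lemma cl_mul_conjE0 x : (x * cl_conj x) finset.set0 = cl_norm x ^+ 2.
Proof.
rewrite cl_mulrE cl_norm_sqr; apply: eq_bigr => A _.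
by rewrite cl_symdiff0 cl_conjE mulrCA -mulrA mulrA cl_sign_sqr mul1r.
Qed.

Lemma cl_norm_conj x : cl_norm (cl_conj x) = cl_norm x.
Proof.
apply/eqP; rewrite -(eqrXn2 (n := 2))// ?cl_norm_ge0// -!cl_conj_mulE0.
by rewrite cl_conjK cl_mul_conjE0 cl_conj_mulE0.
Qed.

Lemma cl_normZ k x : cl_norm (k *: x) = `|k| * cl_norm x.
Proof.
rewrite /cl_norm -sqrtr_sqr -sqrtrM ?sqr_ge0// mulr_sumr; congr (Num.sqrt _).
by apply: eq_bigr => A _; rewrite cl_scaleE exprMn.
Qed.

Lemma cl_norm1 : cl_norm (1 : Cl) = 1.
Proof.
apply/eqP; rewrite -(eqrXn2 (n := 2))// ?cl_norm_ge0// -cl_conj_mulE0.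
by rewrite cl_conj1 mulr1 cl_oneE eqxx expr1n.
Qed.

Lemma cl_norm_vec v : cl_norm (cl_vec v) ^+ 2 = dot v v.
Proof.
rewrite -cl_conj_mulE0 cl_conj_vec mulNr cl_vec_sqr scaleNr opprK.
by rewrite cl_scaleE cl_oneE eqxx mulr1.
Qed.

End CliffordInvolutions.

(** * Products of vectors and Möbius transformations *)

Section VectorProducts.
Context {R : realType} {n : nat}.
Local Notation Cl := (clifford R n).
Local Notation vp := (@is_vector_product R n).
Implicit Types (x y z w q : Cl) (u v : 'rV[R]_n) (k : R).

Lemma cl_oppE x A : (- x) A = - x A. Proof. by rewrite ffunE. Qed.

(** Passing to coefficients turns an identity that is linear in fixed noncommutative monomials into
    a goal for [ring]. *)
Definition cl_lin := (@cl_addE R n, cl_oppE, @cl_scaleE R n).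

Lemma is_vector_vec v : is_vector (cl_vec v). Proof. by exists v. Qed.

Lemma is_vectorD x y : is_vector x -> is_vector y -> is_vector (x + y).
Proof. by move=> [u ->] [v ->]; exists (u + v); rewrite linearD. Qed.

Lemma is_vectorZ k x : is_vector x -> is_vector (k *: x).
Proof. by move=> [u ->]; exists (k *: u); rewrite linearZ. Qed.

Lemma is_vectorN x : is_vector x -> is_vector (- x).
Proof. by move=> [u ->]; exists (- u); rewrite linearN. Qed.

Lemma is_vector_rev x : is_vector x -> cl_rev x = x.
Proof. by move=> [u ->]; exact: cl_rev_vec. Qed.

Lemma cl_vec_inj : injective (@cl_vec R n).
Proof. exact: can_inj (@cl_vecK R n). Qed.

Lemma vp_ind (P : Cl -> Prop) : P 1 ->
  (forall v q, vp q -> P q -> P (cl_vec v * q)) -> forall q, vp q -> P q.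
Proof.
move=> P1 PM q [s ->]; elim: s => [|v s IH]; first by rewrite big_nil.
by rewrite big_cons; apply: PM => //; exists s.
Qed.

Lemma vpM q w : vp q -> vp w -> vp (q * w).
Proof. by move=> [s ->] [t ->]; exists (s ++ t); rewrite big_cat. Qed.

Lemma vp1 : vp 1. Proof. by exists [::]; rewrite big_nil. Qed.

Lemma vp_vec v : vp (cl_vec v). Proof. by exists [:: v]; rewrite big_seq1. Qed.

Lemma vp_rev q : vp q -> vp (cl_rev q).
Proof.
elim/vp_ind => {q} [|v q _ IH]; first by rewrite cl_rev1; exact: vp1.
by rewrite cl_revM cl_rev_vec; apply: vpM => //; exact: vp_vec.
Qed.

(** [-1] is the square of a basis vector, which exists in positive dimension. *)
Lemma vpN q : (0 < n)%N -> vp q -> vp (- q).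
Proof.
move=> n0; rewrite -mulN1r; apply: vpM; pose i := Ordinal n0.
suff -> : -1 = cl_vec (delta_mx ord0 i) * cl_vec (delta_mx ord0 i) :> Cl.
  by apply: vpM; exact: vp_vec.
have -> : cl_vec (delta_mx ord0 i) = cl_e i :> Cl.
  rewrite /cl_vec (bigD1 i)//= big1 => [|j ji].
    by rewrite mxE !eqxx scale1r addr0.
  by rewrite mxE (negbTE ji) andbF scale0r.
by rewrite cl_e_sqr.
Qed.

(** The product collapses from the middle, each vector contributing the scalar [dot v v]. It is
    enough to find some scalar: its value is then read off at the empty set. *)
Lemma vp_conj_mul q : vp q ->
  cl_conj q * q = (cl_norm q ^+ 2)%:A /\ q * cl_conj q = (cl_norm q ^+ 2)%:A.
Proof.
move=> vpq; suff [k [qk kq]] : exists k, cl_conj q * q = k%:A /\ q * cl_conj q = k%:A.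
  suff -> : cl_norm q ^+ 2 = k by [].
  by rewrite -cl_conj_mulE0 qk cl_scaleE cl_oneE eqxx mulr1.
elim/vp_ind: q / vpq => [|v q _ [k [qk kq]]].
  by exists 1; rewrite cl_conj1 mulr1 scale1r.
exists (dot v v * k); rewrite cl_conjM cl_conj_vec; split.
  rewrite mulrN mulNr mulrA -(mulrA (cl_conj q)) cl_vec_sqr scaleNr.
  by rewrite mulrN mulNr opprK -scalerAr mulr1 -scalerAl qk scalerA.
rewrite mulrA -(mulrA (cl_vec v)) kq -scalerAr mulr1 -scalerAl mulrN cl_vec_sqr scaleNr.
by rewrite opprK scalerA mulrC.
Qed.

(** The coefficient norm is not multiplicative in general. With a product of vectors as one factor
    it is, because the scalar [cl_conj q * q] can be pulled out. *)
Lemma vp_norm_mull q w : vp q -> cl_norm (q * w) = cl_norm q * cl_norm w.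
Proof.
move=> /vp_conj_mul[qq _]; apply/eqP.
rewrite -(eqrXn2 (n := 2))// ?mulr_ge0 ?cl_norm_ge0// exprMn -cl_conj_mulE0.
rewrite cl_conjM mulrA -(mulrA _ _ q) qq -scalerAr mulr1 -scalerAl cl_scaleE.
by rewrite cl_conj_mulE0.
Qed.

Lemma vp_norm_mulr q w : vp q -> cl_norm (w * q) = cl_norm w * cl_norm q.
Proof.
move=> /vp_conj_mul[_ qq]; apply/eqP.
rewrite -(eqrXn2 (n := 2))// ?mulr_ge0 ?cl_norm_ge0// exprMn -cl_mul_conjE0.
rewrite cl_conjM mulrA -(mulrA w) qq -scalerAr mulr1 -scalerAl cl_scaleE.
by rewrite cl_mul_conjE0 mulrC.
Qed.

(** The sign [e] is the parity of the number of vector factors. *)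
Lemma vp_rev_conj q : vp q -> exists2 e : R, e ^+ 2 = 1 & cl_rev q = e *: cl_conj q.
Proof.
elim/vp_ind => {q} [|v q _ [e e1 qe]].
  by exists 1; rewrite ?expr1n// cl_rev1 cl_conj1 scale1r.
exists (- e); first by rewrite sqrrN.
by rewrite cl_revM cl_conjM qe cl_rev_vec cl_conj_vec mulrN scaleNr scalerN opprK scalerAl.
Qed.

Lemma cl_norm_neq0 q : q != 0 -> cl_norm q != 0.
Proof. by rewrite cl_norm_eq0. Qed.

Lemma vp_unit q : vp q -> q != 0 -> q \is a GRing.unit.
Proof.
move=> /vp_conj_mul[qq1 qq2] /cl_norm_neq0 q0; apply/unitrP.
exists (cl_norm q ^- 2 *: cl_conj q); rewrite -scalerAl -scalerAr qq1 qq2.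
by rewrite !scalerA mulVf ?scale1r// sqrf_eq0.
Qed.

Lemma vp_inv q : vp q -> q != 0 -> q^-1 = cl_norm q ^- 2 *: cl_conj q.
Proof.
move=> vpq q0; apply: (mulrI (vp_unit vpq q0)); rewrite mulrV ?vp_unit//.
have [_ qq] := vp_conj_mul vpq.
by rewrite -scalerAr qq scalerA mulVf ?scale1r// sqrf_eq0 cl_norm_neq0.
Qed.

Lemma vp_norm_inv q : vp q -> q != 0 -> cl_norm q^-1 = (cl_norm q)^-1.
Proof.
move=> vpq q0; rewrite vp_inv// cl_normZ cl_norm_conj ger0_norm ?invr_ge0 ?sqr_ge0//.
by rewrite expr2 invfM -mulrA mulVf ?mulr1// cl_norm_neq0.
Qed.

Lemma cl_rev_eq0 q : (cl_rev q == 0) = (q == 0).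
Proof. by rewrite -(inj_eq (can_inj (@cl_revK R n))) cl_revK linear0. Qed.

Lemma cl_norm_rev q : cl_norm (cl_rev q) = cl_norm q.
Proof.
congr (Num.sqrt _); apply: eq_bigr => A _; rewrite cl_revE !exprMn sqrr_sign.
by rewrite expr2 cl_sign_sqr !mul1r.
Qed.

(** For non-zero [u] this is |u|^2 times the reflection of [v] in the hyperplane orthogonal to
    [u]. *)
Let vec_sandwichE u v : cl_vec u * cl_vec v * cl_vec u =
  dot u u *: cl_vec v - (2 * dot u v) *: cl_vec u :> Cl.
Proof.
have /eqP := cl_vec_anticomm u v; rewrite addrC eq_sym -subr_eq => /eqP uv.
rewrite -mulrA -uv mulrBr -scalerAr mulr1 mulrA cl_vec_sqr -scalerAl mul1r.
by rewrite !scaleNr mulNr scaleNr opprK addrC.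
Qed.

Lemma vec_sandwich u v : is_vector (cl_vec u * cl_vec v * cl_vec u).
Proof.
rewrite vec_sandwichE; apply: is_vectorD; first exact/is_vectorZ/is_vector_vec.
exact/is_vectorN/is_vectorZ/is_vector_vec.
Qed.

(** Polarization of [vec_sandwich] in its outer vector. *)
Lemma vec_triple u v (w : 'rV[R]_n) : is_vector
  (cl_vec u * cl_vec v * cl_vec w + cl_vec w * cl_vec v * cl_vec u).
Proof.
have -> : cl_vec u * cl_vec v * cl_vec w + cl_vec w * cl_vec v * cl_vec u =
    cl_vec (u + w) * cl_vec v * cl_vec (u + w) -
    cl_vec u * cl_vec v * cl_vec u - cl_vec w * cl_vec v * cl_vec w.
  rewrite linearD/= !(mulrDl, mulrDr).
  by apply/ffunP => A; rewrite !cl_lin; ring.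
by do 2!(apply: is_vectorD; last exact/is_vectorN/vec_sandwich); exact: vec_sandwich.
Qed.

Lemma vp_sandwich q z : vp q -> is_vector z -> is_vector (q * z * cl_rev q).
Proof.
move=> vpq vz; elim/vp_ind: q / vpq => [|v q _ [w qz]].
  by rewrite cl_rev1 mulr1 mul1r.
rewrite cl_revM cl_rev_vec !mulrA -(mulrA _ q) -(mulrA (cl_vec v)) qz.
exact: vec_sandwich.
Qed.

Lemma vp_inv_rev q : vp q -> q != 0 -> exists k, q^-1 = k *: cl_rev q.
Proof.
move=> vpq q0; have [e e1 qe] := vp_rev_conj vpq.
exists (cl_norm q ^- 2 * e).
by rewrite qe scalerA -mulrA -expr2 e1 mulr1 vp_inv.
Qed.

Lemma vp_sandwich_inv q z : vp q -> q != 0 -> is_vector z ->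
  is_vector (cl_rev q^-1 * z * q^-1).
Proof.
move=> vpq q0 vz; have [k ->] := vp_inv_rev vpq q0.
rewrite linearZ/= cl_revK -!scalerAl -scalerAr.
by do 2!apply: is_vectorZ; exact: vp_sandwich.
Qed.

Lemma cl_rev_inv q : vp q -> q != 0 -> cl_rev q^-1 = (cl_rev q)^-1.
Proof.
move=> vpq q0; have uq : cl_rev q \is a GRing.unit.
  by rewrite vp_unit ?cl_rev_eq0//; exact: vp_rev.
by apply: (mulIr uq); rewrite mulVr// -cl_revM mulrV ?vp_unit// cl_rev1.
Qed.

(** The inverse of [q] is a multiple of its reverse, so [q^-1 * z] is a vector too. This turns the
    conditions on the coefficients into factorizations such as d = c w. *)
Lemma vp_factor q z : vp q -> q != 0 -> is_vector (cl_rev q * z) ->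
  exists v, z = q * cl_vec v.
Proof.
move=> vpq q0 vqz; have [k qk] := vp_inv_rev vpq q0.
have [v qzv] := is_vectorZ k vqz; exists v.
by rewrite -qzv scalerAl -qk mulrA mulrV ?vp_unit// mul1r.
Qed.

(** Writing [z] as [q] times a vector exhibits the product as a sandwich. It gives the coefficient
    conditions with the reversal on the other side, as the inverse transformation needs them. *)
Lemma vp_swap q z : vp q -> is_vector (cl_rev q * z) -> is_vector (z * cl_rev q).
Proof.
move=> vpq vqz; have [->|q0] := eqVneq q 0.
  by rewrite linear0 mulr0; exists 0; rewrite linear0.
have [v ->] := vp_factor vpq q0 vqz; apply: vp_sandwich => //.
exact: is_vector_vec.
Qed.

End VectorProducts.

(** * Algebraic identities for a Möbius transformation *)

Section MoebiusAlgebra.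
Context {R : realType} {n : nat}.
Local Notation Cl := (clifford R n).
Local Notation vp := (@is_vector_product R n).
Implicit Types (x y : 'rV[R]_n).
Variables (a b c d : Cl).
Hypothesis Mabcd : moebius_coeffs a b c d.

Local Notation p x := (a * cl_vec x + b).
Local Notation q x := (c * cl_vec x + d).
Local Notation M := (moebius a b c d).

Let vpa : vp a. Proof. by case: Mabcd => -[]. Qed.
Let vpb : vp b. Proof. by case: Mabcd => -[]. Qed.
Let vpc : vp c. Proof. by case: Mabcd => -[]. Qed.
Let vpd : vp d. Proof. by case: Mabcd => -[]. Qed.
Let vac : is_vector (cl_rev a * c). Proof. by case: Mabcd => _ []. Qed.
Let vcd : is_vector (cl_rev c * d). Proof. by case: Mabcd => _ []. Qed.
Let vdb : is_vector (cl_rev d * b). Proof. by case: Mabcd => _ []. Qed.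
Let vba : is_vector (cl_rev b * a). Proof. by case: Mabcd => _ []. Qed.
Let adE : cl_rev a * d = 1 + cl_rev c * b.
Proof. by case: Mabcd => _ _ <-; rewrite subrK. Qed.
Let daE : cl_rev d * a = 1 + cl_rev b * c.
Proof.
rewrite -[LHS]cl_revK [cl_rev (_ * a)]cl_revM cl_revK adE linearD/= cl_rev1.
by rewrite cl_revM cl_revK.
Qed.
Let caE : cl_rev c * a = cl_rev a * c.
Proof. by rewrite -[RHS]is_vector_rev// cl_revM cl_revK. Qed.
Let dbE : cl_rev d * b = cl_rev b * d.
Proof. by rewrite -[LHS]is_vector_rev// cl_revM cl_revK. Qed.

Lemma moebius_den_factor : c != 0 -> exists w, d = c * cl_vec w.
Proof. by move=> c0; exact: vp_factor. Qed.

(** Either c = 0 and the denominator is d, or d = c w and it is c (x + w). *)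
Lemma moebius_den_vp x : vp (q x).
Proof.
have [->|c0] := eqVneq c 0; first by rewrite mul0r add0r.
have [w dw] := moebius_den_factor c0.
by rewrite {1}dw -mulrDr -linearD/=; apply: vpM => //; exact: vp_vec.
Qed.

Lemma moebius_den_unit x : q x != 0 -> q x \is a GRing.unit.
Proof. by apply: vp_unit; exact: moebius_den_vp. Qed.

(** Two independent points are kept: [y = x] gives the vector property below, and subtracting the
    reverse of the expression with [x] and [y] exchanged gives [moebius_subE]. *)
Let moebius_cross x y : cl_rev (q y) * p x =
  cl_vec y * (cl_rev c * a) * cl_vec x + cl_vec y * (cl_rev c * b) +
  (cl_vec x + cl_rev b * c * cl_vec x) + cl_rev d * b.
Proof.
have -> : cl_vec x + cl_rev b * c * cl_vec x = cl_rev d * a * cl_vec x.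
  by rewrite daE mulrDl mul1r.
rewrite linearD/= cl_revM cl_rev_vec !(mulrDl, mulrDr) !mulrA.
by apply/ffunP => A; rewrite !cl_addE; ring.
Qed.

Let moebius_num_vec x : is_vector (cl_rev (q x) * p x).
Proof.
rewrite moebius_cross; apply: is_vectorD => //.
have -> : cl_vec x * (cl_rev c * a) * cl_vec x + cl_vec x * (cl_rev c * b) +
    (cl_vec x + cl_rev b * c * cl_vec x) =
  cl_vec x * (cl_rev c * a) * cl_vec x + cl_vec x +
    (cl_vec x * (cl_rev c * b) + cl_rev (cl_rev c * b) * cl_vec x).
  by rewrite cl_revM cl_revK; apply/ffunP => A; rewrite !cl_lin; ring.
apply: is_vectorD.
  apply: is_vectorD; last exact: is_vector_vec.
  by rewrite caE; have [w ->] := vac; exact: vec_sandwich.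
have [d0|d0] := eqVneq d 0.
  have := adE; rewrite d0 mulr0 => /eqP; rewrite eq_sym addrC addr_eq0 => /eqP ->.
  rewrite linearN/= cl_rev1 mulrN1 mulN1r.
  by apply: is_vectorD; exact/is_vectorN/is_vector_vec.
have [k dk] := vp_inv_rev vpd d0.
(* Inserting [d * d^-1], with [d^-1] a multiple of [cl_rev d], between [cl_rev c] and [b] makes
   their product a multiple of the product of the vectors [cl_rev c * d] and [cl_rev d * b]. *)
have [[u cdu] [v dbv]] := (vcd, vdb).
have -> : cl_rev c * b = k *: (cl_vec u * cl_vec v).
  rewrite -cdu -dbv -mulrA (mulrA d) scalerAr scalerAl scalerAr -dk.
  by rewrite mulrV ?vp_unit// mul1r.
rewrite linearZ/= -scalerAl -scalerAr -scalerDr; apply: is_vectorZ.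
by rewrite cl_revM !cl_rev_vec mulrA; exact: vec_triple.
Qed.

Lemma moebiusE x : q x != 0 -> cl_vec (M x) = p x * (q x)^-1.
Proof.
move=> q0; suff [v pqv] : is_vector (p x * (q x)^-1).
  by rewrite /moebius pqv cl_vecK.
have -> : p x * (q x)^-1 = cl_rev (q x)^-1 * (cl_rev (q x) * p x) * (q x)^-1.
  rewrite mulrA -cl_revM mulrV ?moebius_den_unit// cl_rev1 mul1r//.
by apply: vp_sandwich_inv => //; exact: moebius_den_vp.
Qed.

(** The derivative formula in finite-difference form. Being exact, it yields both the partial
    derivatives and the Lipschitz estimate for [M] after removal of its differential. *)
Lemma moebius_subE x y : q x != 0 -> q y != 0 ->
  cl_rev (q y) * (cl_vec (M x) - cl_vec (M y)) * q x = cl_vec (x - y).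
Proof.
move=> qx qy; rewrite mulrBr mulrBl moebiusE// mulrA divrK ?moebius_den_unit//.
(* A vector equals its reverse, so the denominator of [M y] can be cancelled from the left. *)
rewrite -(cl_rev_vec (M y)) -cl_revM moebiusE// divrK ?moebius_den_unit//.
rewrite -[X in _ - X]cl_revK cl_revM cl_revK !moebius_cross.
rewrite linearB/= !(linearD (@cl_rev R n))/= !cl_revM !cl_revK !cl_rev_vec.
rewrite caE dbE !mulrA.
by apply/ffunP => A; rewrite !cl_lin; ring.
Qed.

(** These are the entries of the inverse matrix. Its determinant condition d a~ - c b~ = 1 follows
    from a~ d - c~ b = 1 after multiplication by a~ if a is non-zero, and from the invertibility of
    c if a = 0. *)
Lemma moebius_coeffs_inv : (0 < n)%N ->
  moebius_coeffs (cl_rev d) (- cl_rev b) (- cl_rev c) (cl_rev a).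
Proof.
move=> n0; rewrite /moebius_coeffs !cl_revK !linearN/= !cl_revK !mulrN !mulNr.
rewrite opprK; split.
- by split; [exact: vp_rev|exact/vpN/vp_rev|exact/vpN/vp_rev|exact: vp_rev].
- by split; apply: is_vectorN; exact: vp_swap.
have abE : a * cl_rev b = b * cl_rev a.
  rewrite -[LHS]is_vector_rev; first by rewrite cl_revM cl_revK.
  exact: vp_swap.
have [a0|a0] := eqVneq a 0.
  have cb : cl_rev c * b = -1.
    by have /eqP := adE; rewrite a0 linear0 mul0r eq_sym addrC addr_eq0 => /eqP.
  have c0 : c != 0.
    by apply: contra_eq_neq cb => ->; rewrite linear0 mul0r eq_sym oppr_eq0 oner_eq0.
  have uc : cl_rev c \is a GRing.unit.
    by rewrite vp_unit ?cl_rev_eq0//; exact: vp_rev.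
  have bc : b * cl_rev c = -1.
    by apply: (mulrI uc); rewrite mulrA cb mulN1r mulrN1.
  have := congr1 (@cl_rev R n) bc; rewrite cl_revM cl_revK linearN/= cl_rev1 => ->.
  by rewrite a0 linear0 mulr0 sub0r opprK.
have ua : cl_rev a \is a GRing.unit.
  by rewrite vp_unit ?cl_rev_eq0//; exact: vp_rev.
apply: (mulrI ua); rewrite mulrBr !mulrA adE mulrDl mul1r -caE -!mulrA abE.
by rewrite addrK mulr1.
Qed.

(** The cocycle relation of the denominators, for the composite of [M] with its inverse. *)
Lemma moebius_den_inv x : q x != 0 ->
  - cl_rev c * cl_vec (M x) + cl_rev a = (q x)^-1.
Proof.
move=> q0; apply: (mulIr (moebius_den_unit q0)); rewrite mulVr ?moebius_den_unit//.
rewrite mulrDl moebiusE// -!mulrA mulVr ?moebius_den_unit// mulr1.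
rewrite mulNr !mulrDr !mulrA caE adE.
by apply/ffunP => A; rewrite !cl_lin; ring.
Qed.

Lemma moebius_num_inv x : q x != 0 ->
  cl_rev d * cl_vec (M x) - cl_rev b = cl_vec x * (q x)^-1.
Proof.
move=> q0; apply: (mulIr (moebius_den_unit q0)); rewrite divrK ?moebius_den_unit//.
rewrite mulrDl moebiusE// -!mulrA mulVr ?moebius_den_unit// mulr1.
rewrite mulNr !mulrDr !mulrA daE dbE.
by apply/ffunP => A; rewrite !(mulrDl, mul1r) !ffunE; ring.
Qed.

End MoebiusAlgebra.

Section MoebiusInverse.
Context {R : realType} {n : nat}.
Local Notation Cl := (clifford R n).
Variables (a b c d : Cl).
Hypothesis Mabcd : moebius_coeffs a b c d.
Hypothesis n_gt0 : (0 < n)%N.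

Local Notation q x := (c * cl_vec x + d).
Local Notation M := (moebius a b c d).
Local Notation a' := (cl_rev d).
Local Notation b' := (- cl_rev b).
Local Notation c' := (- cl_rev c).
Local Notation d' := (cl_rev a).
Local Notation q' y := (c' * cl_vec y + d').
Local Notation M' := (moebius a' b' c' d').

Lemma moebius_inv_den_neq0 x : q x != 0 -> q' (M x) != 0.
Proof. by move=> q0; rewrite moebius_den_inv// invr_eq0. Qed.

Lemma moebius_invK x : q x != 0 -> M' (M x) = x.
Proof.
move=> q0; apply: cl_vec_inj; rewrite (moebiusE (moebius_coeffs_inv Mabcd n_gt0)).
  by rewrite moebius_num_inv// moebius_den_inv// invrK divrK// (moebius_den_unit Mabcd).
exact: moebius_inv_den_neq0.
Qed.

Lemma moebius_norm_den_inv x : q x != 0 -> cl_norm (q' (M x)) = (cl_norm (q x))^-1.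
Proof.
by move=> q0; rewrite moebius_den_inv// vp_norm_inv//; exact: (moebius_den_vp Mabcd).
Qed.

End MoebiusInverse.

Section MoebiusRightInverse.
Context {R : realType} {n : nat}.
Variables (a b c d : clifford R n).
Hypothesis Mabcd : moebius_coeffs a b c d.
Hypothesis n_gt0 : (0 < n)%N.

Local Notation q x := (c * cl_vec x + d).
Local Notation M := (moebius a b c d).
Local Notation q' y := (- cl_rev c * cl_vec y + cl_rev a).
Local Notation M' := (moebius (cl_rev d) (- cl_rev b) (- cl_rev c) (cl_rev a)).

(** Inverting the coefficients twice restores them, so the facts about [M] apply with the two maps
    exchanged. *)
Lemma moebius_den_inv_neq0 y : q' y != 0 -> q (M' y) != 0.
Proof.
move=> /(moebius_inv_den_neq0 (moebius_coeffs_inv Mabcd n_gt0)).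
by rewrite linearN/= !cl_revK opprK.
Qed.

Lemma moebiusK y : q' y != 0 -> M (M' y) = y.
Proof.
move=> /(moebius_invK (moebius_coeffs_inv Mabcd n_gt0) n_gt0).
by rewrite !linearN/= !cl_revK !opprK.
Qed.

End MoebiusRightInverse.

(** * Lebesgue outer measure on row vectors *)

Section DyadicCells.
Context {R : realType} {n : nat}.
Implicit Types (v w : 'rV[R]_n) (k : nat) (m : {ffun 'I_n -> int}).

Lemma row_norm_leP v (r : R) : 0 <= r ->
  `|v| <= r <-> forall i, `|v ord0 i| <= r.
Proof.
move=> r0; rewrite /Num.norm/= mx_normrE; split=> [/bigmax_leP[_ vr] i|vr].
  exact: (vr (ord0, i)).
by apply/bigmax_leP; split => // -[i j] _ /=; rewrite (ord1 i); exact: vr.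
Qed.

Definition cell_index k v : {ffun 'I_n -> int} :=
  [ffun i => Num.floor (2 ^+ k * v ord0 i)].

(** Half-open dyadic cubes of side 2^-k: those of one level partition the space, and each lies in a
    single cube of any coarser level. *)
Definition cell k m : set 'rV[R]_n := [set v | cell_index k v = m].

Let floor_half (s t : R) : Num.floor (2 * s) = Num.floor (2 * t) ->
  Num.floor s = Num.floor t.
Proof.
move=> st.
have E (u : R) (m : int) : (m <= Num.floor u) = (2 * m <= Num.floor (2 * u)).
  by rewrite !floor_ge_int intrM ler_pM2l// ltr0n.
by apply/eqP; rewrite eq_le E -st -E lexx E st -E lexx.
Qed.

Lemma cell_index_coarser j k v w : (j <= k)%N ->
  cell_index k v = cell_index k w -> cell_index j v = cell_index j w.
Proof.
move=> /subnK <-; elim: (k - j)%N => [//|l IH] /ffunP vw; apply: IH.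
by apply/ffunP => i; have := vw i; rewrite !ffunE addSn exprS -!mulrA => /floor_half.
Qed.

Lemma cell_itv k m v : cell k m v <->
  forall i, `[(m i)%:~R / 2 ^+ k, (m i + 1)%:~R / 2 ^+ k[%classic (v ord0 i).
Proof.
have e i (t : R) : (Num.floor (2 ^+ k * t) == m i) =
    ((m i)%:~R / 2 ^+ k <= t < (m i + 1)%:~R / 2 ^+ k).
  by rewrite floor_eq ler_pdivrMr ?ltr_pdivlMr ?exprn_gt0// mulrC.
split=> [vm i|vm]; first by rewrite /= in_itv/= -e -vm ffunE.
apply/ffunP => i; rewrite ffunE; apply/eqP; rewrite e.
by have := vm i; rewrite /= in_itv.
Qed.

Lemma cell_diam k m v w i : cell k m v -> cell k m w ->
  `|v ord0 i - w ord0 i| <= (2 ^+ k)^-1.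
Proof.
have e u : cell k m u -> (m i)%:~R / 2 ^+ k <= u ord0 i < (m i)%:~R / 2 ^+ k + (2 ^+ k)^-1.
  by move=> /cell_itv/(_ i); rewrite /= in_itv/= intrD mulrDl mul1r.
move=> /e/andP[v1 v2] /e/andP[w1 w2]; rewrite ler_norml.
by move: v1 v2 w1 w2; set s := _ / _; set t := (2 ^+ k)^-1; move: s t => s t *; lra.
Qed.

Lemma measurable_cell k m : measurable (cell k m).
Proof.
have -> : cell k m = [set v | forall i,
    `[(m i)%:~R / 2 ^+ k, (m i + 1)%:~R / 2 ^+ k[%classic (v ord0 i)].
  by apply/seteqP; split => v /cell_itv.
apply: (@measurable_row_box R n (fun i =>
  `[(m i)%:~R / 2 ^+ k, (m i + 1)%:~R / 2 ^+ k[%classic)) => i.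
exact: measurable_itv.
Qed.

Lemma borel_lebesgue_cell k m :
  borel_lebesgue n (cell k m) = ((2 ^+ k)^-1 ^+ n)%:E.
Proof.
have -> : cell k m = [set v | forall i,
    `[(m i)%:~R / 2 ^+ k, (m i + 1)%:~R / 2 ^+ k[%classic (v ord0 i)].
  by apply/seteqP; split => v /cell_itv.
rewrite (@borel_lebesgue_box R n (fun i =>
  `[(m i)%:~R / 2 ^+ k, (m i + 1)%:~R / 2 ^+ k[%classic))//.
transitivity (\prod_(i < n) ((2 ^+ k)^-1 : R)%R%:E)%E; last first.
  by rewrite prodEFin prodr_const card_ord.
apply: eq_bigr => i _; rewrite lebesgue_measure_itv/= lte_fin.
rewrite intrD mulrDl mul1r ltrDl invr_gt0 exprn_gt0//.
by rewrite -EFinB addrAC subrr add0r.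
Qed.

Section Decomposition.
Variable P : set 'rV[R]_n -> Prop.
Hypothesis Phered : forall X Y, X `<=` Y -> P Y -> P X.

(** All points of a cell lie in the same coarser cells, so this set is empty or the whole cell. *)
Let maximal_cell k m : set 'rV[R]_n := [set v | [/\ cell k m v, P (cell k m) &
  forall j, (j < k)%N -> ~ P (cell j (cell_index j v))]].

Let maximal_cellE k m : maximal_cell k m = set0 \/ maximal_cell k m = cell k m.
Proof.
have [->|/set0P[v [vm Pkm vj]]] := eqVneq (maximal_cell k m) set0; [by left|right].
apply/seteqP; split => [w []//|w wm]; split => // j jk.
suff -> : cell_index j w = cell_index j v by exact: vj.
by apply: cell_index_coarser (ltnW jk) _; rewrite wm.
Qed.

Let max_cell_seq (i : nat) : set 'rV[R]_n :=
  if @pickle_inv (nat * {ffun 'I_n -> int})%type i is Some km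
  then maximal_cell km.1 km.2 else set0.

(** The sequence enumerates the maximal dyadic cubes satisfying [P]. Maximality makes them disjoint;
    heredity puts every point that has a good ball into some good cube, hence into a coarsest
    one. *)
Lemma cell_decomposition : exists F : (set 'rV[R]_n)^nat,
  [/\ trivIset setT F,
      forall i, F i = set0 \/ exists km, F i = cell km.1 km.2 /\ P (F i) &
      forall v e, 0 < e -> P (ball v e) -> (\bigcup_i F i) v].
Proof.
exists max_cell_seq; split.
- apply/trivIsetP => i j _ _ ij; rewrite -subset0 => v []; rewrite /max_cell_seq.
  have := @pickle_invK (nat * {ffun 'I_n -> int})%type i.
  have := @pickle_invK (nat * {ffun 'I_n -> int})%type j.
  case: (pickle_inv j) => // -[k m]; case: (pickle_inv i) => // -[k' m'] /= ej ei.
  move=> [v1 P1 vl1] [v2 P2 vl2]; move: ij; rewrite -ei -ej.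
  have kk' : k = k'.
    have [kk'|kk'|//] := ltngtP k k'.
      by have := vl1 _ kk'; rewrite v2.
    by have := vl2 _ kk'; rewrite v1.
  by move: v1 v2 => <-; rewrite kk' => ->; rewrite eqxx.
- move=> i; rewrite /max_cell_seq; case: pickle_inv => [[k m]/=|]; last by left.
  have [->|/set0P ne] := eqVneq (maximal_cell k m) set0; [by left|right].
  have [E|E] := maximal_cellE k m; first by case: ne => v; rewrite E.
  by exists (k, m); split => //; rewrite E; case: ne => v [].
move=> v e e0 Pve.
have exk : exists k, `[< P (cell k (cell_index k v)) >].
  have [k ke] : exists k, (2 ^+ k)^-1 < e.
    (* This exponent exceeds 1/e and is smaller than its own power of 2. *)
    exists (Num.truncn e^-1).+1; rewrite invf_plt ?posrE// ?exprn_gt0//.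
    apply: lt_le_trans (_ : (Num.truncn e^-1).+1%:R <= _).
      exact: truncnS_gt.
    by rewrite -natrX ler_nat ltnW// ltn_expl.
  exists k; apply/asboolP; apply: Phered Pve => w vw.
  rewrite -ball_normE/= (le_lt_trans _ ke)//; apply/row_norm_leP => [|i].
    by rewrite invr_ge0 exprn_ge0.
  by rewrite !mxE; exact: (cell_diam i (erefl : cell _ _ v)).
have [k /asboolP Pk mink] := ex_minnP exk.
exists (pickle (k, cell_index k v)) => //; rewrite /max_cell_seq pickleK_inv/=.
split => // j jk; apply/asboolPn; apply/negP => /mink.
by rewrite leqNgt jk.
Qed.

End Decomposition.

Lemma open_cell_decomposition (O : set 'rV[R]_n) : open O ->
  exists F : (set 'rV[R]_n)^nat,
  [/\ trivIset setT F, forall i, F i = set0 \/ exists km, F i = cell km.1 km.2 &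
      O = \bigcup_i F i].
Proof.
move=> oO; have [|F [tF Fcell OF]] := @cell_decomposition (fun X => X `<=` O).
  by move=> X Y XY; exact: subset_trans.
exists F; split => //; first by move=> i; have [->|[km []]] := Fcell i; [left|right; exists km].
apply/seteqP; split => [v Ov|v [i _ Fiv]].
  have /nbhs_ballP[e e0 veO] : nbhs v O by exact: open_nbhs_nbhs.
  exact: OF veO.
by have [F0|[km [_ /(_ v)]]] := Fcell i; [move: Fiv; rewrite F0|exact].
Qed.

Lemma measurable_cell_or_set0 (X : set 'rV[R]_n) :
  X = set0 \/ (exists km, X = cell km.1 km.2) -> measurable X.
Proof. by move=> [->|[km ->]]; [exact: measurable0|exact: measurable_cell]. Qed.

Lemma open_measurable_row (O : set 'rV[R]_n) : open O -> measurable O.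
Proof.
move=> /open_cell_decomposition[F [_ Fcell ->]]; apply: bigcupT_measurable => i.
exact: measurable_cell_or_set0.
Qed.

Lemma closed_measurable_row (C : set 'rV[R]_n) : closed C -> measurable C.
Proof.
move=> cC; rewrite -(setCK C); apply: measurableC; apply: open_measurable_row.
exact: closed_openC.
Qed.

End DyadicCells.

Lemma row_borel_ind (R : realType) n (P : set 'rV[R]_n -> Prop) : P set0 ->
  (forall A, P A -> P (~` A)) ->
  (forall F : (set 'rV[R]_n)^nat, (forall i, P (F i)) -> P (\bigcup_i F i)) ->
  (forall i (t : R), P [set v | t < v ord0 i]) ->
  forall B, measurable B -> P B.
Proof.
move=> P0 PC PU Ph; apply: smallest_sub.
  by split=> [|A|]; [exact: P0|rewrite setTD; exact: PC|exact: PU].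
rewrite -bigcup_seq/=; apply: bigcup_sub => i _ _ [Y mY <-]; rewrite setTI.
have {}mY : <<s @RGenOInfty.G R >> Y.
  by have := @RGenOInfty.measurableE R; rewrite /measurable/= => <-.
pose C := [set Y : set R | P (row_coord i @^-1` Y)].
suff : <<s @RGenOInfty.G R >> `<=` C by exact.
apply: smallest_sub.
  split => [|A|A rA]; rewrite /C/mkset.
  - by rewrite preimage_set0.
  - by move=> /PC; rewrite setTD preimage_setC.
  - by rewrite preimage_bigcup; exact: PU.
move=> _ [t ->]; rewrite /C/mkset; have := Ph i t; congr P.
by apply/seteqP; split => v; rewrite /= /row_coord in_itv/= andbT.
Qed.

(** * Regularity of Lebesgue measure inside a set of finite measure *)

Section Regularity.
Context {R : realType} {n : nat}.
Local Notation mu := (borel_lebesgue (R := R) n).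
Implicit Types (A B F O X : set 'rV[R]_n).

Variable b : set 'rV[R]_n.
Hypotheses (mb : measurable b) (boo : (mu b < +oo)%E).

(** Continuity from above, valid because it is measured inside [b], which has finite measure. *)
Let small_tail (G : (set 'rV[R]_n)^nat) (e : R) : 0 < e ->
  (forall i, measurable (G i)) -> {homo G : i j / (i <= j)%N >-> j `<=` i} ->
  \bigcap_i G i = set0 -> exists i, (mu (G i `&` b) <= e%:E)%E.
Proof.
move=> e0 mG dG G0; apply: contrapT => /forallNP big.
have mGb i : measurable (G i `&` b) by exact: measurableI.
have bigI : \bigcap_i (G i `&` b) = set0.
  by rewrite -subset0 -G0 => x Gx i _; have [] := Gx i I.
have cvg0 : mu (G i `&` b) @[i --> \oo] --> 0%E.
  rewrite -(measure0 mu) -bigI; apply: nonincreasing_cvg_mu => //.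
  - by rewrite (le_lt_trans _ boo)// le_measure ?inE//; exact: subIsetr.
  - by rewrite bigI; exact: measurable0.
  - by move=> i j ij; apply/subsetPset; apply: setSI; exact: dG.
have : (e%:E <= limn (fun i => mu (G i `&` b)))%E.
  apply: lime_ge; first by apply/cvg_ex; exists 0%E.
  by near=> i; rewrite leNgt; apply/negP => /ltW; exact: big.
by rewrite (cvg_lim _ cvg0)// lee_fin leNgt e0.
Unshelve. all: by end_near. Qed.

(** Approximating from outside and inside at once makes the condition symmetric under complement, so
    that Borel induction applies. *)
Let regular B := forall e : R, 0 < e -> exists O F, [/\ open O, closed F, F `<=` B,
  B `<=` O & (mu ((O `\` F) `&` b) <= e%:E)%E].

Let regularC B : regular B -> regular (~` B).
Proof.
move=> rB e e0; have [V [F [oV cF FB BV VFe]]] := rB e e0.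
exists (~` F), (~` V); split.
- exact: closed_openC.
- exact: open_closedC.
- exact: subsetC.
- exact: subsetC.
- by rewrite setDE setCK (setIC _ V) -setDE.
Qed.

Let regular0 : regular set0.
Proof.
move=> e e0; exists set0, set0; split; [exact: open0|exact: closed0|by []|by []|].
by rewrite set0D set0I measure0 lee_fin ltW.
Qed.

(** An infinite union of closed sets need not be closed. It is cut at a finite stage, half of [e]
    paying for the tail and the other half, spread geometrically, for the sets. *)
Let regular_bigcup (B : (set 'rV[R]_n)^nat) :
  (forall i, regular (B i)) -> regular (\bigcup_i B i).
Proof.
move=> rB e e0; have e20 : 0 < e / 2 by rewrite divr_gt0.
have /choice[V /choice[F OF]] : forall i, exists V, exists F,
    [/\ open V, closed F, F `<=` B i, B i `<=` V &
    (mu ((V `\` F) `&` b) <= (e / 2 / (2 ^ i.+1)%:R)%:E)%E].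
  by move=> i; apply: rB; rewrite divr_gt0// ltr0n expn_gt0.
have mO i : measurable (V i) by apply: open_measurable_row; have [] := OF i.
have mF i : measurable (F i) by apply: closed_measurable_row; have [] := OF i.
pose G N := \bigcup_i F i `\` \big[setU/set0]_(i < N) F i.
have mG N : measurable (G N).
  by apply: measurableD; [exact: bigcupT_measurable|exact: bigsetU_measurable].
have [||N GN] := small_tail e20 mG.
- by move=> i j ij; apply: setDS; exact: subset_bigsetU.
- rewrite -subset0 => x Gx; have [[i _ Fix] _] := Gx 0%N I.
  by have [_] := Gx i.+1 I; apply; rewrite big_ord_recr; right.
exists (\bigcup_i V i), (\big[setU/set0]_(i < N) F i); split.
- by apply: bigcup_open => i _; have [] := OF i.
- by apply: closed_bigsetU => i _; have [] := OF i.
- rewrite -bigcup_mkord => x [i _ Fix]; exists i => //.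
  by have [_ _ FB _ _] := OF i; exact: FB.
- by apply: subset_bigcup => i _; have [] := OF i.
pose D := \bigcup_i ((V i `\` F i) `&` b).
have mDi i : measurable ((V i `\` F i) `&` b).
  by apply: measurableI => //; exact: measurableD.
have mD : measurable D by exact: bigcupT_measurable.
have muD : (mu D <= (e / 2)%:E)%E.
  have h := measure_sigma_subadditive mu mDi mD (@subset_refl _ D).
  apply: (le_trans h).
  have := @epsilon_trick R (fun=> 0%E) (e / 2) xpredT (fun=> lexx _) (ltW e20).
  rewrite [X in (_ <= X + _)%E]eseries0// add0e; apply: le_trans; apply: lee_nneseries => // i _.
  by rewrite add0e; have [] := OF i.
have mGb : measurable (G N `&` b) by exact: measurableI.
apply: (@le_trans _ _ (mu (D `|` (G N `&` b)))).
  apply: le_measure; rewrite ?inE.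
  - apply: measurableI => //; apply: measurableD; first exact: bigcupT_measurable.
    exact: bigsetU_measurable.
  - exact: measurableU.
  - move=> x [[[i _ Oix] Fx] bx].
    have [Fix|Fix] := pselect (F i x); last by left; exists i.
    by right; split => //; split => //; exists i.
rewrite (le_trans (measureU2 _ mD mGb))// (splitr e) EFinD.
by apply: leeD; [exact: muD|exact: GN].
Qed.

Let regular_half_space i (x : R) : regular [set v : 'rV[R]_n | x < v ord0 i].
Proof.
move=> e e0.
have crd : continuous (row_coord i : 'rV[R]_n -> R) by exact: coord_continuous.
pose O := row_coord i @^-1` `]x, +oo[%classic : set 'rV[R]_n.
have OE : [set v : 'rV[R]_n | x < v ord0 i] = O.
  by apply/seteqP; split => v; rewrite /O/= /row_coord in_itv/= andbT.
pose F (N : nat) := row_coord i @^-1` `[x + N.+1%:R^-1, +oo[%classic : set 'rV[R]_n.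
have oO : open O by apply: open_comp => [v _|]; [exact: crd|exact: interval_open].
have cF N : closed (F N) by apply: closed_comp => [v _|]; [exact: crd|exact: interval_closed].
have mOF N : measurable (O `\` F N).
  by apply: measurableD; [exact: open_measurable_row|exact: closed_measurable_row].
have [||N OFN] := small_tail e0 mOF.
- move=> j k jk; apply: setDS => v; rewrite /F/= !in_itv/= !andbT; apply: le_trans.
  by rewrite lerD2l lef_pV2 ?posrE// ler_nat.
- rewrite -subset0 => v OFv.
  have : O v by have [] := OFv 0%N I.
  rewrite /O/= in_itv/= andbT -subr_gt0 => xv.
  have [_] := OFv (Num.truncn (row_coord i v - x)^-1) I; apply.
  rewrite /F/= in_itv/= andbT addrC -lerBrDr invf_ple ?posrE//.
  by rewrite ltW// truncnS_gt.
rewrite OE; exists O, (F N); split => // v; rewrite /F/O/= !in_itv/= !andbT.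
by apply: lt_le_trans; rewrite ltrDl.
Qed.

Lemma outer_regularity B (e : R) : measurable B -> 0 < e ->
  exists O, [/\ open O, B `<=` O & (mu (O `&` b) <= mu (B `&` b) + e%:E)%E].
Proof.
move=> mB e0; have rB : regular B.
  exact: (row_borel_ind regular0 regularC regular_bigcup regular_half_space).
have [V [F [oV cF FB BV VFe]]] := rB _ e0.
have mV := open_measurable_row oV; have mF := closed_measurable_row cF.
have mVF : measurable ((V `\` F) `&` b) by apply: measurableI => //; exact: measurableD.
have mBb : measurable (B `&` b) by exact: measurableI.
exists V; split => //; apply: (@le_trans _ _ (mu ((B `&` b) `|` ((V `\` F) `&` b)))).
  apply: le_measure; rewrite ?inE.
  - exact: measurableI.
  - exact: measurableU.
  - move=> x [Vx bx]; have [Fx|Fx] := pselect (F x); last by right.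
    by left; split => //; exact: FB.
by rewrite (le_trans (measureU2 _ mBb mVF))// leeD2l.
Qed.

End Regularity.

(** * Outer measure of images of arbitrary sets *)

Section OuterLebesgue.
Context {R : realType} {n : nat}.
Local Notation mu := (borel_lebesgue (R := R) n).
Local Notation lam := (lebesgue R n : set 'rV[R]_n -> \bar R).
Implicit Types (X Y B E : set 'rV[R]_n) (r : R).

(** [lebesgue] is given by the outer measure on every set, so images can be estimated before
    anything is known about their measurability. *)
Lemma lebesgue_ge0 X : (0 <= lam X)%E.
Proof. exact: (outer_measure_ge0 (borel_lebesgue n)^*%mu). Qed.

Lemma le_lebesgue X Y : X `<=` Y -> (lam X <= lam Y)%E.
Proof. exact: (le_outer_measure (borel_lebesgue n)^*%mu). Qed.

Lemma lebesgue_bigcup (F : (set 'rV[R]_n)^nat) :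
  (lam (\bigcup_i F i) <= \sum_(i <oo) lam (F i))%E.
Proof. exact: (outer_measure_sigma_subadditive (borel_lebesgue n)^*%mu). Qed.

Lemma lebesgueU X Y : (lam (X `|` Y) <= lam X + lam Y)%E.
Proof. exact: (outer_measureU2 (borel_lebesgue n)^*%mu). Qed.

Lemma lebesgue_borel B : measurable B -> lam B = mu B.
Proof. exact: measurable_mu_extE. Qed.

Lemma lebesgue0 : lam set0 = 0%E.
Proof. by rewrite lebesgue_borel ?measure0. Qed.

Lemma lebesgue_cell k m : lam (cell k m) = ((2 ^+ k)^-1 ^+ n)%:E.
Proof. by rewrite lebesgue_borel ?borel_lebesgue_cell//; exact: measurable_cell. Qed.

(** The enclosing cube has the coordinatewise infima as its corner; a cube centred at a point of [X]
    would cost a factor 2^n and spoil the sharp constants below. *)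
Lemma lebesgue_cube_le X r : 0 <= r ->
  (forall v w i, X v -> X w -> `|v ord0 i - w ord0 i| <= r) ->
  (lam X <= (r ^+ n)%:E)%E.
Proof.
move=> r0 Xr; have [->|/set0P[v0 Xv0]] := eqVneq X set0.
  by rewrite lebesgue0 lee_fin exprn_ge0.
pose a i := inf [set v ord0 i | v in X].
pose B i : set (measurableTypeR R) := `[a i, a i + r]%classic.
have hinf i : has_inf [set v ord0 i | v in X].
  split; first by exists (v0 ord0 i), v0.
  exists (v0 ord0 i - r) => _ [v Xv <-].
  by have := Xr _ _ i Xv0 Xv; rewrite ler_norml => /andP[_]; lra.
have mB i : measurable (B i) by exact: measurable_itv.
apply: (@le_trans _ _ (lam [set v | forall i, B i (v ord0 i)])).
  apply: le_lebesgue => v Xv i; rewrite /B/= in_itv/=; apply/andP; split.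
    by apply: ge_inf; [have [] := hinf i|exists v].
  rewrite -lerBlDr; apply: lb_le_inf; first by exists (v ord0 i), v.
  move=> _ [w Xw <-]; have := Xr _ _ i Xv Xw.
  by rewrite ler_norml => /andP[_]; lra.
rewrite lebesgue_box// (_ : (\prod_(i < n) _)%E = \prod_(i < n) r%:E)%E.
  by rewrite prodEFin prodr_const card_ord.
apply: eq_bigr => i _; rewrite lebesgue_measure_itv/= lte_fin ltrDl.
case: ltP => r'; first by rewrite -EFinB addrAC subrr add0r.
by congr (_%:E); apply/eqP; rewrite eq_le r0.
Qed.

Lemma lebesgue_ball_lty r : (lam (ball (0%R : 'rV[R]_n) r) < +oo)%E.
Proof.
have [r0|r0] := leP r 0.
  rewrite (_ : ball 0 r = set0) ?lebesgue0// -subset0 => x.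
  by rewrite -ball_normE/= ltNge (le_trans r0).
apply: (@le_lt_trans _ _ ((2 * r) ^+ n)%:E); last exact: ltry.
apply: lebesgue_cube_le => [|v w i]; first by rewrite mulr_ge0// ltW.
have bE u : ball (0 : 'rV[R]_n) r u -> `|u ord0 i| <= r.
  rewrite -ball_normE/= sub0r normrN => /ltW; move/row_norm_leP; apply.
  exact: ltW.
by move=> /bE vj /bE wj; rewrite (le_trans (ler_normB _ _))//; lra.
Qed.

Section ImageBound.
Variables (Phi : 'rV[R]_n -> 'rV[R]_n) (E0 : set 'rV[R]_n) (K : R).
Hypothesis K0 : 0 <= K.
Hypothesis Phi_cell : forall k m,
  (lam (Phi @` (cell k m `&` E0)) <= (K * (2 ^+ k)^-1 ^+ n)%:E)%E.

Let nu X := lam (Phi @` (X `&` E0)).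

Let le_nu X Y : X `<=` Y -> (nu X <= nu Y)%E.
Proof.
move=> XY; apply: le_lebesgue => _ [x [Xx Ex] <-]; exists x => //; split => //.
exact: XY.
Qed.

Let nu_bigcup (F : (set 'rV[R]_n)^nat) :
  (nu (\bigcup_i F i) <= \sum_(i <oo) nu (F i))%E.
Proof.
apply: le_trans (lebesgue_bigcup _); apply: le_lebesgue => _ [x [[i _ Fix] Ex] <-].
by exists i => //; exists x.
Qed.

Let sumK (F : (set 'rV[R]_n)^nat) : (forall i, measurable (F i)) ->
  trivIset setT F -> (forall i, nu (F i) <= K%:E * mu (F i))%E ->
  (nu (\bigcup_i F i) <= K%:E * mu (\bigcup_i F i))%E.
Proof.
move=> mF tF nF; rewrite measure_semi_bigcup//; last exact: bigcupT_measurable.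
rewrite -nneseriesZl//; apply: le_trans (nu_bigcup _) _.
by apply: lee_nneseries => // i _; exact: lebesgue_ge0.
Qed.

Let nu_open (O : set 'rV[R]_n) : open O -> (nu O <= K%:E * mu O)%E.
Proof.
move=> /open_cell_decomposition[F [tF Fcell ->]]; apply: sumK => // i.
  exact: measurable_cell_or_set0.
have [->|[km ->]] := Fcell i; first by rewrite /nu set0I image_set0 lebesgue0 measure0 mule0.
by rewrite borel_lebesgue_cell; exact: Phi_cell.
Qed.

Let nu_bounded B b : measurable B -> open b -> (mu b < +oo)%E -> B `<=` b ->
  (nu B <= K%:E * mu B)%E.
Proof.
move=> mB ob boo Bb; apply/lee_addgt0Pr => e e0.
have e'0 : 0 < e / (K + 1) by rewrite divr_gt0// ltr_wpDl.
have [V [oV BV VB]] := outer_regularity (open_measurable_row ob) boo mB e'0.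
have oVb : open (V `&` b) by exact: openI.
apply: (@le_trans _ _ (nu (V `&` b))); first by apply: le_nu => x Bx; split; [exact: BV|exact: Bb].
apply: le_trans (nu_open oVb) _.
rewrite (setIidl Bb) in VB.
apply: (@le_trans _ _ (K%:E * (mu B + (e / (K + 1))%:E))%E).
  by apply: lee_wpmul2l; rewrite ?lee_fin.
rewrite ge0_muleDr ?lee_fin ?(ltW e'0)//.
rewrite leeD2l// -EFinM lee_fin mulrCA ger_pMr// ler_pdivrMr ?ltr_wpDl//.
by rewrite mul1r lerDl.
Qed.

Let nu_borel B : measurable B -> (nu B <= K%:E * mu B)%E.
Proof.
move=> mB; pose b (j : nat) : set 'rV[R]_n := ball 0 j.+1%:R.
have ob j : open (b j) by exact: ball_open.
have mb j : measurable (b j) by exact: open_measurable_row.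
have boo j : (mu (b j) < +oo)%E.
  by rewrite -lebesgue_borel//; exact: lebesgue_ball_lty.
have mBb j : measurable (B `&` seqDU b j).
  by apply: measurableI => //; apply: seqDU_measurable.
have BE : B = \bigcup_j (B `&` seqDU b j).
  apply/seteqP; split => [x Bx|x [j _ []//]].
  have [j _ bjx] : (\bigcup_j seqDU b j) x.
    rewrite -seqDU_bigcup_eq; exists (Num.truncn `|x|) => //.
    by rewrite /b -ball_normE/= sub0r normrN truncnS_gt.
  by exists j.
rewrite {1 2}BE; apply: sumK => //.
  by apply: trivIset_setIl; exact: trivIset_seqDU.
move=> j; apply: (@nu_bounded _ (b j)) => //.
by move=> x [_]; exact: subset_seqDU.
Qed.

(** The bound spreads from cells to open sets by disjoint unions, to Borel sets in a ball by outer
    regularity, to all Borel sets by cutting into shells, and to [E0] through the Borel covers that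
    define its outer measure. *)
Lemma lebesgue_image_le : (lam (Phi @` E0) <= K%:E * lam E0)%E.
Proof.
suff coverE F : measurable_cover E0 F -> (nu E0 <= K%:E * \sum_(k <oo) mu (F k))%E.
  rewrite -[E0 in X in (lam X <= _)%E]setIid -/(nu E0).
  (* The infimum over covers is reached by dividing by [K]; for [K = 0] the cover by the whole space
     already gives 0. *)
  have [K_eq0|K_neq0] := eqVneq K 0.
    have := @coverE (fun=> setT); rewrite K_eq0 !mul0e; apply.
    by split => // x _; exists 0%N.
  have K_gt0 : 0 < K by rewrite lt_def K_neq0.
  rewrite -lee_pdivrMl//; apply: le_ereal_inf_tmp => _ [F cF <-].
  by rewrite lee_pdivrMl//; exact: coverE.
move=> [mF EF]; apply: (le_trans (le_nu EF)); apply: (le_trans (nu_bigcup _)).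
rewrite -nneseriesZl//; apply: lee_nneseries => [i _ _|i _]; first exact: lebesgue_ge0.
exact: nu_borel.
Qed.

End ImageBound.

(** The hypothesis is the Lipschitz condition for the sup norm. Cells are cubes for that norm, so
    their images lie in cubes whose side is multiplied by exactly [L]. *)
Lemma lebesgue_lipschitz (Phi : 'rV[R]_n -> 'rV[R]_n) E (L : R) : 0 <= L ->
  (forall x y (r : R), 0 <= r -> E x -> E y ->
    (forall i, `|x ord0 i - y ord0 i| <= r) ->
    (forall i, `|Phi x ord0 i - Phi y ord0 i| <= L * r)) ->
  (lam (Phi @` E) <= (L ^+ n)%:E * lam E)%E.
Proof.
move=> L0 PhiL; apply: lebesgue_image_le => [|k m]; first exact: exprn_ge0.
rewrite -exprMn; apply: lebesgue_cube_le.
  by rewrite mulr_ge0// invr_ge0 exprn_ge0.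
move=> _ _ i [v [cv Ev] <-] [w [cw Ew] <-]; apply: PhiL => // j.
exact: cell_diam cv cw.
Qed.

Lemma lebesgue_affine (x0 : 'rV[R]_n) (s : R) E : 0 < s ->
  lam [set x0 + s *: x | x in E] = ((s ^+ n)%:E * lam E)%E.
Proof.
have le_affine (t : R) (y : 'rV[R]_n) X : 0 < t ->
    (lam [set (y + t *: x)%R | x in X] <= (t ^+ n)%:E * lam X)%E.
  move=> t0; apply: lebesgue_lipschitz; first exact: ltW.
  move=> v w r r0 _ _ vw i; rewrite !mxE opprD addrACA subrr add0r -mulrBr.
  by rewrite normrM gtr0_norm// ler_pM2l.
move=> s0; apply/eqP; rewrite eq_le le_affine//=.
rewrite -lee_pdivlMl ?exprn_gt0//.
have := le_affine s^-1 (- (s^-1 *: x0)) [set x0 + s *: x | x in E].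
rewrite invr_gt0 exprVn => /(_ s0); apply: le_trans; apply: le_lebesgue.
move=> x Ex; exists (x0 + s *: x); first by exists x.
by rewrite scalerDr scalerA mulVf ?gt_eqF// scale1r addKr.
Qed.

(** The Euclidean norm. The norm of row vectors is the sup norm, which the differential of a Möbius
    transformation does not scale uniformly in general. *)
Definition enorm (v : 'rV[R]_n) : R := Num.sqrt (dot v v).

Lemma dot_ge0 (v : 'rV[R]_n) : 0 <= dot v v.
Proof. by apply: sumr_ge0 => i _; rewrite -expr2 sqr_ge0. Qed.

Lemma enormE v : enorm v = cl_norm (cl_vec v).
Proof. by rewrite /enorm -cl_norm_vec sqrtr_sqr ger0_norm// cl_norm_ge0. Qed.

Lemma enormZ (k : R) (v : 'rV[R]_n) : enorm (k *: v) = `|k| * enorm v.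
Proof. by rewrite !enormE linearZ/= cl_normZ. Qed.

Lemma ler_coord_enorm (v : 'rV[R]_n) i : `|v ord0 i| <= enorm v.
Proof.
rewrite -sqrtr_sqr ler_sqrt ?dot_ge0// /dot (bigD1 i)//= -expr2 lerDl.
by apply: sumr_ge0 => j _; rewrite -expr2 sqr_ge0.
Qed.

Lemma ler_enorm_coord (v : 'rV[R]_n) r : 0 <= r -> (forall i, `|v ord0 i| <= r) ->
  enorm v <= n%:R * r.
Proof.
move=> r0 vr; rewrite -[leRHS]ger0_norm ?mulr_ge0// -sqrtr_sqr ler_sqrt ?sqr_ge0//.
apply: (@le_trans _ _ (n%:R * r ^+ 2)).
  rewrite mulr_natl -[X in _ *+ X]card_ord -sumr_const.
  by apply: ler_sum => i _; rewrite -expr2 -real_normK ?num_real// lerXn2r ?nnegrE.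
rewrite exprMn ler_wpM2r ?sqr_ge0// -natrX ler_nat.
by case: {+}n => // k; rewrite expnS expn1 leq_pmull.
Qed.

Lemma unit_cellP (v : 'rV[R]_n) : cell 0 0 v <-> forall i, 0 <= v ord0 i < 1.
Proof.
have e i : `[((0 : {ffun 'I_n -> int}) i)%:~R / 2 ^+ 0,
    ((0 : {ffun 'I_n -> int}) i + 1)%:~R / 2 ^+ 0[%classic (v ord0 i) =
    (0 <= v ord0 i < 1).
  by rewrite /= in_itv/= ffunE expr0 !divr1.
by split => [/cell_itv|] v1; [|apply/cell_itv] => i; have := v1 i; rewrite e.
Qed.

(** * Scaling of Lebesgue measure by a linear similarity *)

Section Similarity.
Variables (S : {linear 'rV[R]_n -> 'rV[R]_n}) (s : R).
Hypotheses (s_gt0 : 0 < s) (enormS : forall v, enorm (S v) = s * enorm v).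

(** Every cell is a translated homothetic copy of the unit cell, so [c] is the factor by which [S]
    scales all cells and bounds the factor for any set. *)
Let c := lam (S @` cell 0 0).

Let S_affine (x0 : 'rV[R]_n) (t : R) X : 0 < t ->
  lam (S @` [set x0 + t *: x | x in X]) = ((t ^+ n)%:E * lam (S @` X))%E.
Proof.
move=> t0; rewrite -(lebesgue_affine (S x0) _ t0); congr lam.
apply/seteqP; split => [_ [_ [x Xx <-] <-]|_ [_ [x Xx <-] <-]].
  by exists (S x); [exists x|rewrite linearD linearZ].
by exists (x0 + t *: x); [exists x|rewrite linearD linearZ].
Qed.

Let c_fin : c \is a fin_num.
Proof.
rewrite ge0_fin_numE ?lebesgue_ge0//.
apply: (@le_lt_trans _ _ ((s * n%:R) ^+ n * (2 ^+ 0)^-1 ^+ n)%:E); last exact: ltry.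
rewrite EFinM -(lebesgue_cell 0 0); apply: lebesgue_lipschitz.
  by rewrite mulr_ge0// ltW.
move=> x y r r0 _ _ xy i.
have := ler_coord_enorm (S (x - y)) i; rewrite linearB !mxE => /le_trans; apply.
rewrite -linearB enormS -mulrA ler_pM2l//; apply: ler_enorm_coord => // j.
by rewrite !mxE.
Qed.

Let lebesgue_S E : (lam (S @` E) <= c * lam E)%E.
Proof.
have fc := c_fin; rewrite -(fineK fc); apply: lebesgue_image_le => [|k m].
  by rewrite fine_ge0// lebesgue_ge0.
pose x0 : 'rV[R]_n := \row_i ((m i)%:~R / 2 ^+ k).
have k0 : 0 < (2 ^+ k)^-1 :> R by rewrite invr_gt0 exprn_gt0.
apply: (@le_trans _ _ (lam (S @` [set x0 + (2 ^+ k)^-1 *: x | x in cell 0 0]))).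
  apply: le_lebesgue => _ [x [cx _] <-]; exists x => //.
  exists (2 ^+ k *: (x - x0)); last first.
    by rewrite scalerA mulVf ?expf_neq0// scale1r addrC subrK.
  apply/unit_cellP => i; have := cell_itv k m x; case=> /(_ cx i) + _.
  rewrite /= !in_itv/= !mxE intrD mulrDl mul1r => /andP[h1 h2].
  rewrite pmulr_rge0 ?exprn_gt0// subr_ge0 h1/= mulrC -ltr_pdivlMr ?exprn_gt0//.
  by rewrite mul1r ltrBlDr addrC.
by rewrite S_affine// EFinM fineK// muleC.
Qed.

Let unit_ball := [set v : 'rV[R]_n | enorm v < 1].

Let measurable_unit_ball : measurable unit_ball.
Proof.
have -> : unit_ball = (fun v => dot v v) @^-1` [set x | x < 1].
  have e v : (enorm v < 1) = (dot v v < 1) by rewrite /enorm -[X in _ < X]sqrtr1 ltr_sqrt.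
  by apply/seteqP; split => v; rewrite /unit_ball/= e.
apply: open_measurable_row; apply: open_comp; last exact: open_lt.
move=> v _; apply: differentiable_continuous.
rewrite (_ : (fun v => dot v v) = \sum_i (fun v : 'rV[R]_n => v ord0 i * v ord0 i)).
  by apply: differentiable_sum => i; apply: differentiableM; exact: differentiable_coord.
by apply/funext => w; rewrite fct_sumE.
Qed.

Let affine_unit_cell (x0 : 'rV[R]_n) (t : R) : 0 < t ->
  lam [set (x0 + t *: x)%R | x in cell 0 0] = (t ^+ n)%:E.
Proof.
by move=> t0; rewrite lebesgue_affine// lebesgue_cell expr0 invr1 expr1n mule1.
Qed.

Let unit_ball_gt0 : (0 < lam unit_ball)%E.
Proof.
(* In the cube of side 1/(n+1) at the origin the Euclidean norm is at most n/(n+1). *)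
have t0 : 0 < n.+1%:R^-1 :> R by rewrite invr_gt0 ltr0n.
apply: (@lt_le_trans _ _ (lam [set (0 + n.+1%:R^-1 *: x)%R | x in cell 0 0])).
  by rewrite affine_unit_cell// lte_fin exprn_gt0.
apply: le_lebesgue => _ [x /unit_cellP cx <-]; rewrite /unit_ball/= add0r.
apply: (@le_lt_trans _ _ (n%:R * n.+1%:R^-1)); last first.
  by rewrite ltr_pdivrMr ?ltr0n// mul1r ltr_nat.
apply: ler_enorm_coord => [|i]; first exact: ltW.
have /andP[x0 x1] := cx i.
by rewrite !mxE normrM gtr0_norm// ger_pMr// ger0_norm// ltW.
Qed.

Let unit_ball_sub : unit_ball `<=` [set const_mx (-1) + 2 *: x | x in cell 0 0].
Proof.
move=> v v1; have vi i := le_lt_trans (ler_coord_enorm v i) v1.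
exists (2^-1 *: (v + const_mx 1)); last first.
  rewrite scalerA divff// scale1r addrC -addrA.
  by rewrite (_ : const_mx 1 + const_mx (-1) = 0) ?addr0//; apply/rowP => i; rewrite !mxE subrr.
apply/unit_cellP => i; rewrite !mxE.
have := vi i; rewrite ltr_norml => /andP[v_gt v_lt].
by apply/andP; split; lra.
Qed.

(* [S] maps the unit ball into the ball of radius [s], so the factor [c] by which it
   scales measure is at most [s ^+ n]. *)
Lemma lebesgue_similarity E : (lam (S @` E) <= (s ^+ n)%:E * lam E)%E.
Proof.
pose P := [set const_mx (-1) + 2 *: x | x in cell 0 0] : set 'rV[R]_n.
have lamP : lam P = (2 ^+ n)%:E by rewrite affine_unit_cell.
have lamSP : lam (S @` P) = ((2 ^+ n)%:E * c)%E by rewrite S_affine.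
pose P' := P `&` ~` unit_ball.
have PE : lam P = (lam unit_ball + lam P')%E.
  have := @caratheodory_measurable_mu_ext _ R _ mu _ measurable_unit_ball P.
  by rewrite (setIidr unit_ball_sub).
have fin X : X `<=` P -> lam X \is a fin_num.
  move=> XP; rewrite ge0_fin_numE ?lebesgue_ge0//.
  by rewrite (le_lt_trans (le_lebesgue XP))// lamP ltry.
have fB := fin _ unit_ball_sub; have fP' : lam P' \is a fin_num.
  by apply: fin; exact: subIsetl.
have SB : (lam (S @` unit_ball) <= (s ^+ n)%:E * lam unit_ball)%E.
  rewrite -(lebesgue_affine 0 _ s_gt0); apply: le_lebesgue => _ [v v1 <-].
  exists (s^-1 *: S v).
    rewrite /unit_ball/= enormZ enormS gtr0_norm ?invr_gt0// mulrA mulVf ?mul1r//.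
    by rewrite gt_eqF.
  by rewrite scalerA mulfV ?gt_eqF// scale1r add0r.
suff cs : (c <= (s ^+ n)%:E)%E.
  apply: (le_trans (lebesgue_S E)); apply: lee_wpmul2r => //; exact: lebesgue_ge0.
(* With B the ball, c (|B| + |P'|) = |S P| <= s^n |B| + c |P'|. The terms in P' are finite and
   cancel, and |B| > 0 can be divided out. *)
have SPle : (lam (S @` P) <= (s ^+ n)%:E * lam unit_ball + c * lam P')%E.
  apply: (@le_trans _ _ (lam (S @` unit_ball) + lam (S @` P'))).
    apply: le_trans (lebesgueU _ _); apply: le_lebesgue => _ [v Pv <-].
    by have [vB|vB] := pselect (unit_ball v); [left|right]; exists v.
  by apply: leeD => //; exact: lebesgue_S.
move: SPle unit_ball_gt0; rewrite lamSP -lamP PE -(fineK c_fin) -(fineK fB) -(fineK fP').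
move: (fine c) (fine (lam unit_ball)) (fine (lam P')) => x y z.
rewrite -EFinD -!EFinM -EFinD !lee_fin lte_fin => SPle y0.
by rewrite -(ler_pM2r y0); lra.
Qed.

End Similarity.
End OuterLebesgue.

(** * Change of variables *)

Section LebesgueMeasurable.
Context {R : realType} {n : nat}.
Local Notation mu := (borel_lebesgue (R := R) n).
Local Notation lam := (lebesgue R n : set 'rV[R]_n -> \bar R).
Local Notation lmeasurable E := (measurable (E : set (lebesgueT R n))).
Implicit Types (X Y B E : set 'rV[R]_n) (r : R).

Lemma borel_lmeasurable B : measurable B -> lmeasurable B.
Proof. exact: caratheodory_measurable_mu_ext. Qed.

Lemma null_lmeasurable E : lam E = 0%E -> lmeasurable E.
Proof.
move=> E0; apply: le_caratheodory_measurable => X.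
have XE0 : lam (X `&` E) = 0%E.
  apply/eqP; rewrite eq_le lebesgue_ge0 andbT -E0.
  by apply: le_lebesgue; exact: subIsetr.
rewrite [X in (X + _)%E](XE0) add0e.
by apply: le_lebesgue; exact: subIsetl.
Qed.

(** Intersect covers of excess 1/(k+1). Measurability of [E] splits the measure of the intersection,
    and finiteness allows the cancellation. *)
Lemma lebesgue_hull E : lmeasurable E -> (lam E < +oo)%E ->
  exists H, [/\ measurable H, E `<=` H & lam (H `\` E) = 0%E].
Proof.
move=> mE Eoo; have fE : lam E \is a fin_num by rewrite ge0_fin_numE ?lebesgue_ge0.
have /choice[F FP] : forall k : nat, exists F : (set 'rV[R]_n)^nat,
    measurable_cover E F /\ (\sum_(i <oo) mu (F i) <= lam E + (k.+1%:R^-1)%:E)%E.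
  move=> k; have k0 : 0 < k.+1%:R^-1 :> R by rewrite invr_gt0.
  have [_ [F cF <-] /ltW Fk] := lb_ereal_inf_adherent k0 fE.
  by exists F.
have mF k i : measurable (F k i) by have [[]] := FP k.
pose H := \bigcap_k \bigcup_i F k i.
have mH : measurable H.
  by apply: bigcapT_measurable => k; exact: bigcupT_measurable.
have EH : E `<=` H by move=> x Ex k _; have [[_ EF] _] := FP k; exact: EF.
exists H; split => //.
have lH : (lam H <= lam E)%E.
  apply/lee_addgt0Pr => e e0.
  pose k := Num.truncn e^-1.
  have [[_ EF] Fk] := FP k.
  apply: (@le_trans _ _ (lam (\bigcup_i F k i))); first by apply: le_lebesgue => x; apply.
  apply: le_trans (lebesgue_bigcup _) _.
  rewrite (eq_eseriesr (g := fun i => mu (F k i))); last first.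
    by move=> i _; exact: lebesgue_borel.
  apply: (le_trans Fk); rewrite leeD2l// lee_fin invf_ple ?posrE// ltW//.
  exact: truncnS_gt.
have HE : lam H = (lam E + lam (H `\` E))%E.
  by have := mE H; rewrite (setIidr EH).
move: lH; rewrite HE -[X in (_ <= X)%E]adde0 leeD2lE// => HE0.
by apply/eqP; rewrite eq_le HE0 lebesgue_ge0.
Qed.

End LebesgueMeasurable.

Lemma lee_mul1Dgt0 (R : realType) (a b : \bar R) : (0 <= b)%E ->
  (forall e : R, 0 < e -> (a <= (1 + e)%:E * b)%E) -> (a <= b)%E.
Proof.
case: b => [r|_ _|]; [|exact: leey|by rewrite leeNy_eq].
rewrite lee_fin => r0 le_e; apply/lee_addgt0Pr => e e0.
have r1 : 0 < r + 1 by rewrite ltr_wpDl.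
apply: (le_trans (le_e (e / (r + 1)) _)); first by rewrite divr_gt0.
rewrite -EFinM -EFinD lee_fin mulrDl mul1r lerD2l -mulrA ger_pMr//.
by rewrite mulrC ler_pdivrMr// mul1r lerDl.
Qed.

Section Transfer.
Context {R : realType} {n : nat}.
Local Notation lam := (lebesgue R n : set 'rV[R]_n -> \bar R).
Local Notation lmeasurable E := (measurable (E : set (lebesgueT R n))).
Implicit Types (E F X : set 'rV[R]_n).

(* [M] expands measure by at most about [J]. With the same for the inverse of [M] and the
   reciprocal of [J], this suffices for a change of variables. *)
Definition locally_dominated (W : set 'rV[R]_n) (M : 'rV[R]_n -> 'rV[R]_n)
    (J : 'rV[R]_n -> R) :=
  forall x0, W x0 -> forall e : R, 0 < e -> exists2 d : R, 0 < d &
    exists2 K : R, 0 <= K & (forall x, ball x0 d x -> W x /\ K <= J x) /\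
      forall E, E `<=` ball x0 d -> (lam (M @` E) <= ((1 + e) * K)%:E * lam E)%E.

(** Domination with a fixed [K] passes to subsets, so [cell_decomposition] cuts [W] into disjoint
    cells that each carry one constant. *)
Lemma locally_dominated_cover W M J (e : R) : locally_dominated W M J -> 0 < e ->
  exists F : (set 'rV[R]_n)^nat, [/\ trivIset setT F, W = \bigcup_i F i,
    forall i, measurable (F i) & forall i, exists2 K : R, 0 <= K &
      (forall x, F i x -> K <= J x) /\
      forall E, E `<=` F i -> (lam (M @` E) <= ((1 + e) * K)%:E * lam E)%E].
Proof.
move=> dM e0; pose P X := X `<=` W /\ exists2 K : R, 0 <= K &
  (forall x, X x -> K <= J x) /\
  forall E, E `<=` X -> (lam (M @` E) <= ((1 + e) * K)%:E * lam E)%E.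
have [|F [tF Fcell WF]] := @cell_decomposition R n P.
  move=> X Y XY [YW [K K0 [KJ KM]]]; split; first exact: subset_trans YW.
  by exists K => //; split => [x /XY/KJ//|E EX]; apply: KM; exact: subset_trans XY.
have PF i : P (F i).
  have [->|[km [_ //]]] := Fcell i; split => //; exists 0 => //; split => // E.
  by rewrite subset0 => ->; rewrite image_set0 lebesgue0 mule0.
exists F; split => //; first 1 last.
- move=> i; apply: measurable_cell_or_set0.
  by have [->|[km []]] := Fcell i; [left|right; exists km].
- by move=> i; have [] := PF i.
apply/seteqP; split => [x Wx|x [i _ Fix]]; last by have [FW _] := PF i; exact: FW.
have [d d0 [K K0 [KJ KM]]] := dM _ Wx _ e0; apply: WF d0 _.
by split => [y /KJ[]//|]; exists K => //; split => // y /KJ[].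
Qed.

Variables (W W' : set 'rV[R]_n) (M N : 'rV[R]_n -> 'rV[R]_n) (J' : 'rV[R]_n -> R).
Hypotheses (oW : open W) (MW : forall x, W x -> W' (M x))
  (NW : forall y, W' y -> W (N y)) (MK : forall x, W x -> N (M x) = x)
  (NK : forall y, W' y -> M (N y) = y)
  (cM : forall x, W x -> {for x, continuous M}).
Hypothesis dN : locally_dominated W' N J'.

Let preimE F : W `&` M @^-1` F = N @` (F `&` W').
Proof.
apply/seteqP; split => [x [Wx FMx]|_ [y [Fy W'y] <-]].
  by exists (M x); [split => //; exact: MW|exact: MK].
by split; [exact: NW|rewrite /= NK].
Qed.

(** The preimage is an image under [N], and on each cell [N] multiplies outer measure by a finite
    factor at most. *)
Let null_preim F : lam F = 0%E -> lam (W `&` M @^-1` F) = 0%E.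
Proof.
move=> F0; have [G [_ WG _ GK]] := locally_dominated_cover dN ltr01.
apply/eqP; rewrite eq_le lebesgue_ge0 andbT preimE.
apply: (@le_trans _ _ (lam (\bigcup_i (N @` (F `&` G i))))).
  apply: le_lebesgue => _ [y [Fy W'y] <-].
  have [i _ Giy] : (\bigcup_i G i) y by rewrite -WG.
  by exists i => //; exists y.
apply: (le_trans (lebesgue_bigcup _)); rewrite eseries0// => i _ _.
have [K K0 [_ KN]] := GK i; apply/eqP; rewrite eq_le lebesgue_ge0 andbT.
apply: le_trans (KN _ (@subIsetr _ _ _)) _.
suff -> : lam (F `&` G i) = 0%E by rewrite mule0.
apply/eqP; rewrite eq_le lebesgue_ge0 andbT -F0.
by apply: le_lebesgue; exact: subIsetl.
Qed.

Let borel_preim B : measurable B -> measurable (W `&` M @^-1` B).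
Proof.
apply: (@row_borel_ind _ _ (fun B => measurable (W `&` M @^-1` B))) => {B}.
- by rewrite preimage_set0 setI0; exact: measurable0.
- move=> A mA; rewrite (_ : W `&` _ = W `\` (W `&` M @^-1` A)); last first.
    by rewrite setDIr setDv set0U.
  by apply: measurableD => //; exact: open_measurable_row.
- by move=> F mF; rewrite preimage_bigcup setI_bigcupr; exact: bigcupT_measurable.
move=> i t; apply: open_measurable_row.
rewrite openE => x [Wx /= tx]; apply: filterI; first exact: open_nbhs_nbhs.
have := cM Wx; apply; apply: open_nbhs_nbhs; split => //.
apply: (@open_comp _ _ (fun v : 'rV[R]_n => v ord0 i) [set u | t < u]);
  first by move=> v _; exact: coord_continuous.
exact: open_gt.
Qed.

(** A bounded measurable set is a Borel set minus a null set; preimages of the former are Borel by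
    continuity, those of the latter null. *)
Lemma lmeasurable_preimage F : lmeasurable F -> lmeasurable (W `&` M @^-1` F).
Proof.
move=> mF.
have -> : W `&` M @^-1` F = \bigcup_(j : nat) (W `&` M @^-1` (F `&` ball 0 j.+1%:R)).
  apply/seteqP; split => [x [Wx FMx]|x [j _ [Wx [FMx _]]]//].
  exists (Num.truncn `|M x|) => //; split => //; split => //.
  by rewrite -ball_normE/= sub0r normrN truncnS_gt.
apply: bigcupT_measurable => j.
have mFj : lmeasurable (F `&` ball 0 j.+1%:R).
  apply: measurableI => //; apply: borel_lmeasurable.
  by apply: open_measurable_row; exact: ball_open.
have Fjoo : (lam (F `&` ball (0%R : 'rV[R]_n) j.+1%:R) < +oo)%E.
  apply: le_lt_trans (lebesgue_ball_lty j.+1%:R).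
  by apply: le_lebesgue; exact: subIsetr.
have [H [mH FH H0]] := lebesgue_hull mFj Fjoo.
rewrite (_ : W `&` _ = (W `&` M @^-1` H) `\`
  (W `&` M @^-1` (H `\` (F `&` ball 0 j.+1%:R)))); last first.
  apply/seteqP; split => [x [Wx FMx]|x [[Wx HMx] h]].
    by split; [split => //; exact: FH|move=> [_ []]].
  by split => //; apply: contrapT => FMx; apply: h.
apply: measurableD; last by apply: null_lmeasurable; exact: null_preim.
by apply: borel_lmeasurable; exact: borel_preim.
Qed.

Let mW' : lmeasurable W'.
Proof.
have [G [_ -> mG _]] := locally_dominated_cover dN ltr01.
by apply: bigcupT_measurable => i; exact: borel_lmeasurable.
Qed.

Lemma lmeasurable_fun_comp d (T : measurableType d) (k : 'rV[R]_n -> T) :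
  measurable_fun (W' : set (lebesgueT R n)) k ->
  measurable_fun (W : set (lebesgueT R n)) (k \o M).
Proof.
move=> mk mW Y mY.
have := lmeasurable_preimage (mk mW' _ mY).
congr (lmeasurable _); apply/seteqP; split => [x [Wx [_ kMx]]//|x [Wx kMx]].
by split => //; split => //; exact: MW.
Qed.

Hypothesis mJ' : measurable_fun (W' : set (lebesgueT R n)) J'.

(** [M] made total by the value 0 off [W], so that it has a pushforward; the measure pushed forward
    is restricted to [W] and ignores that value. *)
Let phi (x : lebesgueT R n) : lebesgueT R n := if x \in W then M x else 0.

Let mphi : measurable_fun setT phi.
Proof.
move=> _ F mF; rewrite setTI.
have -> : phi @^-1` F = (W `&` M @^-1` F) `|` (~` W `&` [set x | F 0]).
  apply/seteqP; split => x; rewrite /phi/=.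
    by case: ifPn => [/set_mem|/negP xW]; [left|right; split => // /mem_set].
  by move=> [[Wx]|[Wx]]; [rewrite mem_set|rewrite memNset].
apply: measurableU; first exact: lmeasurable_preimage.
have [F0|F0] := pselect (F 0).
  rewrite (_ : [set _ | _] = setT) ?setIT; last by apply/seteqP; split.
  by apply: measurableC; apply: borel_lmeasurable; exact: open_measurable_row.
by rewrite (_ : [set _ | _] = set0) ?setI0 -?subset0.
Qed.

Let Phi : {mfun lebesgueT R n >-> lebesgueT R n} :=
  HB.pack phi (isMeasurableFun.Build _ _ _ _ _ mphi).

(** The bound on [N] says that on [D] the pushforward under [M] of Lebesgue measure on [W] is at
    most [c * K] times Lebesgue measure; [K] is then replaced by the larger [J']. *)
Let integral_cell (k : 'rV[R]_n -> \bar R) D (c K : R) : 0 <= c -> 0 <= K ->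
  lmeasurable D -> D `<=` W' -> (forall y, D y -> K <= J' y) ->
  (forall E, E `<=` D -> (lam (N @` E) <= (c * K)%:E * lam E)%E) ->
  (forall y, 0 <= k y)%E -> measurable_fun (setT : set (lebesgueT R n)) k ->
  (\int[lebesgue R n]_(x in W `&` M @^-1` D) k (M x) <=
   c%:E * \int[lebesgue R n]_(y in D) (k y * (J' y)%:E))%E.
Proof.
move=> c0 K0 mD DW' KJ NK_le k0 mk.
have mW : lmeasurable W by apply: borel_lmeasurable; exact: open_measurable_row.
pose lW := mrestr (lebesgue R n) mW.
have mA : lmeasurable (W `&` M @^-1` D) by exact: lmeasurable_preimage.
have AD : W `&` M @^-1` D `<=` phi @^-1` D.
  by move=> x [Wx DMx]; rewrite /= /phi mem_set.
have mphiD : lmeasurable (phi @^-1` D) by rewrite -[X in measurable X]setTI; exact: mphi.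
apply: (@le_trans _ _ (\int[lW]_(x in W `&` M @^-1` D) k (phi x))%E).
  rewrite [leRHS](_ : _ = \int[lebesgue R n]_(x in W `&` M @^-1` D) k (phi x))%E.
    rewrite le_eqVlt; apply/orP; left; apply/eqP; apply: eq_integral => x.
    by rewrite inE => -[Wx _]; rewrite /phi mem_set.
  apply: eq_measure_integral => A _ AW.
  by rewrite /lW/= /mrestr (setIidl (B := W))// => x /AW[].
apply: (@le_trans _ _ (\int[lW]_(x in phi @^-1` D) k (phi x))%E).
  apply: ge0_subset_integral; [exact: mA|exact: mphiD| |by move=> x _; exact: k0|exact: AD].
  by apply: measurable_funTS; exact: measurableT_comp mk mphi.
rewrite -[leLHS](@ge0_integral_pushforward _ _ _ _ _ phi mphi lW D k mD); last 2 first.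
- exact: measurable_funTS.
- by move=> y _; exact: k0.
have cK0 : 0 <= c * K by rewrite mulr_ge0.
pose lc := mscale (NngNum cK0) (lebesgue R n).
apply: (@le_trans _ _ (\int[lc]_(y in D) k y)%E).
  rewrite (@eq_measure_integral _ _ _ _ (mrestr (pushforward lW Phi) mD)); last first.
    by move=> A _ AD'; rewrite /= /mrestr setIidl.
  apply: ge0_le_measure_integral => // A mA'.
  rewrite /lc/= /mrestr /mscale/= /pushforward/= /lW /mrestr/=.
  have AK := NK_le _ (@subIsetr _ A D).
  apply: (@le_trans _ _ (lam (N @` (A `&` D)))).
    apply: le_lebesgue => x [[Ax Dx] Wx]; exists (M x); last exact: MK.
    by move: Ax Dx; rewrite /phi mem_set.
  apply: (le_trans AK); apply: lee_wpmul2l; first by rewrite lee_fin.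
  by apply: le_lebesgue; exact: subIsetl.
rewrite ge0_integral_mscale//=; last exact: measurable_funTS.
rewrite EFinM -muleA; apply: lee_wpmul2l; first by rewrite lee_fin.
rewrite -ge0_integralZl//; last exact: measurable_funTS.
apply: ge0_le_integral; first exact: mD.
- by move=> y _; apply: mule_ge0; rewrite ?lee_fin.
- by apply: emeasurable_funM; [exact: measurable_cst|exact: measurable_funTS].
- apply: emeasurable_funM; first exact: measurable_funTS.
  by apply/measurable_EFinP; exact: measurable_funS mW' DW' mJ'.
by move=> y Dy; rewrite muleC lee_wpmul2l// lee_fin KJ.
Qed.

(** On each cell the constant [K] stands in for [J'] at the price of a factor 1 + e; sum over the
    cells and let [e] tend to 0. *)
Lemma transfer_integral_le (k : 'rV[R]_n -> \bar R) :
  measurable_fun (W' : set (lebesgueT R n)) k ->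
  (forall y, W' y -> 0 <= k y)%E -> (forall y, W' y -> 0 <= J' y) ->
  (\int[lebesgue R n]_(x in W) k (M x) <=
   \int[lebesgue R n]_(y in W') (k y * (J' y)%:E))%E.
Proof.
move=> mk k0 J0; pose kT := k \_ W'.
have kT0 y : (0 <= kT y)%E.
  by rewrite /kT /patch; case: ifPn => // /set_mem; exact: k0.
have mkT : measurable_fun (setT : set (lebesgueT R n)) kT.
  exact/(measurable_restrictT _ mW').1.
have kTE y : W' y -> kT y = k y by move=> W'y; rewrite /kT /patch mem_set.
have mW : lmeasurable W by apply: borel_lmeasurable; exact: open_measurable_row.
have le_e (e : R) : 0 < e -> (\int[lebesgue R n]_(x in W) k (M x) <=
    (1 + e)%:E * \int[lebesgue R n]_(y in W') (k y * (J' y)%:E))%E.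
  move=> e0; have [G [tG WG mG GK]] := locally_dominated_cover dN e0.
  have WE : W = \bigcup_i (W `&` M @^-1` (G i)).
    rewrite -setI_bigcupr -preimage_bigcup -WG; apply/esym/setIidl => x.
    exact: MW.
  have mGl i : lmeasurable (G i) by exact: borel_lmeasurable.
  have GW' i : G i `<=` W' by rewrite WG; exact: bigcup_sup.
  have mWG i : lmeasurable (W `&` M @^-1` (G i)) by exact: lmeasurable_preimage.
  rewrite (eq_integral (fun x : lebesgueT R n => kT (M x))); last first.
    by move=> x /set_mem Wx; rewrite kTE//; exact: MW.
  rewrite {1}WE (ge0_integral_bigcup _ mWG); last 3 first.
  - rewrite -WE; apply: (@lmeasurable_fun_comp _ _ kT).
    exact: measurable_funTS.
  - by move=> x _; exact: kT0.
  - apply/trivIsetP => i j _ _ ij; rewrite -subset0 => x [[_ Gi] [_ Gj]].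
    by have /trivIsetP/(_ i j I I ij) := tG; rewrite -subset0 => /(_ (M x)); apply; split.
  rewrite [in leRHS]WG (ge0_integral_bigcup _ mGl); last 3 first.
  - rewrite -WG; apply: emeasurable_funM; first exact: mk.
    by apply/measurable_EFinP; exact: mJ'.
  - rewrite -WG => y W'y; apply: mule_ge0; first exact: k0.
    by rewrite lee_fin; exact: J0.
  - exact: tG.
  rewrite -nneseriesZl; last first.
    move=> i _; apply: integral_ge0 => y /GW' W'y; apply: mule_ge0; first exact: k0.
    by rewrite lee_fin; exact: J0.
  apply: lee_nneseries => [i _ _|i _]; first exact: integral_ge0.
  have [K K0 [KJ KM]] := GK i.
  rewrite (_ : \int[lebesgue R n]_(y in G i) (k y * (J' y)%:E) =
      \int[lebesgue R n]_(y in G i) (kT y * (J' y)%:E))%E; last first.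
    by apply: eq_integral => y /set_mem/GW' W'y; rewrite kTE.
  apply: (integral_cell _ K0 (mGl i) (GW' i) KJ KM kT0 mkT).
  by rewrite addr_ge0// ltW.
apply: lee_mul1Dgt0 => [|e e0]; last exact: le_e.
apply: integral_ge0 => y W'y; apply: mule_ge0; first exact: k0.
by rewrite lee_fin; exact: J0.
Qed.

End Transfer.

Section ChangeOfVariables.
Context {R : realType} {n : nat}.
Local Notation lmeasurable E := (measurable (E : set (lebesgueT R n))).
Variables (W W' : set 'rV[R]_n) (M N : 'rV[R]_n -> 'rV[R]_n).
Variables (J J' : 'rV[R]_n -> R).
Hypotheses (oW : open W) (oW' : open W').
Hypotheses (MW : forall x, W x -> W' (M x)) (NW : forall y, W' y -> W (N y)).
Hypotheses (MK : forall x, W x -> N (M x) = x) (NK : forall y, W' y -> M (N y) = y).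
Hypotheses (cM : forall x, W x -> {for x, continuous M})
  (cN : forall y, W' y -> {for y, continuous N}).
Hypotheses (dM : locally_dominated W M J) (dN : locally_dominated W' N J').
Hypotheses (mJ : measurable_fun (W : set (lebesgueT R n)) J)
  (mJ' : measurable_fun (W' : set (lebesgueT R n)) J').
Hypotheses (J0 : forall x, W x -> 0 <= J x) (J'0 : forall y, W' y -> 0 <= J' y).
Hypothesis JJ' : forall x, W x -> J x * J' (M x) = 1.

Lemma change_of_variables (k : 'rV[R]_n -> \bar R) :
  measurable_fun (W' : set (lebesgueT R n)) k -> (forall y, W' y -> 0 <= k y)%E ->
  (\int[lebesgue R n]_(x in W) (k (M x) * (J x)%:E) =
   \int[lebesgue R n]_(y in W') k y)%E.
Proof.
move=> mk k0.
have mJN : measurable_fun (W' : set (lebesgueT R n)) (J \o N).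
  exact: (lmeasurable_fun_comp oW' NW MW NK MK cN dM mJ).
have mkM : measurable_fun (W : set (lebesgueT R n)) (k \o M).
  exact: (lmeasurable_fun_comp oW MW NW MK NK cM dN mk).
apply/eqP; rewrite eq_le; apply/andP; split.
  (* The integrand carries the Jacobian [J (N y)], which [J' y] cancels after the transfer. *)
  have := @transfer_integral_le _ _ _ _ _ _ _ oW MW NW MK NK cM dN mJ'
    (fun y => k y * (J (N y))%:E)%E.
  rewrite (eq_integral (fun x : lebesgueT R n => k (M x) * (J x)%:E)%E); last first.
    by move=> x /set_mem Wx; rewrite MK.
  move=> /(_ _ _ J'0) h; apply: (le_trans (h _ _)).
  - by apply: emeasurable_funM; [exact: mk|apply/measurable_EFinP; exact: mJN].
  - move=> y W'y; apply: mule_ge0; first exact: k0.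
    by rewrite lee_fin J0//; exact: NW.
  rewrite le_eqVlt; apply/orP; left; apply/eqP; apply: eq_integral => y /set_mem W'y.
  by have := JJ' (NW W'y); rewrite NK// => JJ; rewrite -muleA -EFinM JJ mule1.
(* Conversely [k] is the composite of [k \o M] with [N], so the inequality for [N] brings out [J]
   directly. *)
have := @transfer_integral_le _ _ _ _ _ _ _ oW' NW MW NK MK cN dM mJ (k \o M).
rewrite (eq_integral (k : lebesgueT R n -> \bar R)); last first.
  by move=> y /set_mem W'y /=; rewrite NK.
by apply => // x Wx /=; apply: k0; exact: MW.
Qed.

End ChangeOfVariables.

(** * Smooth functions and the Dirac operator *)

Section NearDifferentiable.
Context {R : realType} {V W : normedModType R}.

Lemma near_eq_differentiable (f g : V -> W) (x : V) :
  (\forall y \near x, f y = g y) -> differentiable f x -> differentiable g x.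
Proof.
move=> fg df; have /diff_locallyP[cdf fE] := df.
have fgx : f x = g x by exact: nbhs_singleton fg.
have gE : g \o shift x = cst (g x) + 'd f x +o_ 0 id.
  apply/eqaddoP => e e0; have /eqaddoP/(_ _ e0) fe := fE.
  have fg0 : \forall y \near 0, f (y + x) = g (y + x).
    have x0 : (fun y => y + x) y @[y --> (0 : V)] --> x.
      by rewrite -[X in _ --> X]add0r; apply: cvgD; [exact: cvg_id|exact: cvg_cst].
    exact: x0 _ fg.
  near=> y.
  have : `|((f \o shift x) - (cst (f x) + 'd f x)) y| <= e * `|id y| by near: y.
  rewrite /= !fctE/= fgx; suff -> : f (y + x) = g (y + x) by [].
  by near: y.
apply/diff_locallyP; rewrite (diff_unique cdf gE).
by split => //; rewrite gE.
Unshelve. all: by end_near. Qed.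

End NearDifferentiable.

Section Partial.
Context {R : realType} {n : nat}.
Implicit Types (f g : 'rV[R]_n -> R) (M : 'rV[R]_n -> 'rV[R]_n) (U W : set 'rV[R]_n)
  (x : 'rV[R]_n) (i j : 'I_n).

Lemma eq_on_near U f g x : open U -> (forall y, U y -> f y = g y) -> U x ->
  \forall y \near x, f y = g y.
Proof.
by move=> oU fg Ux; apply: filterS (open_nbhs_nbhs (conj oU Ux)) => y; exact: fg.
Qed.

Lemma eq_on_partial U f g i x : open U -> (forall y, U y -> f y = g y) -> U x ->
  partial i f x = partial i g x.
Proof. by move=> oU fg Ux; apply: near_eq_derive; exact: eq_on_near fg Ux. Qed.

Lemma eq_on_differentiable U f g x : open U -> (forall y, U y -> f y = g y) ->
  U x -> differentiable f x -> differentiable g x.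
Proof. by move=> oU fg Ux; apply: near_eq_differentiable; exact: eq_on_near fg Ux. Qed.

Lemma partial_cst (c : R) i x : partial i (fun=> c) x = 0.
Proof. exact: derive_cst. Qed.

Lemma partialD f g i x : differentiable f x -> differentiable g x ->
  partial i (fun y => f y + g y) x = partial i f x + partial i g x.
Proof. by move=> df dg; rewrite /partial deriveD//; exact: diff_derivable. Qed.

Lemma partialM f g i x : differentiable f x -> differentiable g x ->
  partial i (fun y => f y * g y) x = f x * partial i g x + partial i f x * g x.
Proof.
move=> df dg; rewrite /partial deriveM//; [|exact: diff_derivable..].
by congr (_ + _); rewrite /GRing.scale/= mulrC.
Qed.

Lemma partial_coord i j x : partial i (fun y => y ord0 j) x = (i == j)%:R.
Proof.
rewrite /partial; have dM : derivable (id : 'rV[R]_n -> 'rV[R]_n) x (delta_mx ord0 i).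
  exact: derivable_id.
have := derive_mx dM; rewrite derive_id => /matrixP/(_ ord0 j).
by rewrite !mxE eqxx/= eq_sym => <-.
Qed.

Lemma differentiable_row M x : (forall j, differentiable (fun y => M y ord0 j) x) ->
  differentiable M x.
Proof.
move=> dM; rewrite (_ : M = \sum_j (fun y => M y ord0 j *: delta_mx ord0 j)).
  by apply: differentiable_sum => j; exact: differentiableZl.
by apply/funext => y; rewrite fct_sumE; exact: row_sum_delta.
Qed.

Lemma partial_comp f M i x : differentiable f (M x) ->
  (forall j, differentiable (fun y => M y ord0 j) x) ->
  partial i (f \o M) x =
  \sum_j partial j f (M x) * partial i (fun y => M y ord0 j) x.
Proof.
move=> df dMj; have dM := differentiable_row dMj.
rewrite /partial deriveE; last exact: differentiable_comp.
rewrite diff_comp//= [X in 'd f (M x) X]row_sum_delta linear_sum/=.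
apply: eq_bigr => j _; rewrite linearZ/= -(deriveE _ df) -(deriveE _ dM) mulrC.
congr (_ * _); rewrite derive_mx ?mxE//.
by apply/derivable_mxP => a b; rewrite (ord1 a); apply: diff_derivable; exact: dMj.
Qed.

Lemma powR_differentiable f (a : R) x : differentiable f x -> 0 < f x ->
  differentiable (fun y => f y `^ a) x.
Proof.
move=> df fx0; rewrite (_ : (fun y => _) = (fun t : R => t `^ a) \o f)//.
apply: differentiable_comp df _.
by apply/derivable1_diffP; have [] := @is_derive1_powR R a _ fx0.
Qed.

Lemma partial_powR f (a : R) i x : differentiable f x -> 0 < f x ->
  partial i (fun y => f y `^ a) x = a * f x `^ (a - 1) * partial i f x.
Proof.
move=> df fx0; have [d1 dE] := @is_derive1_powR R a _ fx0.
have dp : differentiable (fun t : R => t `^ a) (f x) by exact/derivable1_diffP.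
rewrite /partial deriveE; last exact: differentiable_comp df dp.
rewrite (_ : (fun y => _) = (fun t : R => t `^ a) \o f)// diff_comp//= -(deriveE _ df).
rewrite -[X in 'd _ _ X]mulr1 -[X in 'd _ _ X]/(_ *: (1 : R)) linearZ/= -deriveE//.
by rewrite dE /GRing.scale/= mulrC.
Qed.

End Partial.

(** * Closure properties of smooth functions *)

Section Smooth.
Context {R : realType} {n : nat}.
Implicit Types (f g : 'rV[R]_n -> R) (M : 'rV[R]_n -> 'rV[R]_n) (U W : set 'rV[R]_n)
  (x : 'rV[R]_n) (i j : 'I_n).

(** Coinduction for iterated partials: it suffices to place [f] in a class of differentiable
    functions that contains its partials up to equality on [U], which derivatives on an open set do
    not see. *)
Lemma smooth_on_coind U (P : ('rV[R]_n -> R) -> Prop) : open U ->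
  (forall f, P f -> (forall x, U x -> differentiable f x) /\
    forall i, exists2 g, P g & forall x, U x -> partial i f x = g x) ->
  forall f, P f -> smooth_on U f.
Proof.
move=> oU Pstep f Pf s.
have [g Pg fg] : exists2 g, P g & forall x, U x -> foldr partial f s x = g x.
  elim: s => [|i s [g Pg fg]]; first by exists f.
  have [_ /(_ i)[h Ph gh]] := Pstep _ Pg; exists h => // x Ux /=.
  by rewrite -gh//; exact: eq_on_partial fg Ux.
move=> x Ux; have [/(_ _ Ux) dg _] := Pstep _ Pg.
by apply: eq_on_differentiable Ux dg => // y Uy; rewrite fg.
Qed.

Lemma smooth_on_differentiable U f x : smooth_on U f -> U x -> differentiable f x.
Proof. by move=> sf; exact: (sf [::]). Qed.

Lemma smooth_on_partial U f i : smooth_on U f -> smooth_on U (partial i f).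
Proof. by move=> sf s x Ux; have := sf (rcons s i) x Ux; rewrite foldr_rcons. Qed.

Lemma smooth_onS U W f : U `<=` W -> smooth_on W f -> smooth_on U f.
Proof. by move=> UW sf s x /UW; exact: sf. Qed.

Lemma smooth_on_eq U f g : open U -> (forall x, U x -> f x = g x) ->
  smooth_on U f -> smooth_on U g.
Proof.
move=> oU fg sf; apply: (@smooth_on_coind U
  (fun g => exists2 f, smooth_on U f & forall x, U x -> f x = g x)) => //; last by exists f.
move=> {fg sf}g [{}f sf fg]; split => [x Ux|i].
  exact: (eq_on_differentiable oU fg Ux (smooth_on_differentiable sf Ux)).
exists (partial i f) => [|x Ux].
  by exists (partial i f) => //; exact: smooth_on_partial.
by apply/esym; exact: eq_on_partial fg Ux.
Qed.

(** The Leibniz, chain and power rules keep partials inside this class. Composites and powers are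
    built on smooth functions rather than on members of the class, so that the partials inside them
    are again admissible arguments. *)
Inductive smooth_gen U : ('rV[R]_n -> R) -> Prop :=
| SmoothBase f : smooth_on U f -> smooth_gen U f
| SmoothCst c : smooth_gen U (fun=> c)
| SmoothCoord i : smooth_gen U (fun x => x ord0 i)
| SmoothD f g : smooth_gen U f -> smooth_gen U g -> smooth_gen U (fun x => f x + g x)
| SmoothM f g : smooth_gen U f -> smooth_gen U g -> smooth_gen U (fun x => f x * g x)
| SmoothComp W f M : smooth_on W f -> (forall x, U x -> W (M x)) ->
    (forall j, smooth_on U (fun x => M x ord0 j)) -> smooth_gen U (f \o M)
| SmoothPowR f a : smooth_on U f -> (forall x, U x -> 0 < f x) ->
    smooth_gen U (fun x => f x `^ a).

Lemma smooth_gen_sum U (I : Type) (r : seq I) (F : I -> 'rV[R]_n -> R) :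
  (forall k, smooth_gen U (F k)) -> smooth_gen U (fun x => \sum_(k <- r) F k x).
Proof.
move=> sF; elim: r => [|k r IH].
  rewrite (_ : (fun x => _) = fun=> 0); first exact: SmoothCst.
  by apply/funext => x; rewrite big_nil.
rewrite (_ : (fun x => _) = fun x => F k x + \sum_(k <- r) F k x); first exact: SmoothD.
by apply/funext => x; rewrite big_cons.
Qed.

Lemma smooth_genP U f : open U -> smooth_gen U f -> smooth_on U f.
Proof.
move=> oU; move: f; apply: smooth_on_coind => // f; elim=> {f}.
- move=> f sf; split => [x|i]; first exact: smooth_on_differentiable.
  by exists (partial i f) => //; apply/SmoothBase/smooth_on_partial.
- move=> c; split => [x _|i]; first exact: differentiable_cst.
  by exists (fun=> 0) => [|x _]; [exact: SmoothCst|exact: partial_cst].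
- move=> j; split => [x _|i]; first exact: differentiable_coord.
  by exists (fun=> (i == j)%:R) => [|x _]; [exact: SmoothCst|exact: partial_coord].
- move=> f g _ [df Pf] _ [dg Pg]; split => [x Ux|i].
    by apply: differentiableD; [exact: df|exact: dg].
  have [f' sf' ff'] := Pf i; have [g' sg' gg'] := Pg i.
  exists (fun x => f' x + g' x) => [|x Ux]; first exact: SmoothD.
  by rewrite partialD ?ff' ?gg'//; [exact: df|exact: dg].
- move=> f g sf [df Pf] sg [dg Pg]; split => [x Ux|i].
    by apply: differentiableM; [exact: df|exact: dg].
  have [f' sf' ff'] := Pf i; have [g' sg' gg'] := Pg i.
  exists (fun x => f x * g' x + f' x * g x) => [|x Ux].
    by apply: SmoothD; exact: SmoothM.
  by rewrite partialM ?ff' ?gg'//; [exact: df|exact: dg].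
- move=> W f M sf UW sM.
  have dM j x : U x -> differentiable (fun y => M y ord0 j) x.
    by move=> Ux; exact: smooth_on_differentiable (sM j) Ux.
  have df x : U x -> differentiable f (M x).
    by move=> /UW; exact: smooth_on_differentiable.
  split => [x Ux|i].
    apply: differentiable_comp; last exact: df.
    by apply: differentiable_row => j; exact: dM.
  exists (fun x => \sum_j partial j f (M x) * partial i (fun y => M y ord0 j) x).
    apply: smooth_gen_sum => j; apply: SmoothM.
      by apply: (SmoothComp (W := W) (f := partial j f)) => //; exact: smooth_on_partial.
    by apply: SmoothBase; exact: smooth_on_partial.
  by move=> x Ux; rewrite partial_comp//; [exact: df|move=> j; exact: dM].
move=> f a sf f0; have df x (Ux : U x) := smooth_on_differentiable sf Ux.
split => [x Ux|i]; first by apply: powR_differentiable; [exact: df|exact: f0].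
exists (fun x => (a * f x `^ (a - 1)) * partial i f x) => [|x Ux]; last first.
  by rewrite partial_powR//; [exact: df|exact: f0].
apply: SmoothM; last by apply: SmoothBase; exact: smooth_on_partial.
by apply: SmoothM; [exact: SmoothCst|exact: SmoothPowR].
Qed.

Lemma smooth_on_cst U c : open U -> smooth_on U (fun=> c).
Proof. by move=> oU; apply: smooth_genP => //; exact: SmoothCst. Qed.

Lemma smooth_on_coord U i : open U -> smooth_on U (fun x => x ord0 i).
Proof. by move=> oU; apply: smooth_genP => //; exact: SmoothCoord. Qed.

Lemma smooth_onD U f g : open U -> smooth_on U f -> smooth_on U g ->
  smooth_on U (fun x => f x + g x).
Proof. by move=> oU sf sg; apply: smooth_genP => //; apply: SmoothD; exact: SmoothBase. Qed.

Lemma smooth_onM U f g : open U -> smooth_on U f -> smooth_on U g ->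
  smooth_on U (fun x => f x * g x).
Proof. by move=> oU sf sg; apply: smooth_genP => //; apply: SmoothM; exact: SmoothBase. Qed.

Lemma smooth_on_sum U (I : Type) (r : seq I) (F : I -> 'rV[R]_n -> R) : open U ->
  (forall k, smooth_on U (F k)) -> smooth_on U (fun x => \sum_(k <- r) F k x).
Proof.
by move=> oU sF; apply: smooth_genP => //; apply: smooth_gen_sum => k; exact: SmoothBase.
Qed.

Lemma smooth_on_comp U W f M : open U -> smooth_on W f ->
  (forall x, U x -> W (M x)) -> (forall j, smooth_on U (fun x => M x ord0 j)) ->
  smooth_on U (f \o M).
Proof. by move=> oU sf UW sM; apply: smooth_genP => //; exact: SmoothComp sf UW sM. Qed.

Lemma smooth_on_powR U f a : open U -> smooth_on U f -> (forall x, U x -> 0 < f x) ->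
  smooth_on U (fun x => f x `^ a).
Proof. by move=> oU sf f0; apply: smooth_genP => //; exact: SmoothPowR. Qed.

Lemma differentiable_bigsum (I : Type) (r : seq I) (F : I -> 'rV[R]_n -> R) x :
  (forall k, differentiable (F k) x) -> differentiable (fun y => \sum_(k <- r) F k y) x.
Proof.
move=> dF; elim: r => [|k r IH].
  rewrite (_ : (fun x => _) = fun=> 0); first exact: differentiable_cst.
  by apply/funext => y; rewrite big_nil.
rewrite (_ : (fun x => _) = fun x => F k x + \sum_(k <- r) F k x).
  exact: differentiableD.
by apply/funext => y; rewrite big_cons.
Qed.

Lemma partial_sum (I : Type) (r : seq I) (F : I -> 'rV[R]_n -> R) i x :
  (forall k, differentiable (F k) x) ->
  partial i (fun y => \sum_(k <- r) F k y) x = \sum_(k <- r) partial i (F k) x.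
Proof.
move=> dF; elim: r => [|k r IH].
  rewrite big_nil (_ : (fun x => _) = fun=> 0); first exact: partial_cst.
  by apply/funext => y; rewrite big_nil.
rewrite big_cons -IH -partialD//; last exact: differentiable_bigsum.
congr (partial i _ x); by apply/funext => y; rewrite big_cons.
Qed.

End Smooth.

Section CliffordCalculus.
Context {R : realType} {n : nat}.
Local Notation Cl := (clifford R n).
Implicit Types (g h : 'rV[R]_n -> Cl) (f : 'rV[R]_n -> R) (U : set 'rV[R]_n)
  (x : 'rV[R]_n) (i j : 'I_n).

Definition cl_smooth U g := forall A, smooth_on U (fun x => g x A).

Definition cl_diff g x := forall A, differentiable (fun y => g y A) x.

Definition cl_partial i g x : Cl := [ffun A => partial i (fun y => g y A) x].

Lemma cl_smooth_diff U g x : cl_smooth U g -> U x -> cl_diff g x.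
Proof. by move=> sg Ux A; exact: smooth_on_differentiable (sg A) Ux. Qed.

Lemma cl_diff_cst (a : Cl) x : cl_diff (fun=> a) x.
Proof. by move=> A; exact: differentiable_cst. Qed.

Lemma cl_partial_cst (a : Cl) i x : cl_partial i (fun=> a) x = 0.
Proof. by apply/ffunP => A; rewrite !ffunE partial_cst. Qed.

Lemma cl_diffD g h x : cl_diff g x -> cl_diff h x -> cl_diff (fun y => g y + h y) x.
Proof.
move=> dg dh A; rewrite (_ : (fun y => _) = fun y => g y A + h y A).
  by apply: differentiableD; [exact: dg|exact: dh].
by apply/funext => y; rewrite cl_addE.
Qed.

Lemma cl_partialD g h i x : cl_diff g x -> cl_diff h x ->
  cl_partial i (fun y => g y + h y) x = cl_partial i g x + cl_partial i h x.
Proof.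
move=> dg dh; apply/ffunP => A; rewrite cl_addE !ffunE.
rewrite (_ : (fun y => _) = fun y => g y A + h y A).
  by rewrite partialD; [|exact: dg|exact: dh].
by apply/funext => y; rewrite cl_addE.
Qed.

Let cl_mul_fun g h A : (fun y => (g y * h y) A) =
  fun y => \sum_B cl_sign B (cl_symdiff B A) * (g y B * h y (cl_symdiff B A)).
Proof. by apply/funext => y; rewrite cl_mulrE; apply: eq_bigr => B _; rewrite mulrA. Qed.

Let diff_term g h x A B : cl_diff g x -> cl_diff h x ->
  differentiable (fun y => (cl_sign B (cl_symdiff B A) : R) * (g y B * h y (cl_symdiff B A))) x.
Proof.
move=> dg dh; apply: differentiableM; first exact: differentiable_cst.
by apply: differentiableM; [exact: dg|exact: dh].
Qed.

Lemma cl_diffM g h x : cl_diff g x -> cl_diff h x -> cl_diff (fun y => g y * h y) x.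
Proof.
move=> dg dh A; rewrite cl_mul_fun.
by apply: differentiable_bigsum => B; exact: diff_term.
Qed.

Lemma cl_partialM g h i x : cl_diff g x -> cl_diff h x ->
  cl_partial i (fun y => g y * h y) x = cl_partial i g x * h x + g x * cl_partial i h x.
Proof.
move=> dg dh; apply/ffunP => A; rewrite cl_addE ffunE cl_mul_fun partial_sum; last first.
  by move=> B; exact: diff_term.
rewrite !cl_mulrE -big_split/=; apply: eq_bigr => B _.
rewrite (partialM _ (differentiable_cst _ _)); last first.
  by apply: differentiableM; [exact: dg|exact: dh].
rewrite partial_cst mul0r addr0 (partialM _ (dg B) (dh _)) !ffunE.
by rewrite mulrDr addrC !mulrA.
Qed.

Lemma cl_diffZ f g x : differentiable f x -> cl_diff g x -> cl_diff (fun y => f y *: g y) x.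
Proof.
move=> df dg A; rewrite (_ : (fun y => _) = fun y => f y * g y A).
  by apply: differentiableM => //; exact: dg.
by apply/funext => y; rewrite cl_scaleE.
Qed.

Lemma cl_partialZ f g i x : differentiable f x -> cl_diff g x ->
  cl_partial i (fun y => f y *: g y) x = partial i f x *: g x + f x *: cl_partial i g x.
Proof.
move=> df dg; apply/ffunP => A; rewrite cl_addE !cl_scaleE !ffunE.
rewrite (_ : (fun y => _) = fun y => f y * g y A).
  by rewrite (partialM _ df (dg A)) addrC.
by apply/funext => y; rewrite cl_scaleE.
Qed.

Let cl_vec_fun A : (fun y : 'rV[R]_n => (cl_vec y : Cl) A) =
  fun y => \sum_j (A == [set j]%SET)%:R * y ord0 j.
Proof. by apply/funext => y; rewrite cl_vecE; apply: eq_bigr => j _; rewrite mulrC. Qed.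

Lemma cl_diff_comp_vec (M : 'rV[R]_n -> 'rV[R]_n) x :
  (forall j, differentiable (fun y => M y ord0 j) x) -> cl_diff (fun y => cl_vec (M y)) x.
Proof.
move=> dM A; rewrite (_ : (fun y => _) = fun y =>
    \sum_j (A == [set j]%SET)%:R * M y ord0 j).
  apply: differentiable_bigsum => j; apply: differentiableM; last exact: dM.
  exact: differentiable_cst.
by apply/funext => y; have := congr1 (@^~ (M y)) (cl_vec_fun A).
Qed.

Lemma cl_partial_comp_vec (M : 'rV[R]_n -> 'rV[R]_n) i x :
  (forall j, differentiable (fun y => M y ord0 j) x) ->
  cl_partial i (fun y => cl_vec (M y)) x =
  \sum_j partial i (fun y => M y ord0 j) x *: cl_e j.
Proof.
move=> dM; apply/ffunP => A; rewrite ffunE (_ : (fun y => _) = fun y =>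
    \sum_j (A == [set j]%SET)%:R * M y ord0 j); last first.
  by apply/funext => y; have := congr1 (@^~ (M y)) (cl_vec_fun A).
rewrite partial_sum => [|j]; last first.
  by apply: differentiableM; [exact: differentiable_cst|exact: dM].
rewrite cl_sumE; apply: eq_bigr => j _.
rewrite (partialM _ (differentiable_cst _ _) (dM j)) partial_cst mul0r addr0.
by rewrite cl_scaleE ffunE mulrC.
Qed.

Lemma cl_diff_vec x : cl_diff (@cl_vec R n) x.
Proof. by apply: (@cl_diff_comp_vec id) => j; exact: differentiable_coord. Qed.

Lemma cl_partial_vec i x : cl_partial i (@cl_vec R n) x = cl_e i.
Proof.
rewrite (@cl_partial_comp_vec id) => [|j]; last exact: differentiable_coord.
rewrite (bigD1 i)//= big1 => [|j ji]; rewrite partial_coord ?eqxx ?scale1r ?addr0//.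
by rewrite eq_sym (negbTE ji) scale0r.
Qed.

Let cl_rev_fun g A : (fun y => cl_rev (g y) A) =
  fun y => (-1) ^+ #|A| * cl_sign A A * g y A.
Proof. by apply/funext => y; rewrite cl_revE mulrA. Qed.

Lemma cl_diff_rev g x : cl_diff g x -> cl_diff (fun y => cl_rev (g y)) x.
Proof.
move=> dg A; rewrite cl_rev_fun; apply: differentiableM; last exact: dg.
exact: differentiable_cst.
Qed.

Lemma cl_partial_rev g i x : cl_diff g x ->
  cl_partial i (fun y => cl_rev (g y)) x = cl_rev (cl_partial i g x).
Proof.
move=> dg; apply/ffunP => A; rewrite cl_revE !ffunE cl_rev_fun.
rewrite (partialM _ (differentiable_cst _ _) (dg A)) partial_cst mul0r addr0.
by rewrite mulrA.
Qed.

Lemma cl_partial_comp g (M : 'rV[R]_n -> 'rV[R]_n) i x : cl_diff g (M x) ->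
  (forall j, differentiable (fun y => M y ord0 j) x) ->
  cl_partial i (fun y => g (M y)) x =
  \sum_j partial i (fun y => M y ord0 j) x *: cl_partial j g (M x).
Proof.
move=> dg dM; apply/ffunP => A; rewrite ffunE cl_sumE.
rewrite (partial_comp _ (dg A) dM); apply: eq_bigr => j _.
by rewrite cl_scaleE ffunE mulrC.
Qed.

Lemma cl_diff_comp g (M : 'rV[R]_n -> 'rV[R]_n) x : cl_diff g (M x) ->
  (forall j, differentiable (fun y => M y ord0 j) x) -> cl_diff (fun y => g (M y)) x.
Proof.
move=> dg dM A; apply: (@differentiable_comp _ _ _ _ M (fun z => g z A)); last exact: dg.
exact: differentiable_row.
Qed.

Lemma eq_on_cl_partial U g h i x : open U -> (forall y, U y -> g y = h y) -> U x ->
  cl_partial i g x = cl_partial i h x.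
Proof.
move=> oU gh Ux; apply/ffunP => A; rewrite !ffunE; apply: eq_on_partial oU _ Ux.
by move=> y Uy; rewrite gh.
Qed.

Lemma dirac_opE g x : dirac_op g x = \sum_i cl_e i * cl_partial i g x.
Proof. by []. Qed.

Lemma eq_on_dirac_op U g h x : open U -> (forall y, U y -> g y = h y) -> U x ->
  dirac_op g x = dirac_op h x.
Proof.
by move=> oU gh Ux; apply: eq_bigr => i _; congr (_ * _); exact: eq_on_cl_partial gh Ux.
Qed.

Lemma cl_smooth_eq U g h : open U -> (forall x, U x -> g x = h x) ->
  cl_smooth U g -> cl_smooth U h.
Proof. by move=> oU gh sg A; apply: smooth_on_eq oU _ (sg A) => x Ux; rewrite gh. Qed.

Lemma cl_smooth_cst U (a : Cl) : open U -> cl_smooth U (fun=> a).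
Proof. by move=> oU A; exact: smooth_on_cst. Qed.

Lemma cl_smoothD U g h : open U -> cl_smooth U g -> cl_smooth U h ->
  cl_smooth U (fun x => g x + h x).
Proof.
move=> oU sg sh A; rewrite (_ : (fun y => _) = fun y => g y A + h y A).
  exact: smooth_onD.
by apply/funext => y; rewrite cl_addE.
Qed.

Lemma cl_smoothM U g h : open U -> cl_smooth U g -> cl_smooth U h ->
  cl_smooth U (fun x => g x * h x).
Proof.
move=> oU sg sh A; rewrite cl_mul_fun; apply: smooth_on_sum => // B.
apply: smooth_onM => //; first exact: smooth_on_cst.
exact: smooth_onM.
Qed.

Lemma cl_smoothZ U f g : open U -> smooth_on U f -> cl_smooth U g ->
  cl_smooth U (fun x => f x *: g x).
Proof.
move=> oU sf sg A; rewrite (_ : (fun y => _) = fun y => f y * g y A).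
  exact: smooth_onM.
by apply/funext => y; rewrite cl_scaleE.
Qed.

Lemma cl_smooth_vec U : open U -> cl_smooth U (@cl_vec R n).
Proof.
move=> oU A; rewrite cl_vec_fun; apply: smooth_on_sum => // j.
by apply: smooth_onM => //; [exact: smooth_on_cst|exact: smooth_on_coord].
Qed.

Lemma cl_smooth_rev U g : open U -> cl_smooth U g -> cl_smooth U (fun x => cl_rev (g x)).
Proof.
move=> oU sg A; rewrite cl_rev_fun; apply: smooth_onM => //.
exact: smooth_on_cst.
Qed.

Lemma cl_smooth_conj U g : open U -> cl_smooth U g -> cl_smooth U (fun x => cl_conj (g x)).
Proof.
move=> oU sg A; rewrite (_ : (fun y => _) = fun y => cl_sign A A * g y A).
  by apply: smooth_onM => //; exact: smooth_on_cst.
by apply/funext => y; rewrite cl_conjE.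
Qed.

Lemma cl_smooth_comp U W g (M : 'rV[R]_n -> 'rV[R]_n) : open U -> cl_smooth W g ->
  (forall x, U x -> W (M x)) -> (forall j, smooth_on U (fun x => M x ord0 j)) ->
  cl_smooth U (fun x => g (M x)).
Proof.
by move=> oU sg UW sM A; apply: (smooth_on_comp (f := fun z => g z A) oU (sg A) UW sM).
Qed.

Lemma smooth_on_norm_sqr U g : open U -> cl_smooth U g ->
  smooth_on U (fun x => cl_norm (g x) ^+ 2).
Proof.
move=> oU sg; rewrite (_ : (fun x => _) = fun x => \sum_A g x A * g x A).
  by apply: smooth_on_sum => // A; exact: smooth_onM.
by apply/funext => x; rewrite cl_norm_sqr; apply: eq_bigr => A _; rewrite expr2.
Qed.

(** The squared norm is polynomial in the coefficients, hence smooth everywhere, unlike the norm. *)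
Lemma cl_norm_powR (y : Cl) (a : R) : cl_norm y `^ a = (cl_norm y ^+ 2) `^ (a / 2).
Proof.
rewrite -powR_mulrn ?cl_norm_ge0// -powRrM; congr (_ `^ _).
by rewrite mulrCA divff ?mulr1// pnatr_eq0.
Qed.

Lemma smooth_on_norm_powR U g (a : R) : open U -> cl_smooth U g ->
  (forall x, U x -> g x != 0) -> smooth_on U (fun x => cl_norm (g x) `^ a).
Proof.
move=> oU sg g0; under eq_fun do rewrite cl_norm_powR.
apply: (smooth_on_powR (f := fun x => cl_norm (g x) ^+ 2)) => //.
  exact: smooth_on_norm_sqr.
by move=> x Ux; rewrite exprn_gt0// cl_norm_gt0 g0.
Qed.

End CliffordCalculus.

(** * Conformal covariance of the Dirac operator *)

Section CliffordInner.
Context {R : realType} {n : nat}.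
Local Notation Cl := (clifford R n).
Implicit Types (x y q : Cl).

Definition cl_inner x y : R := \sum_A x A * y A.

Lemma cl_inner_conjl x y : cl_inner x y = (cl_conj x * y) finset.set0.
Proof.
rewrite cl_mulrE; apply: eq_bigr => A _.
by rewrite cl_symdiff0 cl_conjE mulrA cl_sign_sqr mul1r.
Qed.

Lemma cl_inner_conjr x y : cl_inner x y = (x * cl_conj y) finset.set0.
Proof.
rewrite cl_mulrE; apply: eq_bigr => A _.
by rewrite cl_symdiff0 cl_conjE mulrCA !mulrA cl_sign_sqr mul1r.
Qed.

Lemma cl_inner_mull q x y : cl_inner (q * x) y = cl_inner x (cl_conj q * y).
Proof. by rewrite !cl_inner_conjl cl_conjM mulrA. Qed.

Lemma cl_inner_mulr q x y : cl_inner (x * q) y = cl_inner x (y * cl_conj q).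
Proof. by rewrite !cl_inner_conjr cl_conjM cl_conjK mulrA. Qed.

Lemma cl_innerC x y : cl_inner x y = cl_inner y x.
Proof. by apply: eq_bigr => A _; rewrite mulrC. Qed.

Lemma cl_inner_e x i : cl_inner x (cl_e i) = x [set i]%SET.
Proof.
rewrite /cl_inner (bigD1 [set i]%SET)//= big1 => [|A Ai].
  by rewrite ffunE eqxx mulr1 addr0.
by rewrite ffunE (negbTE Ai) mulr0.
Qed.

Lemma is_vector_sum x : is_vector x -> x = \sum_i cl_inner x (cl_e i) *: cl_e i.
Proof.
move=> [v ->]; rewrite {1}/cl_vec; apply: eq_bigr => i _; rewrite cl_inner_e.
by have := congr1 (fun w : 'rV[R]_n => w ord0 i) (cl_vecK v); rewrite mxE => ->.
Qed.

Lemma cl_vec_delta i : cl_vec (delta_mx ord0 i) = cl_e i :> Cl.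
Proof.
rewrite /cl_vec (bigD1 i)//= big1 => [|j ji]; first by rewrite mxE !eqxx scale1r addr0.
by rewrite mxE (negbTE ji) andbF scale0r.
Qed.

Lemma is_vector_e i : is_vector (cl_e i : Cl).
Proof. by rewrite -cl_vec_delta; exact: is_vector_vec. Qed.

(* The adjoint of the similarity [h |-> q h q~] is [h |-> q~ h q]; the signs relating
   reversion and conjugation cancel. *)
Lemma vp_sandwich_adjoint q x y : is_vector_product q ->
  cl_inner (q * x * cl_rev q) y = cl_inner x (cl_rev q * y * q).
Proof.
move=> vpq; have [e e1 qe] := vp_rev_conj vpq.
have ee : e * e = 1 by rewrite -expr2.
have cqE : cl_conj q = e *: cl_rev q by rewrite qe scalerA ee scale1r.
have crE : cl_conj (cl_rev q) = e *: q by rewrite qe linearZ/= cl_conjK.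
rewrite cl_inner_mulr cl_inner_mull cqE crE -!scalerAr -!scalerAl scalerA ee scale1r.
by rewrite mulrA.
Qed.

Lemma vp_mul_rev q : is_vector_product q ->
  exists2 e : R, e ^+ 2 = 1 & q * cl_rev q = (e * cl_norm q ^+ 2)%:A.
Proof.
move=> vpq; have [e e1 ->] := vp_rev_conj vpq; exists e => //.
by have [_ qq] := vp_conj_mul vpq; rewrite -scalerAr qq scalerA.
Qed.

End CliffordInner.

Section MoebiusCalculus.
Context {R : realType} {n : nat}.
Local Notation Cl := (clifford R n).
Local Notation vp := (@is_vector_product R n).
Implicit Types (x y : 'rV[R]_n).
Variables (a b c d : Cl).
Hypothesis Mabcd : moebius_coeffs a b c d.

Local Notation p x := (a * cl_vec x + b).
Local Notation q x := (c * cl_vec x + d).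
Local Notation M := (moebius a b c d).
Local Notation W := [set x | q x != 0].

Lemma cl_diff_moebius_den x : cl_diff (fun y => q y) x.
Proof.
apply: cl_diffD; last exact: cl_diff_cst.
by apply: cl_diffM; [exact: cl_diff_cst|exact: cl_diff_vec].
Qed.

Lemma cl_partial_moebius_den i x : cl_partial i (fun y => q y) x = c * cl_e i.
Proof.
rewrite cl_partialD; last exact: cl_diff_cst; last first.
  by apply: cl_diffM; [exact: cl_diff_cst|exact: cl_diff_vec].
rewrite (cl_partialM _ (cl_diff_cst _ _) (cl_diff_vec _)) !cl_partial_cst mul0r.
by rewrite add0r addr0 cl_partial_vec.
Qed.

Lemma cl_smooth_moebius_den U : open U -> cl_smooth U (fun y => q y).
Proof.
move=> oU; apply: cl_smoothD => //; last exact: cl_smooth_cst.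
by apply: cl_smoothM => //; [exact: cl_smooth_cst|exact: cl_smooth_vec].
Qed.

Lemma moebius_den_continuous : continuous (fun x => cl_norm (q x) ^+ 2).
Proof.
move=> x; apply: differentiable_continuous; apply: (@smooth_on_differentiable _ _ setT) => //.
by apply: smooth_on_norm_sqr; [exact: openT|exact/cl_smooth_moebius_den/openT].
Qed.

Lemma open_moebius_dom : open W.
Proof.
have -> : W = (fun x => cl_norm (q x) ^+ 2) @^-1` [set t | 0 < t].
  by apply/seteqP; split => x /=; rewrite lt_def sqr_ge0 andbT sqrf_eq0 cl_norm_eq0.
by apply: open_comp => [x _|]; [exact: moebius_den_continuous|exact: open_gt].
Qed.

Let cl_smooth_num : cl_smooth W (fun x => p x).
Proof.
have oW := open_moebius_dom; apply: cl_smoothD => //; last exact: cl_smooth_cst.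
by apply: cl_smoothM => //; [exact: cl_smooth_cst|exact: cl_smooth_vec].
Qed.

Lemma cl_smooth_moebius_den_inv : cl_smooth W (fun x => (q x)^-1).
Proof.
have oW := open_moebius_dom.
apply: (@cl_smooth_eq _ _ _ (fun x => cl_norm (q x) `^ (- 2%:R) *: cl_conj (q x))) => //.
  move=> x /= qx; rewrite vp_inv//; last exact: (moebius_den_vp Mabcd).
  by rewrite powRN powR_mulrn// cl_norm_ge0.
apply: cl_smoothZ => //.
  apply: smooth_on_norm_powR => //; exact: cl_smooth_moebius_den.
by apply: cl_smooth_conj => //; exact: cl_smooth_moebius_den.
Qed.

Lemma smooth_on_moebius j : smooth_on W (fun x => M x ord0 j).
Proof.
rewrite (_ : (fun x => _) = fun x => (p x * (q x)^-1) [set j]%SET).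
  apply: (@cl_smoothM _ _ _ (fun x => p x)); [exact: open_moebius_dom|exact: cl_smooth_num|].
  exact: cl_smooth_moebius_den_inv.
by apply/funext => x; rewrite /moebius mxE.
Qed.

Lemma moebius_differentiable x j : q x != 0 -> differentiable (fun y => M y ord0 j) x.
Proof. by move=> qx; exact: smooth_on_differentiable (smooth_on_moebius j) qx. Qed.

Lemma moebius_continuous x : q x != 0 -> {for x, continuous M}.
Proof.
move=> qx; apply: differentiable_continuous; apply: differentiable_row => j.
exact: moebius_differentiable.
Qed.

(* Differentiate [moebius_subE] with respect to its first variable. *)
Lemma cl_partial_moebius i x : q x != 0 ->
  cl_partial i (fun y => cl_vec (M y)) x = cl_rev (q x)^-1 * cl_e i * (q x)^-1.
Proof.
move=> qx; have dM j := moebius_differentiable j qx.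
have dvM := cl_diff_comp_vec dM; set w := - cl_vec (M x).
have dvMw : cl_diff (fun y => cl_vec (M y) + w) x by apply: cl_diffD => //; exact: cl_diff_cst.
have dl : cl_diff (fun y => cl_rev (q x) * (cl_vec (M y) + w)) x.
  by apply: cl_diffM => //; exact: cl_diff_cst.
have E : cl_partial i (fun y => cl_rev (q x) * (cl_vec (M y) + w) * q y) x =
    cl_partial i (fun y => cl_vec y + cl_vec (- x)) x.
  apply: (eq_on_cl_partial _ open_moebius_dom _ qx) => y qy.
  by rewrite -linearD/= /w (moebius_subE Mabcd).
move: E; rewrite cl_partialM//; last exact: cl_diff_moebius_den.
rewrite (cl_partialM _ (cl_diff_cst _ _) dvMw) (cl_partialD _ dvM (cl_diff_cst _ _)).
(* The term in which the factor [q y] is differentiated carries the difference of [cl_vec (M x)]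
   with itself and drops out. *)
rewrite !cl_partial_cst mul0r add0r addr0 subrr mulr0 mul0r addr0.
rewrite (cl_partialD _ (@cl_diff_vec _ _ x) (cl_diff_cst _ _)).
rewrite cl_partial_cst addr0 cl_partial_vec => <-.
have vpq := moebius_den_vp Mabcd x; have uq := vp_unit vpq qx.
have urq : cl_rev (q x) \is a GRing.unit by rewrite vp_unit ?cl_rev_eq0//; exact: vp_rev.
by rewrite cl_rev_inv// -!mulrA mulrV// mulr1 mulKr.
Qed.

(** The transpose of the differential applied to e_j. With q^-1 = k q~ the differential is h |-> k^2
    q h q~, whose adjoint is h |-> k^2 q~ h q, and k^2 = |q|^-4. *)
Lemma partial_moebius_sum j x : q x != 0 ->
  \sum_i partial i (fun y => M y ord0 j) x *: cl_e i =
  (cl_norm (q x) ^- 4) *: (cl_rev (q x) * cl_e j * q x).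
Proof.
move=> qx; have vpq := moebius_den_vp Mabcd x.
have [k qk] := vp_inv_rev vpq qx.
have k2 : k * k = cl_norm (q x) ^- 4.
  have := congr1 (fun z => cl_norm z ^+ 2) qk.
  rewrite vp_norm_inv// cl_normZ cl_norm_rev exprMn real_normK ?num_real// => kE.
  have n0 := cl_norm_neq0 qx.
  by rewrite -expr2; apply: (mulIf (expf_neq0 2 n0)); rewrite -kE; field.
have partE i : partial i (fun y => M y ord0 j) x =
    k * k * cl_inner (cl_rev (q x) * cl_e j * q x) (cl_e i).
  have dM l := moebius_differentiable l qx.
  have -> : partial i (fun y => M y ord0 j) x =
      cl_inner (cl_partial i (fun y => cl_vec (M y)) x) (cl_e j).
    rewrite cl_inner_e (cl_partial_comp_vec _ dM) cl_sumE (bigD1 j)//= big1 => [|l lj].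
      by rewrite cl_scaleE ffunE eqxx mulr1 addr0.
    by rewrite cl_scaleE ffunE (inj_eq set1_inj) eq_sym (negbTE lj) mulr0.
  rewrite cl_partial_moebius// qk linearZ/= cl_revK -scalerAl -scalerAl -scalerAr scalerA.
  rewrite [in RHS]cl_innerC -vp_sandwich_adjoint// /cl_inner mulr_sumr.
  by apply: eq_bigr => A _; rewrite cl_scaleE mulrA.
rewrite -k2 [in RHS](@is_vector_sum _ _ (cl_rev (q x) * cl_e j * q x)); last first.
  have := vp_sandwich (vp_rev vpq) (is_vector_e j).
  by rewrite cl_revK.
by rewrite scaler_sumr; apply: eq_bigr => i _; rewrite partE scalerA.
Qed.

(* Up to a translation and a factor on the right, this is the Cauchy kernel x / |x|^n. *)
Lemma kelvin_monogenic x : q x != 0 ->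
  \sum_i cl_e i * cl_partial i
    (fun y => cl_norm (q y) `^ (- n%:R) *: cl_rev (q y)) x = 0.
Proof.
move=> qx; have [c0|c0] := eqVneq c 0.
  apply: big1 => i _; rewrite (_ : (fun y => _) = fun=> cl_norm d `^ (- n%:R) *: cl_rev d).
    by rewrite cl_partial_cst mulr0.
  by apply/funext => y; rewrite c0 mul0r add0r.
have [w dw] := moebius_den_factor Mabcd c0.
have vpc : vp c by case: Mabcd => -[].
have qE y : q y = c * cl_vec (y + w) by rewrite {1}dw linearD mulrDr.
pose Q y := cl_norm c ^+ 2 * dot (y + w) (y + w).
have QE y : cl_norm (q y) ^+ 2 = Q y by rewrite qE vp_norm_mull// exprMn cl_norm_vec.
have Qx0 : 0 < Q x by rewrite -QE exprn_gt0// cl_norm_gt0.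
have rE : (fun y => cl_norm (q y) `^ (- n%:R)) = fun y => Q y `^ (- n%:R / 2).
  by apply/funext => y; rewrite cl_norm_powR QE.
have dcoord j y : differentiable (fun y : 'rV[R]_n => y ord0 j + w ord0 j) y.
  by apply: differentiableD; [exact: differentiable_coord|exact: differentiable_cst].
have dotE : (fun y => dot (y + w) (y + w)) =
    fun y => \sum_j (y ord0 j + w ord0 j) * (y ord0 j + w ord0 j).
  by apply/funext => y; apply: eq_bigr => j _; rewrite !mxE.
have ddot y : differentiable (fun y => dot (y + w) (y + w)) y.
  by rewrite dotE; apply: differentiable_bigsum => j; apply: differentiableM.
have dQ y : differentiable Q y by apply: differentiableM => //; exact: differentiable_cst.
have pQ i : partial i Q x = cl_norm c ^+ 2 * (2 * (x + w) ord0 i).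
  rewrite (partialM _ (differentiable_cst _ _) (ddot x)) partial_cst mul0r addr0.
  congr (_ * _); rewrite dotE partial_sum => [|j]; last exact: differentiableM.
  have pc j : partial i (fun y : 'rV[R]_n => y ord0 j + w ord0 j) x = (i == j)%:R.
    rewrite partialD; [|exact: differentiable_coord|exact: differentiable_cst].
    by rewrite partial_cst addr0 partial_coord.
  rewrite (bigD1 i)//= big1 => [|j ji].
    by rewrite partialM// pc eqxx mulr1 mul1r addr0 mxE -mulr2n mulr_natl.
  by rewrite partialM// pc eq_sym (negbTE ji) mulr0 mul0r addr0.
have pr i : partial i (fun y => cl_norm (q y) `^ (- n%:R)) x =
    - n%:R * Q x `^ (- n%:R / 2 - 1) * cl_norm c ^+ 2 * (x + w) ord0 i.
  rewrite rE partial_powR// pQ; set s := Q x `^ _.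
  by field.
have dr : differentiable (fun y => cl_norm (q y) `^ (- n%:R)) x.
  by rewrite rE; exact: powR_differentiable.
have dqr := cl_diff_rev (cl_diff_moebius_den x).
under eq_bigr do rewrite (cl_partialZ _ dr dqr) (cl_partial_rev _ (cl_diff_moebius_den x))
  cl_partial_moebius_den cl_revM (is_vector_rev (is_vector_e _)) mulrDr.
rewrite big_split/=.
(* Differentiating the power of the norm gives n |q|^(-n) c~, because (x + w)^2 = -|x + w|^2;
   differentiating q~ gives the opposite, because the n squares e_i^2 sum to -n. *)
have s1 : \sum_i cl_e i * (partial i (fun y => cl_norm (q y) `^ (- n%:R)) x *: cl_rev (q x)) =
    (n%:R * Q x `^ (- n%:R / 2)) *: cl_rev c.
  pose k := - n%:R * Q x `^ (- n%:R / 2 - 1) * cl_norm c ^+ 2.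
  transitivity (k *: (cl_vec (x + w) * cl_rev (q x))).
    set rq := cl_rev (q x); rewrite /cl_vec mulr_suml scaler_sumr.
    apply: eq_bigr => i _; rewrite pr -scalerAr.
    by rewrite -[X in _ = _ *: X]scalerAl scalerA.
  rewrite qE cl_revM cl_rev_vec mulrA cl_vec_sqr -scalerAl mul1r scalerA.
  congr (_ *: _); rewrite /k -[X in _ = _ * X `^ _]/(Q x).
  have -> : Q x `^ (- n%:R / 2) = Q x `^ (- n%:R / 2 - 1) * Q x.
    rewrite -[X in _ = _ * X](powRr1 (ltW Qx0)) -powRD; last by rewrite (gt_eqF Qx0)/= ?implybT.
    by rewrite subrK.
  by move: (Q x `^ _) => s; rewrite /Q; ring.
have s2 : \sum_i cl_e i * (cl_norm (q x) `^ (- n%:R) *: (cl_e i * cl_rev c)) =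
    (- (n%:R * Q x `^ (- n%:R / 2))) *: cl_rev c.
  under eq_bigr do rewrite -scalerAr mulrA cl_e_sqr mulN1r scalerN -scaleNr.
  rewrite sumr_const card_ord -scaler_nat scalerA cl_norm_powR QE mulrN.
  by [].
by rewrite [X in X + _]s1 [X in _ + X]s2 -scalerDl subrr scale0r.
Qed.

Lemma dirac_moebius (xi : 'rV[R]_n -> Cl) x : q x != 0 -> cl_diff xi (M x) ->
  q x * dirac_op (fun y => cl_norm (q y) `^ (- n%:R) *: cl_rev (q y) * xi (M y)) x =
  cl_norm (q x) `^ (- n%:R) *: dirac_op xi (M x).
Proof.
move=> qx dxi; set r := cl_norm (q x) `^ (- n%:R).
have dM j := moebius_differentiable j qx.
have dxiM : cl_diff (fun y => xi (M y)) x by exact: cl_diff_comp.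
have dr : differentiable (fun y => cl_norm (q y) `^ (- n%:R)) x.
  apply: (@smooth_on_differentiable _ _ W) => //; apply: smooth_on_norm_powR => //.
    exact: open_moebius_dom.
  exact/cl_smooth_moebius_den/open_moebius_dom.
have drq : cl_diff (fun y => cl_norm (q y) `^ (- n%:R) *: cl_rev (q y)) x.
  by apply: cl_diffZ => //; apply: cl_diff_rev; exact: cl_diff_moebius_den.
rewrite dirac_opE; under eq_bigr do rewrite (cl_partialM _ drq dxiM) mulrDr mulrA.
rewrite big_split/= -mulr_suml kelvin_monogenic// mul0r add0r.
have -> : \sum_i cl_e i * (r *: cl_rev (q x) * cl_partial i (fun y => xi (M y)) x) =
    r *: \sum_j (cl_norm (q x) ^- 4 *: (cl_rev (q x) * cl_e j * q x)) * cl_rev (q x) *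
      cl_partial j xi (M x).
  under eq_bigr do rewrite (cl_partial_comp _ dxi dM) mulr_sumr mulr_sumr.
  rewrite exchange_big/= [RHS]scaler_sumr; apply: eq_bigr => j _.
  rewrite -partial_moebius_sum// !mulr_suml [RHS]scaler_sumr.
  by apply: eq_bigr => i _; rewrite -!(scalerAl, scalerAr) !mulrA.
rewrite -scalerAr; congr (_ *: _); rewrite mulr_sumr dirac_opE; apply: eq_bigr => j _.
have vpq := moebius_den_vp Mabcd x.
(* The scalar q q~ = e |q|^2 occurs twice: its sign squares to 1 and its modulus cancels |q|^-4. *)
have [e e1 qq] := vp_mul_rev vpq.
rewrite -!scalerAl -scalerAr !mulrA qq -!mulrA (mulrA (q x)) qq -!scalerAl !mul1r.
rewrite -[cl_e j * (_ *: _)]scalerAr !scalerA -[RHS]scale1r; congr (_ *: _).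
by rewrite -e1; field; exact: cl_norm_neq0.
Qed.

End MoebiusCalculus.

(** * Jacobian of a Möbius transformation *)

Lemma vp_norm_mul_invl (R : realType) n (q w : clifford R n) :
  is_vector_product q -> q != 0 -> cl_norm (q^-1 * w) = (cl_norm q)^-1 * cl_norm w.
Proof.
move=> vpq q0; apply: (mulfI (cl_norm_neq0 q0)).
by rewrite -vp_norm_mull// mulVKr ?vp_unit// mulVKf ?cl_norm_neq0.
Qed.

Lemma bernoulli_small (R : realFieldType) n (e : R) : 0 < e ->
  exists2 t, 0 < t & (1 + t) ^+ n <= 1 + e.
Proof.
elim: n e => [|n IH] e e0.
  by exists 1; rewrite // expr0 lerDl ltW.
(* From e' <= 1/3 and 3 e' <= e one gets (1 + e')^2 = 1 + e' (2 + e') <= 1 + e. *)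
pose e' := Num.min e 1 / 3.
have m0 : 0 < Num.min e 1 by rewrite lt_min e0 ltr01.
have [me m1] : Num.min e 1 <= e /\ Num.min e 1 <= 1 by rewrite !ge_min !lexx orbT.
have e'0 : 0 < e' by rewrite divr_gt0.
have [t t0 tn] := IH _ e'0; pose s := Num.min t e'.
have s0 : 0 < s by rewrite lt_min t0.
have [st se] : s <= t /\ s <= e' by rewrite !ge_min !lexx orbT.
exists s => //; rewrite exprS.
apply: (@le_trans _ _ ((1 + e') * (1 + e'))).
  apply: ler_pM; rewrite ?exprn_ge0 ?addr_ge0 ?(ltW s0)// ?lerD2l//.
  by apply: le_trans tn; rewrite lerXn2r ?nnegrE ?addr_ge0 ?(ltW s0) ?(ltW t0)// lerD2l.
have : e' <= 1 / 3 /\ 3 * e' <= e by rewrite /e'; split; lra.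
by move=> [e'1 e'e]; nra.
Qed.

Lemma ler_cl_coord_norm (R : realType) n (z : clifford R n) A : `|z A| <= cl_norm z.
Proof.
rewrite -sqrtr_sqr ler_sqrt ?sumr_ge0// => [|B _]; last exact: sqr_ge0.
by rewrite (bigD1 A)//= lerDl sumr_ge0// => B _; exact: sqr_ge0.
Qed.

Lemma cl_vec_coord (R : realType) n (v : 'rV[R]_n) i : cl_vec v [set i]%SET = v ord0 i.
Proof. by rewrite -[in RHS](cl_vecK v) mxE. Qed.

(* With [ux] and [uy] close to 1, the right-hand side of the first hypothesis
   is close to [cl_vec (x - y)]. *)
Lemma sandwich_coord_le (R : realType) n (x y rx ry : 'rV[R]_n)
    (ux uy : clifford R n) (t r : R) i :
  cl_vec (rx - ry) = cl_rev uy * cl_vec (x - y) * ux ->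
  (forall w, cl_norm (cl_rev uy * w) = cl_norm uy * cl_norm w) ->
  0 <= r -> 0 <= t -> cl_norm uy <= 2 ->
  cl_norm (ux - 1) <= t -> cl_norm (uy - 1) <= t ->
  (forall j, `|x ord0 j - y ord0 j| <= r) ->
  `|rx ord0 i - ry ord0 i| <= (1 + 3 * n%:R * t) * r.
Proof.
move=> rE uyM r0 t0 uy2 uxt uyt xyr; set v := cl_vec (x - y) in rE.
have vn : cl_norm v <= n%:R * r.
  by rewrite -enormE; apply: ler_enorm_coord => // j; rewrite !mxE.
(* Telescope uy~ v ux - v as uy~ v (ux - 1) + (uy - 1)~ v. With |uy| <= 2 and |v| <= n r the two
   terms cost 2 n r t and n r t, whence the constant 3 n. *)
have E : rx ord0 i - ry ord0 i = (x ord0 i - y ord0 i) +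
    ((cl_rev uy * v * (ux - 1)) [set i]%SET + (cl_rev (uy - 1) * v) [set i]%SET).
  have -> : rx ord0 i - ry ord0 i = (rx - ry) ord0 i by rewrite !mxE.
  have -> : x ord0 i - y ord0 i = (x - y) ord0 i by rewrite !mxE.
  rewrite -!cl_vec_coord rE -/v -!cl_addE; congr ((_ : clifford R n) _).
  rewrite raddfB/= cl_rev1 mulrBr mulr1 mulrBl mul1r.
  by rewrite subrKA addrC subrK.
have n1 : cl_norm (cl_rev uy * v * (ux - 1)) <= 2 * (n%:R * r) * t.
  rewrite -mulrA uyM vp_norm_mull; last exact: vp_vec.
  by rewrite -mulrA; do 2![apply: ler_pM; rewrite ?mulr_ge0 ?cl_norm_ge0//].
have n2 : cl_norm (cl_rev (uy - 1) * v) <= t * (n%:R * r).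
  rewrite vp_norm_mulr ?cl_norm_rev; last exact: vp_vec.
  by apply: ler_pM => //; rewrite ?cl_norm_ge0.
rewrite E (le_trans (ler_normD _ _))// mulrDl mul1r; apply: lerD; first exact: xyr.
rewrite (le_trans (ler_normD _ _))//.
apply: (@le_trans _ _ (2 * (n%:R * r) * t + t * (n%:R * r))).
  by apply: lerD; [apply: le_trans n1|apply: le_trans n2]; exact: ler_cl_coord_norm.
by rewrite le_eqVlt; apply/orP; left; apply/eqP; ring.
Qed.

Lemma cl_vec_sub_sandwich (R : realType) n (f h : 'rV[R]_n -> 'rV[R]_n) z w :
  (forall x, cl_vec (f x) = z * cl_vec (h x) * w) ->
  forall x y, cl_vec (f x - f y) = z * (cl_vec (h x) - cl_vec (h y)) * w.
Proof. by move=> E x y; rewrite linearB/= !E -mulrBl -mulrBr. Qed.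

Lemma sandwich_quotient (R : realType) n (q q1 q2 X z : clifford R n) :
  q1 \is a GRing.unit -> q2 \is a GRing.unit -> cl_rev q2 * X * q1 = z ->
  cl_rev q * X * q = cl_rev (q2^-1 * q) * z * (q1^-1 * q).
Proof.
move=> u1 u2 <-; rewrite cl_revM -!mulrA mulVKr//.
have h : cl_rev q2^-1 * cl_rev q2 = 1 by rewrite -cl_revM mulrV// cl_rev1.
by rewrite (mulrA (cl_rev q2^-1)) h mul1r.
Qed.

Section MoebiusJacobian.
Context {R : realType} {n : nat}.
Local Notation Cl := (clifford R n).
Implicit Types (x y : 'rV[R]_n).
Variables (a b c d : Cl).
Hypothesis Mabcd : moebius_coeffs a b c d.

Local Notation q x := (c * cl_vec x + d).
Local Notation M := (moebius a b c d).
Local Notation W := [set x | q x != 0].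
Local Notation lam := (lebesgue R n : set 'rV[R]_n -> \bar R).

Definition moebius_jac x : R := cl_norm (q x) `^ (- (2 * n)%:R).

Lemma moebius_jacE x : moebius_jac x = (cl_norm (q x) ^- 2) ^+ n.
Proof. by rewrite /moebius_jac powRN powR_mulrn ?cl_norm_ge0// exprM exprVn. Qed.

Lemma moebius_jac_gt0 x : q x != 0 -> 0 < moebius_jac x.
Proof. by move=> qx; rewrite powR_gt0// cl_norm_gt0. Qed.

Lemma smooth_on_moebius_jac : smooth_on W moebius_jac.
Proof.
have oW := @open_moebius_dom R n c d.
by apply: smooth_on_norm_powR => //; exact: cl_smooth_moebius_den.
Qed.

Lemma cl_unvecK (z : Cl) : is_vector z -> cl_vec (cl_unvec z) = z.
Proof. by move=> [v ->]; rewrite cl_vecK. Qed.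

Section LinearPart.
Variable x0 : 'rV[R]_n.
Hypothesis Wx0 : q x0 != 0.
Local Notation q0 := (q x0).

Let vpq x : is_vector_product (q x). Proof. exact: (moebius_den_vp Mabcd). Qed.
Let uq0 : q0 \is a GRing.unit. Proof. exact: vp_unit. Qed.

(* [dmoebius] is the differential of [M] at [x0], a similarity; [M] is its composite
   with [rectified], which is Lipschitz near [x0] with constant close to 1. *)
Definition dmoebius (h : 'rV[R]_n) : 'rV[R]_n :=
  cl_unvec (cl_rev q0^-1 * cl_vec h * q0^-1).

Definition rectified x : 'rV[R]_n := cl_unvec (cl_rev q0 * cl_vec (M x) * q0).

Lemma dmoebiusE h : cl_vec (dmoebius h) = cl_rev q0^-1 * cl_vec h * q0^-1.
Proof. by rewrite cl_unvecK//; apply: vp_sandwich_inv => //; exact: is_vector_vec. Qed.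

Lemma rectifiedE x : cl_vec (rectified x) = cl_rev q0 * cl_vec (M x) * q0.
Proof.
rewrite cl_unvecK//; have := vp_sandwich (vp_rev (vpq x0)) (is_vector_vec (M x)).
by rewrite cl_revK.
Qed.

Let rev_qV : cl_rev q0^-1 * cl_rev q0 = 1.
Proof. by rewrite -cl_revM mulrV// cl_rev1. Qed.

Lemma dmoebius_rectified x : dmoebius (rectified x) = M x.
Proof.
apply: cl_vec_inj; rewrite [LHS]dmoebiusE rectifiedE !mulrA rev_qV mul1r.
exact: mulrK uq0 _.
Qed.

Lemma dmoebius_is_linear : linear dmoebius.
Proof.
move=> k u v; apply: cl_vec_inj; rewrite linearP/= !dmoebiusE linearP/=.
by rewrite mulrDr mulrDl -scalerAr -scalerAl.
Qed.
HB.instance Definition _ :=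
  GRing.isLinear.Build R 'rV[R]_n 'rV[R]_n _ dmoebius dmoebius_is_linear.

Lemma enorm_dmoebius h : enorm (dmoebius h) = cl_norm q0 ^- 2 * enorm h.
Proof.
have hE : cl_vec h = cl_rev q0 * cl_vec (dmoebius h) * q0.
  rewrite dmoebiusE !mulrA -cl_revM mulVr// cl_rev1 mul1r -mulrA mulVr//.
  by rewrite mulr1.
rewrite !enormE [in RHS]hE vp_norm_mulr// vp_norm_mull; last exact: vp_rev.
by rewrite cl_norm_rev; field; exact: cl_norm_neq0.
Qed.

(** Both outer factors equal 1 at [x0], so [rectified] nearly preserves differences near it. *)
Lemma rectified_sub x y : q x != 0 -> q y != 0 ->
  cl_vec (rectified x - rectified y) =
  cl_rev ((q y)^-1 * q0) * cl_vec (x - y) * ((q x)^-1 * q0).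
Proof.
move=> qx qy; rewrite (cl_vec_sub_sandwich rectifiedE).
have := moebius_subE Mabcd qx qy.
exact: (sandwich_quotient q0 (vp_unit (vpq x) qx) (vp_unit (vpq y) qy)).
Qed.

Let moebius_image E : M @` E = dmoebius @` (rectified @` E).
Proof.
apply/seteqP; split => [_ [x Ex <-]|_ [_ [x Ex <-] <-]].
  by rewrite -dmoebius_rectified; exists (rectified x); [exists x|].
by rewrite dmoebius_rectified; exists x.
Qed.

Lemma moebius_dominated_at (e : R) : 0 < e -> exists2 r : R, 0 < r &
  exists2 K : R, 0 <= K & (forall x, ball x0 r x -> W x /\ K <= moebius_jac x) /\
    forall E, E `<=` ball x0 r -> (lam (M @` E) <= ((1 + e) * K)%:E * lam E)%E.
Proof.
move=> e0; have e20 : 0 < e / 2 by rewrite divr_gt0.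
have [L1 L10 L1n] := bernoulli_small n e20.
(* Chosen so that the constant 1 + 3 n t of [sandwich_coord_le] is at most 1 + L1; the added 1 keeps
   the denominator positive. *)
pose t := L1 / (3 * n%:R + 1).
have d0 : 0 < 3 * n%:R + 1 :> R by rewrite ltr_wpDl// mulr_ge0.
have t0 : 0 < t by rewrite divr_gt0.
have tL : 3 * n%:R * t <= L1.
  by rewrite /t mulrA ler_pdivrMr// mulrC ler_wpM2l ?(ltW L10)// lerDl.
(* Then (1 + e) K is exactly the Jacobian at [x0] times (1 + L1)^n. Since (1 + L1)^n <= 1 + e/2, [K]
   lies strictly below that Jacobian, and so below the Jacobian at nearby points. *)
pose K := moebius_jac x0 * (1 + L1) ^+ n / (1 + e).
have J0 := moebius_jac_gt0 Wx0.
have e1 : 0 < 1 + e by rewrite addr_gt0.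
have KJ : K < moebius_jac x0.
  rewrite /K ltr_pdivrMr// ltr_pM2l//; apply: (le_lt_trans L1n).
  by rewrite ltrD2l ltr_pdivrMr// ltr_pMr// ltrDl.
have K0 : 0 <= K.
  by rewrite divr_ge0 ?mulr_ge0 ?exprn_ge0 ?addr_ge0// ltW.
have q02 : 0 < cl_norm q0 ^- 2 by rewrite invr_gt0 exprn_gt0// cl_norm_gt0.
have L0 : 0 <= 1 + L1 by rewrite addr_ge0// ltW.
have KE : (1 + e) * K = (cl_norm q0 ^- 2) ^+ n * (1 + L1) ^+ n.
  rewrite /K moebius_jacE [LHS]mulrC divfK//; exact: lt0r_neq0.
have oW := @open_moebius_dom R n c d.
(* The closeness of [u] to 1 is expressed below by squared norms, which are smooth in [x]. *)
pose u x := (q x)^-1 * q0.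
have su : cl_smooth W u.
  apply: cl_smoothM => //; first exact: (cl_smooth_moebius_den_inv Mabcd).
  exact: cl_smooth_cst.
have near_lt (f : 'rV[R]_n -> R) z : smooth_on W f -> f x0 < z -> \forall x \near x0, f x < z.
  move=> sf fz; have cf : {for x0, continuous f}.
    by apply: differentiable_continuous; exact: smooth_on_differentiable sf Wx0.
  exact: cf _ (lt_nbhsl fz).
have nW : \forall x \near x0, W x by exact: open_nbhs_nbhs.
have nJ : \forall x \near x0, K < moebius_jac x.
  have cf : {for x0, continuous moebius_jac}.
    apply: differentiable_continuous.
    exact: smooth_on_differentiable smooth_on_moebius_jac Wx0.
  exact: cf _ (lt_nbhsr KJ).
have ux0 : u x0 = 1 by rewrite /u; exact: mulVr uq0.
have nu1 : \forall x \near x0, cl_norm (u x - 1) ^+ 2 < t ^+ 2.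
  apply: (near_lt (fun x => cl_norm (u x - 1) ^+ 2)); last first.
    by rewrite ux0 subrr cl_norm_sqr big1 ?exprn_gt0// => A _; rewrite ffunE expr0n.
  apply: smooth_on_norm_sqr => //; apply: cl_smoothD => //; exact: cl_smooth_cst.
have nu2 : \forall x \near x0, cl_norm (u x) ^+ 2 < 2 ^+ 2.
  apply: (near_lt (fun x => cl_norm (u x) ^+ 2)); last first.
    by rewrite ux0 cl_norm1 expr1n -natrX ltr1n.
  exact: smooth_on_norm_sqr.
have : \forall x \near x0, [/\ W x, K < moebius_jac x,
    cl_norm (u x - 1) ^+ 2 < t ^+ 2 & cl_norm (u x) ^+ 2 < 2 ^+ 2].
  by near=> x; split; near: x.
case/nbhs_ballP => r r0 rP; exists r; first exact: r0.
exists K; first exact: K0.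
split.
  by move=> x /rP[Wx /ltW KJx _ _].
move=> E Er; have EP x : E x -> [/\ W x, cl_norm (u x - 1) <= t & cl_norm (u x) <= 2].
  move=> /Er/rP[Wx _ /ltW u1 /ltW u2]; split => //.
    by move: u1; rewrite ler_pXn2r// nnegrE ?cl_norm_ge0// ltW.
  by move: u2; rewrite ler_pXn2r// nnegrE ?cl_norm_ge0.
rewrite moebius_image; apply: (le_trans (lebesgue_similarity q02 enorm_dmoebius _)).
rewrite KE EFinM -muleA; apply: lee_wpmul2l.
  by rewrite lee_fin exprn_ge0// ltW.
apply: lebesgue_lipschitz => // x y s s0 Ex Ey xys i.
have [Wx x1 x2] := EP _ Ex; have [Wy y1 y2] := EP _ Ey.
apply: le_trans (sandwich_coord_le i (rectified_sub Wx Wy) _ s0 (ltW t0) y2 x1 y1 xys) _.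
  move=> w; rewrite /u vp_norm_mul_invl//= cl_revM -mulrA vp_norm_mull; last exact: vp_rev.
  rewrite cl_rev_inv// vp_norm_mul_invl ?cl_rev_eq0//; last exact: vp_rev.
  by rewrite !cl_norm_rev; ring.
by apply: ler_wpM2r => //; rewrite lerD2l.
Unshelve. all: by end_near.
Qed.

End LinearPart.

Lemma moebius_locally_dominated : locally_dominated W M moebius_jac.
Proof. by move=> x0 Wx0 e e0; exact: moebius_dominated_at. Qed.

End MoebiusJacobian.

Lemma lmeasurable_continuous (R : realType) n (O : set 'rV[R]_n) (f : 'rV[R]_n -> R) :
  open O -> (forall x, O x -> {for x, continuous f}) ->
  measurable_fun (O : set (lebesgueT R n)) (f : _ -> measurableTypeR R).
Proof.
move=> oO cf; apply: (measurability _ (RGenOInfty.measurableE R)) => //.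
move=> _ [_ [r ->] <-]; apply: borel_lmeasurable; apply: open_measurable_row.
rewrite openE => x [Ox /= rx]; apply: filterI; first exact: open_nbhs_nbhs.
move: rx; rewrite in_itv/= andbT => rx.
have : \forall y \near x, r < f y by exact: cf x Ox _ (lt_nbhsr rx).
by apply: filterS => y /= ry; rewrite in_itv/= andbT.
Qed.

Lemma lmeasurable_moebius_jac (R : realType) n (c d : clifford R n) : measurable_fun
  ([set x | c * cl_vec x + d != 0] : set (lebesgueT R n)) (moebius_jac c d).
Proof.
apply: lmeasurable_continuous; first exact: open_moebius_dom.
move=> x Wx; apply: differentiable_continuous.
exact: smooth_on_differentiable (@smooth_on_moebius_jac R n c d) Wx.
Qed.

Section MoebiusChange.
Context {R : realType} {n : nat}.
Local Notation Cl := (clifford R n).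
Local Notation lmeasurable E := (measurable (E : set (lebesgueT R n))).
Variables (a b c d : Cl).
Hypothesis Mabcd : moebius_coeffs a b c d.
Hypothesis n_gt0 : (0 < n)%N.
Local Notation q x := (c * cl_vec x + d).
Local Notation M := (moebius a b c d).
Local Notation W := [set x | q x != 0].
Local Notation q' y := (- cl_rev c * cl_vec y + cl_rev a).
Local Notation M' := (moebius (cl_rev d) (- cl_rev b) (- cl_rev c) (cl_rev a)).
Local Notation W' := [set y | q' y != 0].
Local Notation J := (moebius_jac c d).

Let M'abcd := moebius_coeffs_inv Mabcd n_gt0.

Let MW x : W x -> W' (M x). Proof. exact: moebius_inv_den_neq0. Qed.
Let NW y : W' y -> W (M' y). Proof. exact: moebius_den_inv_neq0. Qed.
Let MK x : W x -> M' (M x) = x. Proof. exact: moebius_invK. Qed.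
Let NK y : W' y -> M (M' y) = y. Proof. exact: moebiusK. Qed.
Let oW : open W. Proof. exact: open_moebius_dom. Qed.
Let oW' : open W'. Proof. exact: open_moebius_dom. Qed.

Lemma moebius_change (k : 'rV[R]_n -> \bar R) :
  measurable_fun (W' : set (lebesgueT R n)) k -> (forall y, W' y -> 0 <= k y)%E ->
  (\int[lebesgue R n]_(x in W) (k (M x) * (J x)%:E) =
   \int[lebesgue R n]_(y in W') k y)%E.
Proof.
apply: (change_of_variables oW oW' MW NW MK NK
  (J' := moebius_jac (- cl_rev c) (cl_rev a))).
- by move=> x Wx; exact: moebius_continuous.
- by move=> x Wx; exact: (moebius_continuous M'abcd).
- exact: moebius_locally_dominated.
- exact: (moebius_locally_dominated M'abcd).
- exact: lmeasurable_moebius_jac.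
- exact: lmeasurable_moebius_jac.
- by move=> x Wx; apply: ltW; exact: moebius_jac_gt0.
- by move=> x Wx; apply: ltW; exact: moebius_jac_gt0.
move=> x Wx; rewrite !moebius_jacE moebius_norm_den_inv// -exprMn.
by rewrite exprVn invrK mulVf ?expr1n// expf_neq0// cl_norm_neq0.
Qed.

Section ChangeOn.
Variable D : set 'rV[R]_n.
Hypotheses (mD : lmeasurable D) (DW' : D `<=` W').

Let mW : lmeasurable W.
Proof. by apply: borel_lmeasurable; exact: open_measurable_row. Qed.

Lemma lmeasurable_moebius_preimage : lmeasurable (W `&` M @^-1` D).
Proof.
apply: (lmeasurable_preimage oW MW NW MK NK _ _ mD).
  by move=> x Wx; exact: moebius_continuous.
exact: (moebius_locally_dominated M'abcd).
Qed.

Lemma lmeasurable_moebius_comp_on d0 (T : measurableType d0) (k : 'rV[R]_n -> T) :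
  measurable_fun (D : set (lebesgueT R n)) k ->
  measurable_fun (W `&` M @^-1` D : set (lebesgueT R n)) (k \o M).
Proof.
move=> mk mE Y mY.
have : lmeasurable (W `&` M @^-1` (D `&` k @^-1` Y)).
  apply: (lmeasurable_preimage oW MW NW MK NK).
  - by move=> x Wx; exact: moebius_continuous.
  - exact: (moebius_locally_dominated M'abcd).
  exact: mk.
congr (lmeasurable _).
by apply/seteqP; split => [x [Wx [Dx kx]]|x [[Wx Dx] kx]].
Qed.

Lemma moebius_change_on (k : 'rV[R]_n -> \bar R) :
  measurable_fun (D : set (lebesgueT R n)) k -> (forall y, D y -> 0 <= k y)%E ->
  (\int[lebesgue R n]_(x in W `&` M @^-1` D) (k (M x) * (J x)%:E) =
   \int[lebesgue R n]_(y in D) k y)%E.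
Proof.
move=> mk k0; have := @moebius_change (k \_ D).
rewrite -integral_mkcondr (setIidr DW') => <-; first last.
- by move=> y _; rewrite /patch; case: ifPn => // /set_mem; exact: k0.
- by apply: measurable_funTS; exact: (measurable_restrictT _ mD).1.
rewrite integral_mkcondr; apply: eq_integral => x _.
rewrite /patch; case: ifPn => [/set_mem Dx|/negP Dx]; first by rewrite mem_set.
by rewrite memNset ?mul0e// => /mem_set.
Qed.

Let EW : W `&` M @^-1` D `<=` W. Proof. exact: subIsetl. Qed.

Lemma moebius_integrable (f : 'rV[R]_n -> R) :
  (lebesgue R n).-integrable D (EFin \o f) ->
  (lebesgue R n).-integrable (W `&` M @^-1` D) (fun x => (f (M x) * J x)%:E).
Proof.
move=> /integrableP[mf foo]; apply/integrableP; split.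
  apply/measurable_EFinP; apply: measurable_funM.
    by apply: lmeasurable_moebius_comp_on; exact/measurable_EFinP.
  exact: measurable_funS mW EW (@lmeasurable_moebius_jac R n c d).
rewrite (eq_integral (fun x : lebesgueT R n => `|(f (M x))%:E| * (J x)%:E)%E).
  rewrite (@moebius_change_on (fun y => `|(f y)%:E|)%E).
  - exact: foo.
  - by apply: measurableT_comp; [exact: abse_measurable|exact: mf].
  by move=> y _; exact: abse_ge0.
move=> x /set_mem[Wx _]; rewrite EFinM abseM; congr (_ * _)%E.
by rewrite gee0_abs// lee_fin ltW// moebius_jac_gt0.
Qed.

Lemma Rintegral_moebius (f : 'rV[R]_n -> R) :
  (lebesgue R n).-integrable D (EFin \o f) ->
  \int[lebesgue R n]_(x in W `&` M @^-1` D) (f (M x) * J x) =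
  \int[lebesgue R n]_(y in D) f y.
Proof.
move=> /integrableP[mf foo]; rewrite /Rintegral; congr fine.
rewrite integralE [RHS]integralE; congr (_ - _)%E.
  rewrite -moebius_change_on; first last.
  - by move=> y _; exact: funepos_ge0.
  - exact: measurable_funepos.
  apply: eq_integral => x /set_mem[Wx _]; rewrite !funeposE EFinM.
  by rewrite maxe_pMl ?mul0e// lee_fin ltW// moebius_jac_gt0.
rewrite -moebius_change_on; first last.
- by move=> y _; exact: funeneg_ge0.
- exact: measurable_funeneg.
apply: eq_integral => x /set_mem[Wx _]; rewrite !funenegE EFinM -mulNe.
by rewrite maxe_pMl ?mul0e// lee_fin ltW// moebius_jac_gt0.
Qed.

End ChangeOn.

End MoebiusChange.

(** * Transfer of weak solutions *)

Section TestFunctions.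
Context {R : realType} {n : nat}.
Local Notation Cl := (clifford R n).
Implicit Types (g : 'rV[R]_n -> Cl) (U K : set 'rV[R]_n).

Lemma cl_test_function_support U g : cl_test_function U g ->
  exists K, [/\ compact K, K `<=` U & forall x, ~ K x -> g x = 0].
Proof.
move=> tg; pose s A := closure [set x | g x A != 0].
exists (\big[setU/set0]_(A <- enum {set 'I_n}) s A); split.
- by apply: bigsetU_compact => A _; have [_] := tg A.
- by rewrite -bigcup_seq; apply: bigcup_sub => A _; have [_ _] := tg A.
move=> x; rewrite -bigcup_seq => nK; apply/ffunP => A; rewrite ffunE.
apply: contrapT => gA; apply: nK; exists A; first by rewrite /= mem_enum.
exact/subset_closure/eqP.
Qed.

Lemma cl_test_functionP U g K : cl_smooth setT g -> compact K -> K `<=` U ->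
  (forall x, ~ K x -> g x = 0) -> cl_test_function U g.
Proof.
move=> sg cK KU gK A; have sK : closure [set x | g x A != 0] `<=` K.
  have clK : closed K by apply: compact_closed cK; exact: norm_hausdorff.
  rewrite [X in _ `<=` X]((closure_id K).1 clK); apply: closure_subset => x /=.
  by apply: contra_neqP => /gK ->; rewrite ffunE.
split; [exact: sg|exact: subclosed_compact (@closed_closure _ _) cK sK|].
exact: subset_trans KU.
Qed.

End TestFunctions.

(** The operator T: for monogenic functions, what the Kelvin transform is for harmonic ones. *)
Definition kelvin (R : realType) n (a b c d : clifford R n)
    (g : 'rV[R]_n -> clifford R n) (x : 'rV[R]_n) : clifford R n :=
  cl_norm (c * cl_vec x + d) `^ (- n%:R) *: cl_rev (c * cl_vec x + d) *
  g (moebius a b c d x).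

Section KelvinSmooth.
Context {R : realType} {n : nat}.
Local Notation Cl := (clifford R n).
Variables (a b c d : Cl).
Hypothesis Mabcd : moebius_coeffs a b c d.
Local Notation q x := (c * cl_vec x + d).
Local Notation W := [set x | q x != 0].

Lemma cl_smooth_kelvin g : cl_smooth setT g -> cl_smooth W (kelvin a b c d g).
Proof.
have oW := @open_moebius_dom R n c d; move=> sg; apply: cl_smoothM => //.
  have sq : cl_smooth W (fun x => q x) by exact: cl_smooth_moebius_den.
  apply: cl_smoothZ => //; last exact: cl_smooth_rev.
  exact: smooth_on_norm_powR.
apply: cl_smooth_comp sg _ _ => // j; exact: (smooth_on_moebius Mabcd).
Qed.

End KelvinSmooth.

Section Kelvin.
Context {R : realType} {n : nat}.
Local Notation Cl := (clifford R n).
Variables (a b c d : Cl).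
Hypothesis Mabcd : moebius_coeffs a b c d.
Hypothesis n_gt0 : (0 < n)%N.
Local Notation q x := (c * cl_vec x + d).
Local Notation M := (moebius a b c d).
Local Notation W := [set x | q x != 0].
Local Notation q' y := (- cl_rev c * cl_vec y + cl_rev a).
Local Notation M' := (moebius (cl_rev d) (- cl_rev b) (- cl_rev c) (cl_rev a)).
Local Notation W' := [set y | q' y != 0].
Local Notation kelvin' := (kelvin (cl_rev d) (- cl_rev b) (- cl_rev c) (cl_rev a)).

Let M'abcd := moebius_coeffs_inv Mabcd n_gt0.

Lemma kelvinK g x : q x != 0 -> kelvin a b c d (kelvin' g) x = g x.
Proof.
move=> qx; rewrite /kelvin moebius_den_inv// moebius_invK//.
have vq := moebius_den_vp Mabcd x.
rewrite vp_norm_inv// -powR_inv1 ?cl_norm_ge0// -powRrM mulN1r opprK.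
have Q0 : 0 < cl_norm (q x) by rewrite cl_norm_gt0.
move: (g x) => z; rewrite powRN; set s := _ `^ n%:R.
have s0 : s != 0 by rewrite gt_eqF// powR_gt0.
rewrite -!scalerAl -scalerAr scalerA mulVf// scale1r mulrA -cl_revM.
by rewrite mulVr ?vp_unit// cl_rev1 mul1r.
Qed.

(** The support lies in the image under [M] of the support of [g], a compact set on which the
    denominator of the inverse has no zero; so the singularity of the weight is never met. *)
Lemma kelvin_test_function U g : open U ->
  cl_test_function (moebius_preimage a b c d U) g -> cl_test_function U (kelvin' g).
Proof.
move=> oU tg; have [K [cK KV gK]] := cl_test_function_support tg.
have sg : cl_smooth setT g by move=> A; have [] := tg A.
have KW x : K x -> q x != 0 by case/KV.
have cL : compact (M @` K).
  apply: continuous_compact cK; apply: continuous_in_subspaceT => x /set_mem/KW qx.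
  exact: moebius_continuous.
have LU : M @` K `<=` U by move=> _ [x /KV[_ UMx] <-].
have g0 y : ~ (M @` K) y -> kelvin' g y = 0.
  (* Where [q' y] vanishes its reverse makes the product zero, whatever the values there of the
     power of 0 and of [M']. *)
  move=> nLy; rewrite /kelvin; have [->|q'y] := eqVneq (q' y) 0.
    by rewrite linear0 scaler0 mul0r.
  rewrite gK ?mulr0// => KM'y; apply: nLy; exists (M' y) => //.
  exact: moebiusK.
apply: (cl_test_functionP _ cL LU g0).
have [oW' oL] : open W' /\ open (~` (M @` K)).
  split; first exact: open_moebius_dom.
  by apply: closed_openC; apply: compact_closed cL; exact: norm_hausdorff.
(* Smoothness is local: on the image of [K] it comes from the formula on [W'], and elsewhere from
   vanishing on an open set. *)
move=> A s y _; have [[x Kx <-]|nLy] := pselect ((M @` K) y).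
  apply: (cl_smooth_kelvin M'abcd sg A s); exact/moebius_inv_den_neq0/KW.
apply: (@cl_smooth_eq _ _ (~` (M @` K)) (fun=> 0) _ oL _ _ A s) => //.
  by move=> z nLz; rewrite g0.
exact: cl_smooth_cst.
Qed.

End Kelvin.

Lemma dirac_op_test_function0 (R : realType) n (U : set 'rV[R]_n)
    (g : 'rV[R]_n -> clifford R n) x :
  cl_test_function U g -> ~ U x -> dirac_op g x = 0.
Proof.
move=> /cl_test_function_support[K [cK KU gK]] nUx.
have oK : open (~` K).
  by apply: closed_openC; apply: compact_closed cK; exact: norm_hausdorff.
rewrite (@eq_on_dirac_op _ _ (~` K) _ (fun=> 0) _ oK); first last.
- by move=> /KU.
- exact: gK.
by rewrite dirac_opE big1// => i _; rewrite cl_partial_cst mulr0.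
Qed.

Section WeakEquation.
Context {R : realType} {n : nat}.
Local Notation Cl := (clifford R n).
Local Notation lmeasurable E := (measurable (E : set (lebesgueT R n))).
Variables (a b c d : Cl).
Hypothesis Mabcd : moebius_coeffs a b c d.
Hypothesis n_gt0 : (0 < n)%N.
Local Notation q x := (c * cl_vec x + d).
Local Notation M := (moebius a b c d).
Local Notation W := [set x | q x != 0].
Local Notation q' y := (- cl_rev c * cl_vec y + cl_rev a).
Local Notation M' := (moebius (cl_rev d) (- cl_rev b) (- cl_rev c) (cl_rev a)).
Local Notation W' := [set y | q' y != 0].
Local Notation kelvin' := (kelvin (cl_rev d) (- cl_rev b) (- cl_rev c) (cl_rev a)).
Local Notation J := (moebius_jac c d).

(** [M] takes no value at which the denominator of the inverse vanishes, so it only sees the part of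
    [U] in [W'], where the change of variables applies. *)
Lemma moebius_preimageE U : moebius_preimage a b c d U = W `&` M @^-1` (U `&` W').
Proof.
apply/seteqP; split => [x [qx Ux]|x [qx [Ux _]]]; split => //; split => //.
exact: moebius_inv_den_neq0.
Qed.

Lemma moebius_preimage_dom U :
  moebius_preimage a b c d U = moebius_preimage a b c d (U `&` W').
Proof. by rewrite !moebius_preimageE -setIA setIid. Qed.

Lemma kelvin_test_function_dom U g : open U ->
  cl_test_function (moebius_preimage a b c d U) g ->
  cl_test_function (U `&` W') (kelvin' g).
Proof.
move=> oU; rewrite moebius_preimage_dom; apply: kelvin_test_function => //.
by apply: openI => //; exact: open_moebius_dom.
Qed.

(* The powers of |cx + d| have exponents p - n, 2 - p, -2 and -n, of sum -2n. *)
Lemma weak_integrand_moebius (p : R) g eta x : cl_smooth setT (kelvin' eta) -> q x != 0 ->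
  cl_conj ((cl_norm (q x) `^ (p - n%:R) * cl_norm ((q x)^-1 * g (M x)) `^ (p - 2)) *:
    ((q x)^-1 * g (M x))) * dirac_op eta x =
  J x *: (cl_conj (cl_norm (g (M x)) `^ (p - 2) *: g (M x)) * dirac_op (kelvin' eta) (M x)).
Proof.
move=> sxi qx; have vq := moebius_den_vp Mabcd x.
have uq : q x \is a GRing.unit by exact: vp_unit.
have Q0 : 0 < cl_norm (q x) by rewrite cl_norm_gt0.
have dxi : cl_diff (kelvin' eta) (M x) by exact: cl_smooth_diff sxi _.
have -> : dirac_op eta x =
    (q x)^-1 * (cl_norm (q x) `^ (- n%:R) *: dirac_op (kelvin' eta) (M x)).
  rewrite -(dirac_moebius Mabcd qx dxi) mulKr//.
  apply: (eq_on_dirac_op (@open_moebius_dom R n c d) _ qx) => y qy.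
  by rewrite -/(kelvin a b c d _ y) kelvinK.
rewrite vp_norm_mul_invl// /moebius_jac.
have cqV : cl_conj (q x)^-1 = cl_norm (q x) `^ (- 2%:R) *: q x.
  by rewrite vp_inv// linearZ/= cl_conjK powRN powR_mulrn// ltW.
move: (dirac_op _ _) => D; move: (g (M x)) => z.
rewrite !linearZ/= cl_conjM cqV.
move: (cl_norm_ge0 z) => z0; move: (cl_norm z) z0 => Z Z0; move: (cl_conj z) => {}z.
move: (q x) uq (cl_norm (q x)) Q0 => w uw Q Q0 {vq cqV}.
rewrite -!(scalerAr, scalerAl) !scalerA -!mulrA mulVKr//.
have -> : (Q^-1 * Z) `^ (p - 2) = Q `^ (- (p - 2)) * Z `^ (p - 2).
  by rewrite powRM ?invr_ge0 ?(ltW Q0)// -powR_inv1 ?(ltW Q0)// -powRrM mulN1r.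
congr (_ *: _).
have -> : Q `^ (- (2 * n)%:R) =
    Q `^ (p - n%:R) * Q `^ (- (p - 2)) * Q `^ (- 2%:R) * Q `^ (- n%:R).
  by rewrite -!powRD ?(gt_eqF Q0) ?implybT//; congr (_ `^ _); rewrite natrM; ring.
ring.
Qed.

Lemma weak_equation_moebius (p : R) U g eta : open U ->
  (forall xi, cl_test_function U xi ->
    let G y := cl_conj (cl_norm (g y) `^ (p - 2) *: g y) * dirac_op xi y in
    cl_integrable U G /\ cl_integral U G = 0) ->
  cl_test_function (moebius_preimage a b c d U) eta ->
  let F x := cl_conj ((cl_norm (q x) `^ (p - n%:R) *
      cl_norm ((q x)^-1 * g (M x)) `^ (p - 2)) *: ((q x)^-1 * g (M x))) *
    dirac_op eta x in
  cl_integrable (moebius_preimage a b c d U) F /\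
  cl_integral (moebius_preimage a b c d U) F = 0.
Proof.
move=> oU wg teta F; have txi := kelvin_test_function_dom oU teta.
have txiU : cl_test_function U (kelvin' eta).
  by exact: kelvin_test_function.
have [iG G0] := wg _ txiU; set G := fun y => _ in iG G0.
have sxi : cl_smooth setT (kelvin' eta) by move=> A; have [] := txi A.
have oW' : open W' by exact: open_moebius_dom.
have mU : lmeasurable U by apply: borel_lmeasurable; exact: open_measurable_row.
have mD : lmeasurable (U `&` W').
  by apply: borel_lmeasurable; apply: open_measurable_row; exact: openI.
have iD A : (lebesgue R n).-integrable (U `&` W') (EFin \o (fun y => G y A)).
  exact: (integrableS mU mD (@subIsetl _ _ _) (iG A)).
have FG x : q x != 0 -> forall A, F x A = G (M x) A * J x.
  by move=> qx A; rewrite /F weak_integrand_moebius// cl_scaleE mulrC.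
have mV := lmeasurable_moebius_preimage Mabcd n_gt0 mD.
rewrite moebius_preimageE; split.
  move=> A; have := moebius_integrable Mabcd n_gt0 mD (@subIsetr _ _ _) (iD A).
  by apply: eq_integrable => [|x /set_mem[qx _]]; [exact: mV|rewrite FG].
apply/ffunP => A; rewrite !ffunE.
have GA : \int[lebesgue R n]_(y in U) G y A = 0.
  by have /ffunP/(_ A) := G0; rewrite !ffunE.
(* The integrals over [U] and over [U] cut by [W'] agree: the transformed test function is supported
   in the latter, so its Dirac derivative vanishes off it. *)
rewrite -GA -[RHS](_ : \int[lebesgue R n]_(y in U `&` W') G y A = _).
  rewrite -(Rintegral_moebius Mabcd n_gt0 mD (@subIsetr _ _ _) (iD A)).
  by apply: eq_Rintegral => x /set_mem[qx _]; rewrite FG.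
rewrite /Rintegral; congr fine; rewrite integral_mkcondr; apply: eq_integral => y /set_mem Uy.
rewrite /patch; case: ifPn => // nWy; rewrite /G (dirac_op_test_function0 txi).
  by rewrite mulr0 ffunE.
by move=> [_ W'y]; move: nWy; rewrite mem_set.
Qed.

End WeakEquation.

(** * Local integrability of the transformed function and bounds for the weight *)

Lemma continuous_compact_le (R : realType) (T : topologicalType) (f : T -> R) (K : set T) :
  compact K -> (forall x, K x -> {for x, continuous f}) ->
  exists2 C, 0 <= C & forall x, K x -> f x <= C.
Proof.
move=> cK cf; have : compact (f @` K).
  by apply: continuous_compact cK; apply: continuous_in_subspaceT => x /set_mem/cf.
move=> /compact_bounded[C [_ fC]]; pose C1 := Num.max 0 (C + 1).
have CC1 : C < C1 by rewrite lt_max ltrDl ltr01 orbT.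
exists C1; first by rewrite le_max lexx.
by move=> x Kx; rewrite (le_trans (ler_norm _))//; apply: (fC _ CC1); exists x.
Qed.

(** The norm is at most the number of coefficients times the largest one; this works for exponents
    below 1 too, where p-th powers are not convex. *)
Lemma cl_norm_powR_le (R : realType) n (z : clifford R n) (p : R) : 0 <= p ->
  cl_norm z `^ p <= #|{set 'I_n}|%:R `^ p * \sum_A `|z A| `^ p.
Proof.
move=> p0; have [B _ zB] : exists2 B, true & forall A, `|z A| <= `|z B|.
  have [B _ h] := arg_maxP (P := predT) (fun A => `|z A|)
    (erefl : predT (finset.set0 : {set 'I_n})).
  by exists B => // A; exact: h.
have zN : cl_norm z <= #|{set 'I_n}|%:R * `|z B|.
  rewrite -[leRHS]ger0_norm ?mulr_ge0// -sqrtr_sqr ler_sqrt ?sqr_ge0//.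
  apply: (@le_trans _ _ (\sum_(A : {set 'I_n}) z B ^+ 2)).
    apply: ler_sum => A _; rewrite -[leLHS]ger0_norm ?sqr_ge0//.
    by rewrite -[leRHS]ger0_norm ?sqr_ge0// !normrX ler_sqr.
  rewrite sumr_const exprMn -normrX ger0_norm ?sqr_ge0// -[leLHS]mulr_natl.
  apply: ler_wpM2r; first exact: sqr_ge0.
  rewrite -natrX ler_nat; case: #|_| => // k; exact: leq_pmulr.
apply: (@le_trans _ _ (#|{set 'I_n}|%:R `^ p * `|z B| `^ p)).
  rewrite -powRM//; apply: ge0_ler_powR => //; rewrite nnegrE ?cl_norm_ge0//.
apply: ler_wpM2l; first exact: powR_ge0.
by rewrite (bigD1 B)//= lerDl sumr_ge0// => A _; exact: powR_ge0.
Qed.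

(** With q = cx + d, |q^-1 g(M x)|^p = |q|^(2n - p) |g(M x)|^p |q|^(-2n). The first factor is
    continuous, hence bounded on the compact [K], the last is the Jacobian, and the image of [K] is
    a compact subset of [U]. *)
Lemma cl_Lp_loc_moebius (R : realType) n (p : R) (U : set 'rV[R]_n)
    (g : 'rV[R]_n -> clifford R n) (a b c d : clifford R n) :
  (0 < n)%N -> 0 < p -> open U -> moebius_coeffs a b c d -> cl_Lp_loc p U g ->
  cl_Lp_loc p (moebius_preimage a b c d U)
    (fun x => (c * cl_vec x + d)^-1 * g (moebius a b c d x)).
Proof.
move=> n_gt0 p0 oU Mabcd Lg.
set q := fun x => c * cl_vec x + d; set M := moebius a b c d.
pose W := [set x | q x != 0].
pose W' := [set y | - cl_rev c * cl_vec y + cl_rev a != 0].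
pose lT := lebesgueT R n.
have oW : open W by exact: open_moebius_dom.
have oW' : open W' by exact: open_moebius_dom.
have MW' x : W x -> W' (M x) by exact: moebius_inv_den_neq0.
have mW : measurable (W : set lT) by apply: borel_lmeasurable; exact: open_measurable_row.
have mU : measurable (U : set lT) by apply: borel_lmeasurable; exact: open_measurable_row.
have mD : measurable (U `&` W' : set lT).
  by apply: borel_lmeasurable; apply: open_measurable_row; exact: openI.
have VW : moebius_preimage a b c d U `<=` W by move=> x [].
have mV : measurable (moebius_preimage a b c d U : set lT).
  by rewrite (moebius_preimageE Mabcd); exact: (lmeasurable_moebius_preimage Mabcd n_gt0).
have cq x (r : R) : W x -> {for x, continuous (fun x => cl_norm (q x) `^ r)}.
  move=> Wx; apply: differentiable_continuous.
  apply: (@smooth_on_differentiable _ _ W) => //.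
  by apply: smooth_on_norm_powR => //; exact: cl_smooth_moebius_den.
have mgM B : measurable_fun (moebius_preimage a b c d U : set lT)
    ((fun x => g (M x) B) : _ -> measurableTypeR R).
  rewrite (moebius_preimageE Mabcd).
  apply: (lmeasurable_moebius_comp_on Mabcd n_gt0 mD (k := fun y => g y B)).
  by have [mg _] := Lg B; exact: measurable_funS mU (@subIsetl _ _ _) mg.
have mf A : measurable_fun (moebius_preimage a b c d U : set lT)
    ((fun x => ((q x)^-1 * g (M x)) A) : _ -> measurableTypeR R).
  under eq_fun do rewrite cl_mulrE.
  apply: measurable_sum => B; apply: measurable_funM; last exact: mgM.
  apply: measurable_funM; first exact: measurable_cst.
  apply: (measurable_funS mW VW); apply: lmeasurable_continuous => // x Wx.
  apply: differentiable_continuous.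
  exact: smooth_on_differentiable (cl_smooth_moebius_den_inv Mabcd B) Wx.
move=> A; split; first exact: mf.
move=> K KV cK; have KsW : K `<=` W by apply: subset_trans KV VW.
have KW x : K x -> W x by exact: KsW.
have [C C0 qC] : exists2 C, 0 <= C & forall x, K x -> cl_norm (q x) `^ ((2 * n)%:R - p) <= C.
  by apply: continuous_compact_le => // x /KW Wx; exact: cq.
pose L := M @` K.
have cL : compact L.
  apply: continuous_compact cK; apply: continuous_in_subspaceT => x /set_mem/KW Wx.
  exact: (moebius_continuous Mabcd).
have LU : L `<=` U by move=> _ [x /KV[_ UMx] <-].
have LW' : L `<=` W' by move=> _ [x /KW Wx <-]; exact: MW'.
have mcpt (X : set 'rV[R]_n) : compact X -> measurable (X : set lT).
  move=> cX; apply: borel_lmeasurable; apply: closed_measurable_row.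
  by apply: compact_closed cX; exact: norm_hausdorff.
have mL := mcpt _ cL; have mK := mcpt _ cK.
have KE : W `&` M @^-1` L = K.
  apply/seteqP; split => [x [Wx [y Ky yx]]|x Kx]; last first.
    by split; [exact: KW|exists x].
  rewrite -(moebius_invK Mabcd n_gt0 Wx) -/M -yx.
  by rewrite (moebius_invK Mabcd n_gt0 (KW _ Ky)).
pose k y : \bar R := (\sum_B (`|g y B| `^ p)%:E)%E.
have mgp B : measurable_fun (L : set lT) (fun y => (`|g y B| `^ p)%:E).
  apply/measurable_EFinP; apply: (measurableT_comp (measurable_powR p)).
  apply: measurableT_comp; first exact: normr_measurable.
  by have [mg _] := Lg B; exact: measurable_funS mU LU mg.
have mk : measurable_fun (L : set lT) k by exact: emeasurable_sum.
have k0 y : (0 <= k y)%E by apply: sume_ge0 => B _; rewrite lee_fin powR_ge0.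
have kL : (\int[lebesgue R n]_(y in L) k y < +oo)%E.
  rewrite ge0_integral_sum; [|exact: mL|exact: mgp|]; last first.
    by move=> B y _; rewrite lee_fin powR_ge0.
  by apply: lte_sum_pinfty => B _; have [_] := Lg B; apply.
pose N := #|{set 'I_n}|%:R `^ p * C.
have N0 : 0 <= N by rewrite mulr_ge0// powR_ge0.
have mkM : measurable_fun (K : set lT) (fun x => k (M x) * (moebius_jac c d x)%:E)%E.
  apply: emeasurable_funM.
    by have := lmeasurable_moebius_comp_on Mabcd n_gt0 mL mk; rewrite KE.
  apply/measurable_EFinP.
  exact: measurable_funS mW KsW (@lmeasurable_moebius_jac R n c d).
have kM0 x : K x -> (0 <= k (M x) * (moebius_jac c d x)%:E)%E.
  by move=> /KW Wx; rewrite mule_ge0// lee_fin ltW// moebius_jac_gt0.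
apply: (@le_lt_trans _ _
  (\int[lebesgue R n]_(x in K) (N%:E * (k (M x) * (moebius_jac c d x)%:E)))%E).
  apply: ge0_le_integral; first exact: mK.
  - by move=> x _; rewrite lee_fin powR_ge0.
  - apply/measurable_EFinP; apply: (measurableT_comp (measurable_powR p)).
    apply: measurableT_comp; first exact: normr_measurable.
    exact: measurable_funS mV KV (mf A).
  - by apply: emeasurable_funM; [exact: measurable_cst|exact: mkM].
  move=> x Kx; have qx := KW _ Kx.
  have Q0 : 0 < cl_norm (q x) by rewrite cl_norm_gt0.
  rewrite /k sumEFin -!EFinM lee_fin.
  apply: (@le_trans _ _ (cl_norm ((q x)^-1 * g (M x)) `^ p)).
    apply: ge0_ler_powR; rewrite ?nnegrE ?cl_norm_ge0 ?(ltW p0)//.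
    exact: ler_cl_coord_norm.
  rewrite vp_norm_mul_invl//; last exact: (moebius_den_vp Mabcd).
  rewrite powRM ?invr_ge0 ?cl_norm_ge0// -powR_inv1 ?cl_norm_ge0// -powRrM mulN1r.
  have -> : cl_norm (q x) `^ (- p) =
      cl_norm (q x) `^ ((2 * n)%:R - p) * moebius_jac c d x.
    rewrite -powRD ?(gt_eqF Q0) ?implybT//; congr (_ `^ _); ring.
  have J0 := ltW (moebius_jac_gt0 qx).
  rewrite /N (mulrC _ C) -mulrA -mulrA.
  apply: ler_pM; rewrite ?powR_ge0 ?mulr_ge0 ?powR_ge0//; first exact: qC.
  rewrite mulrC mulrA; apply: ler_wpM2r => //.
  by apply: cl_norm_powR_le; exact: ltW.
rewrite ge0_integralZl; [|exact: mK|exact: mkM|exact: kM0|by rewrite lee_fin].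
rewrite -KE (moebius_change_on Mabcd n_gt0 mL LW' mk); last by move=> y _; exact: k0.
by rewrite lte_mul_pinfty// lee_fin.
Qed.

Lemma bounded_le (R : realType) (T : Type) (f : T -> R) (V : set T) (C : R) :
  (forall x, V x -> 0 <= f x <= C) -> [bounded f x | x in V].
Proof.
move=> fC; exists C; split; first exact: num_real.
move=> r /ltW Cr x Vx; have /andP[f0 fx] := fC _ Vx.
by rewrite /= ger0_norm// (le_trans fx).
Qed.

Lemma le0_ler_powR (R : realType) (r s t : R) : r <= 0 -> 0 < s -> s <= t ->
  t `^ r <= s `^ r.
Proof.
move=> r0 s0 st; have t0 := lt_le_trans s0 st.
rewrite -[r]opprK !(powRN _ (- r)) lef_pV2 ?posrE ?powR_gt0//.
by apply: ge0_ler_powR; rewrite ?nnegrE ?oppr_ge0// ltW.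
Qed.

(** For c = 0 the function is constant. Otherwise cx + d = c (x + w) vanishes only at -w, which is
    not in the closure of [V]: this bounds |x + w| from below on [V], enough if r <= 0. For bounded
    [V] the function is continuous on the compact closure. *)
Lemma moebius_den_bounded (R : realType) n (r : R) (V : set 'rV[R]_n)
    (a b c d : clifford R n) :
  moebius_coeffs a b c d -> (forall x, closure V x -> c * cl_vec x + d != 0) ->
  [\/ r <= 0, bounded_set V | c = 0] ->
  [bounded cl_norm (c * cl_vec x + d) `^ r | x in V].
Proof.
move=> Mabcd qV; set q := fun x => c * cl_vec x + d.
have [c0 _|c0] := eqVneq c 0.
  apply: (@bounded_le _ _ _ _ (cl_norm d `^ r)) => x _.
  by rewrite /q c0 mul0r add0r powR_ge0 lexx.
case=> [r0|[C [_ VC]]|/eqP]; last by rewrite (negbTE c0).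
  have vpc : is_vector_product c by case: Mabcd => -[].
  have [w dE] := moebius_den_factor Mabcd c0.
  have qE x : q x = c * cl_vec (x + w) by rewrite /q dE linearD/= mulrDr.
  have : ~ closure V (- w).
    by move=> /qV; rewrite -/(q _) qE addNr linear0 mulr0 eqxx.
  move=> /existsNP[B /not_implyP[]]; rewrite -filter_from_ballE => -[e /= e0 eB] nVB.
  apply: (@bounded_le _ _ _ _ ((cl_norm c * e) `^ r)) => x Vx; rewrite powR_ge0/=.
  apply: le0_ler_powR => //; first by rewrite mulr_gt0// cl_norm_gt0.
  rewrite -/(q x) qE vp_norm_mull// ler_wpM2l ?cl_norm_ge0//.
  rewrite leNgt; apply/negP => xe; apply: nVB; exists x; split => //; apply: eB.
  rewrite -ball_normE/= -opprD normrN addrC; apply: le_lt_trans xe.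
  apply/row_norm_leP; first exact: cl_norm_ge0.
  by move=> i; rewrite -enormE; exact: ler_coord_enorm.
pose X := closure V.
have cX : compact X.
  apply: bounded_closed_compact; last exact: closed_closure.
  exists (C + 1); split; first exact: num_real.
  move=> s Cs x Xx; rewrite /= leNgt; apply/negP => sx.
  have : \forall y \near x, s < `|y| by exact: (@norm_continuous _ _ x) _ (lt_nbhsr sx).
  move=> /Xx[y [Vy /= sy]]; move: sy; rewrite ltNge => /negP; apply.
  by apply: VC => //; apply: lt_trans Cs; rewrite ltrDl.
have [C1 _ AC] : exists2 C, 0 <= C & forall x, X x -> cl_norm (q x) `^ r <= C.
  apply: continuous_compact_le => // x /qV qx; apply: differentiable_continuous.
  apply: (@smooth_on_differentiable _ _ [set x | q x != 0]) => //.
  have oW := @open_moebius_dom R n c d.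
  by apply: smooth_on_norm_powR => //; exact: cl_smooth_moebius_den.
apply: (@bounded_le _ _ _ _ C1) => x Vx; rewrite powR_ge0 AC//.
exact: subset_closure.
Qed.

(** If p > n, c is non-zero and [V] is unbounded, then |cx + d|^(p - n) = |c (x + w)|^(p - n) is
    unbounded on [V]; boundedness of [A] is therefore asserted in the remaining cases. *)
Theorem theorem3 (R : realType) (n : nat) (p : R) (U : set 'rV[R]_n)
    (g : 'rV[R]_n -> clifford R n) (a b c d : clifford R n) :
  (3 <= n)%N -> 0 < p ->
  open U -> connected U ->
  p_dirac_weak_solution p U g ->
  moebius_coeffs a b c d ->
  (forall x, closure (moebius_preimage a b c d U) x ->
     c * cl_vec x + d != 0) ->
  let V := moebius_preimage a b c d U in
  let A := fun x : 'rV[R]_n => cl_norm (c * cl_vec x + d) `^ (p - n%:R) in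
  [/\ smooth_on V A,
      forall x, V x -> 0 < A x,
      [\/ p <= n%:R, bounded_set V | c = 0] -> [bounded A x | x in V] &
      Ap_dirac_weak_solution A p V
        (fun x => (c * cl_vec x + d)^-1 * g (moebius a b c d x))].
Proof.
move=> n3 p0 oU _ [Lg wg] Mabcd qV V A.
have n0 : (0 < n)%N by exact: leq_trans n3.
split.
- apply: (@smooth_onS _ _ V [set x | c * cl_vec x + d != 0]); first by move=> x [].
  have oW := @open_moebius_dom R n c d.
  by apply: smooth_on_norm_powR => //; exact: cl_smooth_moebius_den.
- by move=> x [qx _]; rewrite powR_gt0// cl_norm_gt0.
- rewrite -subr_le0; exact: moebius_den_bounded Mabcd qV.
split; first exact: cl_Lp_loc_moebius.
by move=> eta; exact: weak_equation_moebius.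
Qed.
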